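(* Let $X$ be a complex Banach space, $1<p<\infty$, let $(A,D(A))$ be the generator of a strongly continuous semigroup on $X$, let $\eta:[-1,0]\to\mathcal{L}(X)$ be of bounded variation, and let $\Phi f=\int_{-1}^0 d\eta\,f$ (Riemann–Stieltjes integral) for $f\in W^{1,p}([-1,0],X)$. Let $\mathcal{A}$ be the operator on $\mathcal{E}:=X\times L^p([-1,0],X)$ given by $$\mathcal{A}\begin{pmatrix}x\\ f\end{pmatrix}=\begin{pmatrix}Ax+\Phi f\\ f'\end{pmatrix},\qquad D(\mathcal{A})=\left\{\begin{pmatrix}x\\ f\end{pmatrix}\in D(A)\times W^{1,p}([-1,0],X)\ :\ f(0)=x\right\}.$$ Assume that $s_0(A)<0$ and let $\alpha\in(s_0(A),0]$. If $$\sup_{\omega\in\mathbb{R}}\left\|\Phi(\epsilon_{\alpha+i\omega}\otimes Id)\right\|<\frac{1}{\sup_{\omega\in\mathbb{R}}\|R(\alpha+i\omega,A)\|},$$ then $s_0(\mathcal{A})<\alpha\le 0$.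
   Context: For the generator $G$ of a strongly continuous semigroup, $R(\lambda,G)=(\lambda-G)^{-1}$ for $\lambda$ in the resolvent set $\varrho(G)$, and the abscissa of uniform boundedness of the resolvent is $$s_0(G):=\inf\left\{\omega\in\mathbb{R}\,:\,\{\Re\lambda>\omega\}\subset\varrho(G)\ \text{and}\ \sup_{\Re\lambda>\omega}\|R(\lambda,G)\|<\infty\right\}.$$ For $\lambda\in\mathbb{C}$, $\epsilon_\lambda(s):=e^{\lambda s}$ for $s\in[-1,0]$, and $\Phi(\epsilon_\lambda\otimes Id)\in\mathcal{L}(X)$ is the operator $x\mapsto\Phi(\epsilon_\lambda x)$, where $\epsilon_\lambda x$ is the function $s\mapsto e^{\lambda s}x$. Under the stated assumptions $(\mathcal{A},D(\mathcal{A}))$ generates a strongly continuous semigroup on $\mathcal{E}$. Elements of $W^{1,p}([-1,0],X)$ are identified with their continuous representatives. *)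

(* Defs.v *)
From HB Require Import structures.
From mathcomp Require Import all_boot all_order all_algebra.
From mathcomp Require Import generic_quotient ring_quotient complex.
From mathcomp Require Import all_classical all_reals all_analysis.
From mathcomp Require Import measurable_realfun.

Set Implicit Arguments.
Unset Strict Implicit.
Unset Printing Implicit Defensive.
Import Order.TTheory GRing.Theory Num.Theory.
Import numFieldNormedType.Exports.
Local Open Scope classical_set_scope.
Local Open Scope complex_scope.
Local Open Scope ring_scope.

(* The norm of a normed space over R[i] takes its values in R[i]; nrm is the
   same norm with values in R. *)
Definition nrm (R : realType) (V : normedZmodType R[i]) (x : V) : R :=
  complex.Re `|x|.

Section nrm_theory.
Context {R : realType}.

Lemma nrmE (V : normedZmodType R[i]) (x : V) : (nrm x)%:C = `|x|.
Proof.
rewrite /nrm; have := normr_ge0 x; case: `|x| => a b.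
by rewrite lecE /= => /andP[/eqP -> _].
Qed.

Lemma nrm_ge0 (V : normedZmodType R[i]) (x : V) : 0 <= nrm x.
Proof. by rewrite -lecR nrmE normr_ge0. Qed.

Lemma nrmD (V : normedZmodType R[i]) (x y : V) : nrm (x + y) <= nrm x + nrm y.
Proof. by rewrite -lecR rmorphD /= !nrmE ler_normD. Qed.

Lemma nrm0 (V : normedZmodType R[i]) : nrm (0 : V) = 0.
Proof. by rewrite /nrm normr0. Qed.

Lemma nrm0_eq0 (V : normedZmodType R[i]) (x : V) : nrm x = 0 -> x = 0.
Proof. by move=> x0; apply/eqP; rewrite -normr_eq0 -nrmE x0. Qed.

Lemma nrmZ (V : normedModType R[i]) (a : R[i]) (x : V) :
  nrm (a *: x) = nrm a * nrm x.
Proof.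
by apply: (@complexI R); rewrite rmorphM /= !nrmE normrZ.
Qed.

Lemma nrm_dist (V : normedZmodType R[i]) (x y : V) :
  `|nrm x - nrm y| <= nrm (x - y).
Proof.
have h (u v : V) : nrm u - nrm v <= nrm (u - v).
  by rewrite lerBlDr -{1}(subrK v u) nrmD.
rewrite ler_norml h andbT lerNl opprB.
by rewrite (le_trans (h _ _))// /nrm distrC.
Qed.

End nrm_theory.

Section bochner_Lp.
Context d (T : measurableType d) {R : realType}.
Variable X : normedModType R[i].

Definition simple_fun (s : T -> X) : Prop :=
  finite_set (range s) /\ forall x, measurable (s @^-1` [set x]).

(* Convergence is required everywhere rather than almost everywhere: every
   almost everywhere limit of simple functions agrees almost everywhere with
   an everywhere limit, so this yields the same space of classes. *)
Definition strongly_measurable (f : T -> X) : Prop :=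
  exists s : nat -> T -> X, (forall n, simple_fun (s n)) /\
    forall t, s n t @[n --> \oo] --> f t.

Lemma simple_fun_comp (Y : Type) (s : T -> X) (h : X -> Y) :
  simple_fun s -> finite_set (range (h \o s)) /\
    forall B : set Y, measurable ((h \o s) @^-1` B).
Proof.
move=> [fs ms]; split; first by rewrite -(image_comp s h); apply: (finite_image h fs).
move=> B.
have -> : (h \o s) @^-1` B =
    \bigcup_(x in range s `&` h @^-1` B) s @^-1` [set x].
  apply/seteqP; split => [t Bt|t [x [_ Bx] /= sx]]; last by rewrite /= sx.
  by exists (s t) => //; split => //; exists t.
by apply: fin_bigcup_measurable => //; apply: sub_finite_set fs => y [].
Qed.

Lemma simple_funD (s u : T -> X) :
  simple_fun s -> simple_fun u -> simple_fun (s \+ u).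
Proof.
move=> [fs ms] [fu mu]; split.
  apply: (@sub_finite_set _ _
    [set x.1 + x.2 | x in range s `*` range u]).
    by move=> _ [t _ <-]; exists (s t, u t) => //; split; exists t.
  by apply: finite_image; exact: finite_setX.
move=> x.
have -> : (s \+ u) @^-1` [set x] =
    \bigcup_(y in range s) (s @^-1` [set y] `&` u @^-1` [set x - y]).
  apply/seteqP; split => [t /= <-|t [y _ [/= -> ->]]].
    by exists (s t); [exists t|split => //=; rewrite addrC addKr].
  by rewrite addrC subrK.
by apply: fin_bigcup_measurable => // y _; exact: measurableI.
Qed.

Lemma strongly_measurable0 : strongly_measurable 0.
Proof.
exists (fun _ => 0); split => [_|t]; last exact: cvg_cst.
split.
  apply: (@sub_finite_set _ _ [set 0]) => //.
  by move=> _ [t _ <-].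
move=> x; rewrite preimage_cst; by case: ifP.
Qed.

Lemma strongly_measurableD (f g : T -> X) : strongly_measurable f ->
  strongly_measurable g -> strongly_measurable (f + g).
Proof.
move=> [s [ss sf]] [u [su ug]]; exists (fun n => s n \+ u n); split.
  by move=> n; exact: simple_funD.
by move=> t; apply: cvgD.
Qed.

Lemma strongly_measurableZ (a : R[i]) (f : T -> X) : strongly_measurable f ->
  strongly_measurable (a *: f).
Proof.
move=> [s [ss sf]]; exists (fun n => (fun x => a *: x) \o s n); split.
  by move=> n; have [fas mas] := simple_fun_comp (fun x => a *: x) (ss n).
by move=> t; apply: cvgZr.
Qed.

Lemma measurable_nrm (f : T -> X) : strongly_measurable f ->
  measurable_fun setT (@nrm R X \o f).
Proof.
move=> [s [ss sf]].
apply: (measurable_fun_cvg (h := fun n => @nrm R X \o s n)) => //.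
- move=> n _ B mB; rewrite setTI.
  by have [_] := simple_fun_comp (@nrm R X) (ss n); apply.
- move=> t _; apply/cvgrPdist_lt => e e0.
  have /cvgrPdist_lt/(_ e%:C) := sf t.
  rewrite ltcR => /(_ e0); apply: filterS => n /= h.
  by rewrite (le_lt_trans (nrm_dist _ _))// -ltcR nrmE.
Qed.

Variables (mu : {measure set T -> \bar R}) (p : R) (p1 : 1 <= p).

Definition Lpnorm (f : T -> X) : \bar R :=
  'N[mu]_(p%:E)[EFin \o (@nrm R X \o f)]%E.

Lemma Lpnorm_le (f g : T -> R) :
  measurable_fun setT f -> measurable_fun setT g ->
  (forall t, 0 <= f t <= g t) ->
  ('N[mu]_(p%:E)[EFin \o f] <= 'N[mu]_(p%:E)[EFin \o g])%E.
Proof using p1.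
move=> mf mg fg; have p0 : 0 <= p by rewrite (le_trans _ p1).
have mpow (h : T -> R) : measurable_fun setT h ->
    measurable_fun setT (fun t => (`|h t| `^ p)%:E).
  move=> mh; apply/measurable_EFinP.
  apply: (@measurableT_comp _ _ _ _ _ _ (@powR R ^~ p)) => //.
  exact: measurableT_comp.
rewrite unlock /=; apply: gt0_ler_poweR.
- by rewrite invr_ge0.
- by rewrite in_itv /= leey andbT integral_ge0// => t _; rewrite lee_fin powR_ge0.
- by rewrite in_itv /= leey andbT integral_ge0// => t _; rewrite lee_fin powR_ge0.
apply: ge0_le_integral => //; try exact: mpow.
move=> t _; rewrite lee_fin ge0_ler_powR ?nnegrE//.
by have /andP[f0 fgt] := fg t; rewrite !ger0_norm// (le_trans f0).
Qed.

Lemma LpnormD (f g : T -> X) :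
  strongly_measurable f -> strongly_measurable g ->
  (Lpnorm (f + g)%R <= Lpnorm f + Lpnorm g)%E.
Proof using p1.
move=> mf mg; apply: le_trans; last first.
  apply: (minkowski_EFin mu (f := @nrm R X \o f) (g := @nrm R X \o g)) => //;
  exact: measurable_nrm.
apply: Lpnorm_le; first exact/measurable_nrm/strongly_measurableD.
  by apply: measurable_funD; exact: measurable_nrm.
by move=> t; rewrite nrm_ge0 nrmD.
Qed.

Lemma LpnormZ (a : R[i]) (f : T -> X) : strongly_measurable f ->
  Lpnorm (a *: f) = ((nrm a)%:E * Lpnorm f)%E.
Proof using p1.
move=> mf; have p0 : 0 < p by rewrite (lt_le_trans _ p1).
rewrite /Lpnorm unlock.
under eq_integral => t _ do rewrite /= nrmZ normrM powRM// EFinM.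
rewrite ge0_integralZl//=; last first.
  apply/measurable_EFinP.
  apply: (@measurableT_comp _ _ _ _ _ _ (@powR R ^~ p)) => //.
  by apply: measurableT_comp => //; exact: measurable_nrm.
rewrite poweRM ?lee_fin ?powR_ge0//; last first.
  by apply: integral_ge0 => t _; rewrite lee_fin powR_ge0.
rewrite poweR_EFin -powRrM mulfV ?gt_eqF// powRr1//.
by rewrite ger0_norm ?nrm_ge0.
Qed.

(* The argument 1 <= p is only there so that the closure properties below can
   be registered as canonical instances. *)
Definition Lpfun of 1 <= p : {pred T -> X} :=
  mem [set f | strongly_measurable f /\ (Lpnorm f < +oo)%E].

Lemma Lpnorm0 : Lpnorm 0 = 0%E.
Proof using p1.
have -> : (0 : T -> X) = (0 : R[i]) *: (0 : T -> X) by rewrite scale0r.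
rewrite LpnormZ; last exact: strongly_measurable0.
by rewrite nrm0 mul0e.
Qed.

Lemma Lpfun_submod_closed : submod_closed (Lpfun p1).
Proof.
split.
  rewrite inE/=; split; first exact: strongly_measurable0.
  by rewrite Lpnorm0.
move=> a f g; rewrite !inE/= => -[mf ff] [mg fg].
have maf := strongly_measurableZ a mf.
split; first exact: strongly_measurableD.
rewrite (le_lt_trans (LpnormD maf mg))// lte_add_pinfty// LpnormZ//.
by rewrite lte_mul_pinfty// lee_fin nrm_ge0.
Qed.

HB.instance Definition _ := GRing.isSubmodClosed.Build _ _ (Lpfun p1)
  Lpfun_submod_closed.


Record Lpfun_type := LpfunType { Lpfun_val : T -> X; _ : Lpfun_val \in Lpfun p1 }.

HB.instance Definition _ := [isSub for Lpfun_val].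
HB.instance Definition _ := [Choice of Lpfun_type by <:].
HB.instance Definition _ := [SubChoice_isSubLmodule of Lpfun_type by <:].

Definition Lpnull : {pred Lpfun_type} :=
  mem [set f : Lpfun_type | {ae mu, forall t, Lpfun_val f t = 0}].

Lemma Lpnull_submod_closed : submod_closed Lpnull.
Proof.
split.
  by rewrite inE/=; apply: nearW => t.
move=> a f g; rewrite !inE/= => f0 g0.
by apply: filterS2 f0 g0 => t /= f0 g0; rewrite !fctE f0 g0 scaler0 addr0.
Qed.

HB.instance Definition _ := GRing.isSubmodClosed.Build _ _ Lpnull
  Lpnull_submod_closed.

Definition Lp : Type := @Quotient.quot Lpfun_type Lpnull.

HB.instance Definition _ := Choice.on Lp.
HB.instance Definition _ := GRing.Zmodule.on Lp.
HB.instance Definition _ := EqQuotient.on Lp.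
HB.instance Definition _ := ZmodQuotient.on Lp.

Local Open Scope quotient_scope.

Definition Lpscale (a : R[i]) (F : Lp) : Lp := \pi_Lp (a *: repr F).

Lemma Lpscale_pi a (f : Lpfun_type) : Lpscale a (\pi_Lp f) = \pi_Lp (a *: f).
Proof.
apply/eqP; rewrite -Quotient.idealrBE -scalerBr rpredZ//.
by rewrite Quotient.idealrBE reprK.
Qed.

Lemma Lp_piD (f g : Lpfun_type) : \pi_Lp (f + g) = \pi_Lp f + \pi_Lp g.
Proof. exact: raddfD. Qed.

Lemma LpscaleA a b F : Lpscale a (Lpscale b F) = Lpscale (a * b) F.
Proof.
elim/quotW: F => f.
by rewrite (Lpscale_pi b) (Lpscale_pi a) (Lpscale_pi (a * b)) scalerA.
Qed.

Lemma Lpscale1 : left_id 1 Lpscale.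
Proof. by elim/quotW => f; rewrite Lpscale_pi scale1r. Qed.

Lemma LpscaleDr : right_distributive Lpscale +%R.
Proof.
move=> a; elim/quotW => f; elim/quotW => g.
rewrite (Lpscale_pi a f) (Lpscale_pi a g) -!Lp_piD.
by rewrite (Lpscale_pi a) scalerDr.
Qed.

Lemma LpscaleDl F : {morph Lpscale^~ F : a b / a + b}.
Proof.
elim/quotW: F => f a b.
rewrite (Lpscale_pi (a + b)) (Lpscale_pi a) (Lpscale_pi b) scalerDl.
by rewrite Lp_piD.
Qed.

HB.instance Definition _ := GRing.Zmodule_isLmodule.Build R[i] Lp
  LpscaleA Lpscale1 LpscaleDr LpscaleDl.

Definition Lp_fun (F : Lp) : T -> X := Lpfun_val (repr F).

Lemma Lp_funP F : strongly_measurable (Lp_fun F) /\ (Lpnorm (Lp_fun F) < +oo)%E.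
Proof. by have := valP (repr F); rewrite inE. Qed.

Lemma Lp_fun_pi (f : Lpfun_type) :
  {ae mu, forall t, Lp_fun (\pi_Lp f) t = Lpfun_val f t}.
Proof.
have : repr (\pi_Lp f) - f \in Lpnull by rewrite Quotient.idealrBE reprK.
rewrite inE/=; apply: filterS => t /= /eqP.
by rewrite subr_eq0 => /eqP.
Qed.

Lemma Lp_funD F G : {ae mu, forall t, Lp_fun (F + G) t = Lp_fun F t + Lp_fun G t}.
Proof.
have := Lp_fun_pi (repr F + repr G).
by rewrite Lp_piD !reprK; apply: filterS.
Qed.

Lemma Lp_funZ a F : {ae mu, forall t, Lp_fun (a *: F) t = a *: Lp_fun F t}.
Proof. by have := Lp_fun_pi (a *: repr F); apply: filterS. Qed.

Lemma eq_Lpnorm (f g : T -> X) :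
  strongly_measurable f -> strongly_measurable g ->
  {ae mu, forall t, f t = g t} -> Lpnorm f = Lpnorm g.
Proof.
move=> mf mg fg; rewrite /Lpnorm unlock; congr (_ `^ _)%E.
have mpow (h : T -> X) : strongly_measurable h ->
    measurable_fun setT (fun t => (`|(EFin \o (@nrm R X \o h)) t| `^ p)%E).
  move=> mh; apply/measurable_EFinP.
  apply: (@measurableT_comp _ _ _ _ _ _ (@powR R ^~ p)) => //.
  by apply: measurableT_comp => //; exact: measurable_nrm.
apply: ae_eq_integral => //; try exact: mpow.
by apply: filterS fg => t /= -> _.
Qed.

Definition Lp_norm (F : Lp) : R[i] := (fine (Lpnorm (Lp_fun F)))%:C.

Lemma Lp_norm_fin F : (fine (Lpnorm (Lp_fun F)))%:E = Lpnorm (Lp_fun F).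
Proof.
rewrite fineK// ge0_fin_numE ?Lnorm_ge0//.
by have [] := Lp_funP F.
Qed.

Lemma Lp_normD F G : Lp_norm (F + G) <= Lp_norm F + Lp_norm G.
Proof.
rewrite -rmorphD lecR -lee_fin EFinD !Lp_norm_fin.
have [mF _] := Lp_funP F; have [mG _] := Lp_funP G.
have [mFG _] := Lp_funP (F + G).
apply: le_trans (LpnormD mF mG).
rewrite (eq_Lpnorm mFG (strongly_measurableD mF mG))//; exact: Lp_funD.
Qed.

Lemma Lp_normZ a F : Lp_norm (a *: F) = `|a| * Lp_norm F.
Proof.
have [mF _] := Lp_funP F; have [maF _] := Lp_funP (a *: F).
rewrite -nrmE -rmorphM; congr (_%:C); apply: EFin_inj.
rewrite EFinM !Lp_norm_fin -LpnormZ//.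
by apply: eq_Lpnorm (Lp_funZ a F) => //; exact: strongly_measurableZ.
Qed.

Lemma Lp_norm0_eq0 F : Lp_norm F = 0 -> F = 0.
Proof.
move=> /(congr1 (@complex.Re R))/= F0.
have [mF _] := Lp_funP F.
have /Lnorm_eq0_eq0 : Lpnorm (Lp_fun F) = 0%E by rewrite -Lp_norm_fin F0.
have mN : measurable_fun setT (EFin \o (@nrm R X \o Lp_fun F)).
  by apply/measurable_EFinP; exact: measurable_nrm.
move=> /(_ mN); rewrite lte_fin (lt_le_trans _ p1)// => /(_ isT) N0.
rewrite -[F]reprK; apply/eqP.
have -> : (0 : Lp) = \pi_Lp 0 by rewrite raddf0.
rewrite -Quotient.idealrBE subr0 inE /=.
by apply: filterS N0 => t /(_ I) [] /nrm0_eq0.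
Qed.

HB.instance Definition _ := Lmodule_isNormed.Build R[i] Lp
  Lp_normD Lp_normZ Lp_norm0_eq0.

End bochner_Lp.

Arguments Lp {d T R} X mu {p} p1.
Arguments Lp_fun {d T R X mu p p1} F.
Coercion Lp_fun : Lp >-> Funclass.

Section bochner_integral.
Context d (T : measurableType d) {R : realType}.
Variables (X : normedModType R[i]) (mu : {measure set T -> \bar R}).

Definition simple_integral (s : T -> X) : X :=
  \sum_(x \in range s) (fine (mu (s @^-1` [set x])))%:C *: x.

Definition is_bochner_integral (f : T -> X) (v : X) : Prop :=
  strongly_measurable f /\
  exists s : nat -> T -> X,
    [/\ forall n, simple_fun (s n),
        forall n, mu.-integrable setT (EFin \o (@nrm R X \o s n)),
        (\int[mu]_t (nrm (f t - s n t))%:E)%E @[n --> \oo] --> 0%E &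
        simple_integral (s n) @[n --> \oo] --> v].

Definition bochner_integral (f : T -> X) : X := get (is_bochner_integral f).

End bochner_integral.

Section operators.
Context {R : realType}.

Definition bounded_operator (V : normedModType R[i]) (S : V -> V) : Prop :=
  linear S /\ continuous S.

Definition opnorm (V W : normedModType R[i]) (S : V -> W) : \bar R :=
  ereal_sup [set (nrm (S x))%:E | x in [set x | nrm x <= 1]].

(* The values of op_fun outside op_dom are irrelevant. *)
Record unbounded_operator (V : normedModType R[i]) := UnboundedOperator {
  op_dom : set V;
  op_fun : V -> V
}.

Definition resolvent (V : normedModType R[i]) (G : unbounded_operator V) (lambda : R[i])
    (y : V) : V :=
  get [set x | op_dom G x /\ lambda *: x - op_fun G x = y].

Definition resolvent_set (V : normedModType R[i]) (G : unbounded_operator V) : set R[i] :=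
  [set lambda |
    set_bij (op_dom G) setT (fun x => lambda *: x - op_fun G x) /\
    (opnorm (resolvent G lambda) < +oo)%E].

(* s_0(G), in the extended reals: the infimum of the empty set is +oo, and
   s_0(G) = -oo may happen. *)
Definition s0 (V : normedModType R[i]) (G : unbounded_operator V) : \bar R :=
  ereal_inf [set w%:E | w in [set w : R |
    [set lambda | w < complex.Re lambda] `<=` resolvent_set G /\
    (ereal_sup [set opnorm (resolvent G lambda) |
       lambda in [set lambda : R[i] | (w < complex.Re lambda)%R]] < +oo)%E]].

Definition C0_semigroup (V : normedModType R[i]) (S : R -> {linear V -> V}) :=
  [/\ forall t, 0 <= t -> continuous (S t),
      forall x, S 0 x = x,
      forall t u x, 0 <= t -> 0 <= u -> S (t + u) x = S t (S u x) &
      forall x, {within `[0, +oo[, continuous (fun t => S t x)}].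

Definition is_generator (V : normedModType R[i]) (G : unbounded_operator V) : Prop :=
  exists S : R -> {linear V -> V}, C0_semigroup S /\
    forall x y, (op_dom G x /\ op_fun G x = y) <->
      (h^-1)%:C *: (S h x - x) @[h --> 0^'+] --> y.

End operators.

Section delay.
Context {R : realType}.
Variable X : normedModType R[i].

Definition cexp (z : R[i]) : R[i] :=
  (expR (complex.Re z))%:C *
  (cos (complex.Im z) +i* sin (complex.Im z)).

(* a :: s is a partition of [a, b]; in RS_sum below, tau i is a point of its
   i-th interval. *)
Definition bounded_variation_op (a b : R) (eta : R -> X -> X) : Prop :=
  exists M : R, forall s, itv_partition a b s ->
    (\sum_(i < size s)
       opnorm (fun x => eta (nth b s i) x - eta (nth b (a :: s) i) x)%R
     <= M%:E)%E.

Definition RS_sum (a b : R) (eta : R -> X -> X) (f : R -> X) (s : seq R)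
    (tau : nat -> R) : X :=
  \sum_(i < size s)
    (eta (nth b s i) (f (tau i)) - eta (nth b (a :: s) i) (f (tau i))).

Definition is_RS_integral (a b : R) (eta : R -> X -> X) (f : R -> X) (v : X) :=
  forall e : R, 0 < e -> exists2 delta : R, 0 < delta &
    forall (s : seq R) (tau : nat -> R), itv_partition a b s ->
      (forall i, (i < size s)%N ->
         nth b s i - nth b (a :: s) i < delta /\
         nth b (a :: s) i <= tau i <= nth b s i) ->
      nrm (RS_sum a b eta f s tau - v) < e.

Definition RS_integral (a b : R) (eta : R -> X -> X) (f : R -> X) : X :=
  get (is_RS_integral a b eta f).

Definition mu10 : {measure set (measurableTypeR R) -> \bar R} :=
  mrestr lebesgue_measure (measurable_itv `[(-1 : R), 0]).

(* C^1 functions with compact support in the open interval ]-1, 0[; real-valued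
   test functions suffice, by linearity of the integral. *)
Definition test_function (phi : R -> R) : Prop :=
  [/\ forall t, derivable phi t 1,
      continuous (derive1 phi) &
      exists a b, [/\ -1 < a, b < 0 &
        forall t, ~ (a <= t <= b) -> phi t = 0]].

Variables (p : R) (p1 : 1 <= p).

Definition is_weak_derivative (F G : Lp X mu10 p1) : Prop :=
  forall phi, test_function phi ->
    bochner_integral mu10 (fun t : measurableTypeR R => (derive1 phi t)%:C *: F t) =
    - bochner_integral mu10 (fun t : measurableTypeR R => (phi t)%:C *: G t).

(* f is a W^{1,p} function when it has a weak derivative in L^p. Elements of
   W^{1,p} are evaluated pointwise through continuous_rep, which is determined
   on [-1, 0]. *)
Definition W1p : set (Lp X mu10 p1) :=
  [set F | exists G, is_weak_derivative F G].

Definition weak_derivative (F : Lp X mu10 p1) : Lp X mu10 p1 :=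
  get (is_weak_derivative F).

Definition is_continuous_rep (F : Lp X mu10 p1) (f : R -> X) : Prop :=
  {within `[(-1), 0], continuous f} /\
  {ae mu10, forall t : measurableTypeR R, F t = f t}.

Definition continuous_rep (F : Lp X mu10 p1) : R -> X :=
  get (is_continuous_rep F).

Variable eta : R -> X -> X.

Definition Phi (f : R -> X) : X := RS_integral (-1) 0 eta f.

Definition Phi_exp (lambda : R[i]) (x : X) : X :=
  Phi (fun t => cexp (lambda * t%:C) *: x).

(* The product X * L^p carries the library's max norm; any product norm is
   equivalent to it and gives the same s0. *)
Definition delay_operator (A : unbounded_operator X) :
    unbounded_operator (X * Lp X mu10 p1)%type :=
  UnboundedOperator
    [set u | [/\ op_dom A u.1, W1p u.2 & continuous_rep u.2 0 = u.1]]
    (fun u => (op_fun A u.1 + Phi (continuous_rep u.2), weak_derivative u.2)).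

End delay.

(* Main.v *)
Require Import Defs.
From HB Require Import structures.
From mathcomp Require Import all_boot all_order all_algebra.
From mathcomp Require Import finmap complex ring lra.
From mathcomp Require Import all_classical all_reals all_analysis.
From mathcomp Require Import measurable_realfun.

Set Implicit Arguments.
Unset Strict Implicit.
Unset Printing Implicit Defensive.
Import Order.TTheory GRing.Theory Num.Theory.
Import numFieldNormedType.Exports HBSimple.
Local Open Scope classical_set_scope.
Local Open Scope complex_scope.
Local Open Scope ring_scope.

(** The equation [(l - AA) (x, F) = (y, G)] for the delay operator [AA] forces
    [F t = exp (l t) (x + int_t^0 exp (- l s) G s ds)] and leaves
    [(l - A) x - Phi (eps_l x) = y'], where [y'] depends boundedly on [(y, G)].
    Put [z = (l - A) x]: this is [z = y' + Phi (eps_l R(l, A) z)], which a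
    contraction argument solves, uniformly in [l], as soon as
    [|Phi (eps_l (x) Id)| |R(l, A)| <= q < 1].

    The hypothesis gives such a bound on the line [Re l = alpha]. Both
    [l |-> Phi (eps_l x)] and [l |-> R(l, A) x] are bounded and holomorphic to
    the right of that line, so that the three lines theorem extends their
    bounds to [Re l >= alpha]; and they are Lipschitz in [Re l] uniformly in
    [Im l], so that the product of the norms stays below some [q < 1] for
    [Re l > alpha - d]. Hence [s_0(AA) <= alpha - d].

    Holomorphy enters only through the mean value estimate
    [f (l + r) + f (l - r) + f (l + i r) + f (l - i r) - 4 f l = O(r^3)], which
    can be read off the exponentials under the integral and the resolvent
    identity. It makes the supremum of [|f|] on vertical lines convex up to
    [o(r^2)], and a bounded convex function on a half line is nonincreasing. *)

(** The hypothesis compares two separate suprema, and this is the form that the half-plane argument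
    can use: for each fixed vector x the functions [l |-> Phi_exp eta l x] and
    [l |-> resolvent A l x] are treated independently, and a bound on the line that is a multiple of
    the norm of x passes to the half plane vector by vector. Strictness of the conclusion costs a
    further step to the left of alpha, for which s_0(A) < alpha provides the room.

    Much of the work goes into showing that the exponential formula gives the only solution in
    W^{1,p}. The operations [weak_derivative], [continuous_rep], the integrals and the resolvents
    are values of [get], so that existence and uniqueness must be proved before anything is known
    about them. Multiplying the weak equation F' = l F - G by exp(-l t) and removing a primitive
    leaves a function with weak derivative zero, which the du Bois-Reymond lemma makes constant.
    Since the datum x = f(0) sits at the right end, primitives run from t to 0 and their derivative
    carries a minus sign. *)

Section nrm_extra.
Context {R : realType}.

(** A positive element of [R[i]] is real, so real radii are enough to describe neighbourhoods. *)
Lemma cvg_nrmP (V : normedModType R[i]) (T : Type) (F : set_system T)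
    (FF : Filter F) (f : T -> V) (l : V) :
  f @ F --> l <-> forall e : R, 0 < e -> \forall t \near F, nrm (l - f t) < e.
Proof.
split=> [/cvgrPdist_lt h e e0|h].
  have := h e%:C; rewrite ltcR => /(_ e0); apply: filterS => t.
  by rewrite -nrmE ltcR.
apply/cvgrPdist_lt => -[a b]; rewrite ltcE /= => /andP[/eqP b0 a0].
have := h _ a0; apply: filterS => t; rewrite -nrmE b0; by rewrite ltcR.
Qed.

Lemma nrmN (V : normedZmodType R[i]) (x : V) : nrm (- x) = nrm x.
Proof. by rewrite /nrm normrN. Qed.

Lemma nrm_distC (V : normedZmodType R[i]) (x y : V) : nrm (x - y) = nrm (y - x).
Proof. by rewrite -nrmN opprB. Qed.

Lemma nrm_sum (V : normedZmodType R[i]) (I : Type) (r : seq I) (P : pred I) (F : I -> V) :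
  nrm (\sum_(i <- r | P i) F i) <= \sum_(i <- r | P i) nrm (F i).
Proof.
elim/big_ind2 : _ => [|x a y b xa yb|//]; first by rewrite nrm0.
by rewrite (le_trans (nrmD _ _))// lerD.
Qed.

Lemma nrmB_le (V : normedZmodType R[i]) (x y z : V) :
  nrm (x - z) <= nrm (x - y) + nrm (y - z).
Proof. by rewrite (le_trans _ (nrmD _ _))// addrA subrK. Qed.

Lemma nrm_le0 (V : normedZmodType R[i]) (x : V) : nrm x <= 0 -> x = 0.
Proof. by move=> x0; apply: nrm0_eq0; apply/eqP; rewrite eq_le x0 nrm_ge0. Qed.

Lemma nrm_lt_eq (V : normedZmodType R[i]) (x y : V) :
  (forall e : R, 0 < e -> nrm (x - y) < e) -> x = y.
Proof.
move=> h; apply/eqP; rewrite -subr_eq0; apply/eqP/nrm_le0/ler_addgt0Pr => e /h.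
by rewrite add0r; exact: ltW.
Qed.

Lemma nrmM (a b : R[i]) : nrm (a * b) = nrm a * nrm b.
Proof. by apply: (@complexI R); rewrite rmorphM /= !nrmE normrM. Qed.

Lemma nrm_real (a : R) : nrm a%:C = `|a|.
Proof. by apply: (@complexI R); rewrite nrmE normc_def /= expr0n /= addr0 sqrtr_sqr. Qed.

Lemma nrm1 : nrm (1 : R[i]) = 1.
Proof. by rewrite -[1]/(1%:C) nrm_real normr1. Qed.

Lemma nrmi : nrm ('i : R[i]) = 1.
Proof. by apply: (@complexI R); rewrite nrmE normc_def /= expr0n /= add0r expr1n sqrtr1. Qed.

Lemma nrm_prod (V W : normedModType R[i]) (u : V * W) :
  nrm u = Num.max (nrm u.1) (nrm u.2).
Proof.
apply: (@complexI R); rewrite nrmE prod_normE -!nrmE.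
case: (leP (nrm u.1) (nrm u.2)) => h; rewrite /Num.max.
  case: ifPn => //; rewrite ltcR -leNgt => h'.
  by congr (_%:C); apply/eqP; rewrite eq_le h h'.
by rewrite ltcR ltNge (ltW h).
Qed.

Lemma nrm_complex (a b : R) : nrm (a +i* b) <= `|a| + `|b|.
Proof.
have -> : a +i* b = a%:C + 'i * b%:C.
  by apply/eqP; rewrite eq_complex /= !(mul0r,mul1r,mulr0,subr0,add0r,addr0) !eqxx.
by rewrite (le_trans (nrmD _ _))// nrmM nrmi mul1r !nrm_real.
Qed.

Lemma continuous_nrm (V : normedModType R[i]) : continuous (@nrm R V).
Proof.
move=> x; apply/cvgrPdist_lt => e e0.
have /cvg_nrmP/(_ e e0) : id y @[y --> x] --> x by exact: cvg_id.
by apply: filterS => y; exact/le_lt_trans/nrm_dist.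
Qed.

End nrm_extra.

(** * Three lines on a half plane *)

Section half_plane.
Context {R : realType}.

(** Slopes of the chords from index 0 increase along a convex sequence; the inequality is cleared of
    denominators. *)
Lemma convex_seq_ratio (g : nat -> R) :
  (forall k, 2 * g k.+1 <= g k.+2 + g k) ->
  forall k N, (k <= N)%N -> N%:R * (g k - g 0%N) <= k%:R * (g N - g 0%N).
Proof.
move=> gc.
(* The increments increase, so the first [k] of them are each at most the next one. *)
have slope k : g k - g 0%N <= k%:R * (g k.+1 - g k).
  elim: k => [|k IH]; first by rewrite subrr mul0r.
  have := gc k; move: (g k.+1) (g k) (g k.+2) IH => b c d IH h.
  apply: (@le_trans _ _ ((k.+1)%:R * (b - c))).
    by rewrite -natr1 mulrDl mul1r; lra.
  by rewrite ler_wpM2l ?ler0n//; lra.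
move=> k; elim=> [|N IH]; first by rewrite leqn0 => /eqP ->; rewrite !mul0r.
rewrite leq_eqVlt => /orP[/eqP ->//|]; rewrite ltnS => kN.
have := IH kN; case: (posnP N) => [N0|N0].
  by move: kN; rewrite N0 leqn0 => /eqP -> _; rewrite subrr mul0r mulr0.
move=> h; have := slope N; move: (g k - g 0%N) h => u h.
have -> : g N - g 0%N = N.+1%:R * (g N - g 0%N) - N%:R * (g N - g 0%N).
  by rewrite -natr1; ring.
move=> s.
have Np : (0 < N%:R :> R) by rewrite ltr0n.
rewrite -(ler_pM2l Np).
apply: (@le_trans _ _ (N.+1%:R * (k%:R * (g N - g 0%N)))).
  by rewrite mulrCA ler_wpM2l ?ler0n.
rewrite mulrCA [leRHS]mulrCA ler_wpM2l ?ler0n//.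
by move: s; lra.
Qed.

(** The sequence [eps / 2 * k ^+ 2] has second difference [eps], so adding it makes [h] convex; the
    price at the far end [N] is the quadratic term of the bound. *)
Lemma almost_convex_seq (h : nat -> R) (eps B : R) :
  0 <= eps -> (forall k, 0 <= h k <= B) ->
  (forall k, 2 * h k.+1 <= h k.+2 + h k + eps) ->
  forall k N, (k <= N)%N ->
    N%:R * (h k - h 0%N) <= k%:R * (B + eps * N%:R ^+ 2 / 2).
Proof.
move=> eps0 hB hc k N kN.
pose g (k : nat) := h k + eps / 2 * k%:R ^+ 2.
have gc j : 2 * g j.+1 <= g j.+2 + g j.
  rewrite /g; have := hc j; rewrite -[j.+2%:R]natr1 -[j.+1%:R]natr1.
  by move: (j%:R : R) => x; lra.
have := convex_seq_ratio gc kN.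
rewrite /g expr0n /= mulr0 addr0 => H.
have /andP[h00 _] := hB 0%N; have /andP[_ hN] := hB N.
apply: (@le_trans _ _ (N%:R * (h k + eps / 2 * k%:R ^+ 2 - h 0%N))).
  rewrite ler_wpM2l ?ler0n// lerD2r lerDl mulr_ge0 ?divr_ge0 ?sqr_ge0//.
apply: (le_trans H); rewrite ler_wpM2l ?ler0n//.
by move: (N%:R ^+ 2) => n2; lra.
Qed.

(* Discrete three lines argument: h x = sup_w |f (x + i w)| is a bounded
   function of x which, by the four-point mean value estimate, is convex up to
   an error o(r^2) at scale r; hence it is nonincreasing. *)
Lemma half_plane_bound (V : normedModType R[i]) (f : R[i] -> V) (a B C M : R) :
  0 <= C ->
  (forall x w, a <= x -> nrm (f (x +i* w)) <= B) ->
  (forall w, nrm (f (a +i* w)) <= M) ->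
  (forall x w r, 0 < r -> r <= 1 -> a <= x - r ->
    nrm (f ((x + r) +i* w) + f ((x - r) +i* w) + f (x +i* (w + r)) +
         f (x +i* (w - r)) - 4 *: f (x +i* w)) <= C * r ^+ 3) ->
  forall x w, a <= x -> nrm (f (x +i* w)) <= M.
Proof.
move=> C0 fB fM f4 x w ax.
have B0 : 0 <= B by exact: le_trans (nrm_ge0 _) (fB a 0 (lexx _)).
have [->//|xa] := eqVneq x a.
pose L := x - a; have L0 : 0 < L by rewrite subr_gt0 lt_neqAle eq_sym xa.
(* The segment from [a] to [x] is cut into [n] steps of length [r], and the sequence of suprema is
   followed for [T * n] steps, up to distance [T * L] from [a]. The convexity error at each step is
   [C * r ^+ 3]. Divided by [T], the bound is [B / T] plus a term of order [T / n]: small for [T]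
   large and then [n] large. *)
have main (n T : nat) : (0 < n)%N -> (0 < T)%N -> L <= n%:R ->
    T%:R * (nrm (f (x +i* w)) - M) <= B + C * L ^+ 3 * T%:R ^+ 2 / (2 * n%:R).
  move=> n0 T0 Ln; pose r := L / n%:R.
  have np : 0 < n%:R :> R by rewrite ltr0n.
  have r0 : 0 < r by rewrite divr_gt0.
  have r1 : r <= 1 by rewrite ler_pdivrMr// mul1r.
  pose S (k : nat) := [set nrm (f ((a + k%:R * r) +i* v)) | v in [set: R]].
  pose h k := sup (S k).
  have ak k : a <= a + k%:R * r by rewrite lerDl mulr_ge0 ?ler0n// ltW.
  have Sub k : ubound (S k) B by move=> _ [v _ <-]; exact: fB.
  have Ssup k : has_sup (S k).
    by split; [exists (nrm (f ((a + k%:R * r) +i* 0))); exists 0|exists B; exact: Sub].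
  have fh k v : nrm (f ((a + k%:R * r) +i* v)) <= h k.
    by apply: ub_le_sup; [exists B; exact: Sub|exists v].
  have hB k : 0 <= h k <= B.
    apply/andP; split; first exact: le_trans (nrm_ge0 _) (fh k 0).
    by apply: ge_sup; [have [] := Ssup k|exact: Sub].
  have hM : h 0%N <= M.
    apply: ge_sup; first by have [] := Ssup 0%N.
    by move=> _ [v _ <-]; rewrite mul0r addr0.
  have hc k : 2 * h k.+1 <= h k.+2 + h k + C * r ^+ 3.
    (* The two vertical neighbours lie on the same vertical line as the point itself, so [h k.+1]
       reappears twice on the right and is absorbed on the left. *)
    have {}hc : h k.+1 <= (h k.+2 + h k + 2 * h k.+1 + C * r ^+ 3) / 4.
      apply: ge_sup; first by have [] := Ssup k.+1.
      move=> _ [v _ <-]; rewrite ler_pdivlMr//.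
      pose y := a + k.+1%:R * r.
      have y1 : y + r = a + k.+2%:R * r by rewrite /y -[k.+2%:R]natr1; ring.
      have y2 : y - r = a + k%:R * r by rewrite /y -natr1; ring.
      have := f4 y v r r0 r1; rewrite y2 => /(_ (ak k)); rewrite y1 -/y.
      set s := _ + f (y +i* (v - r)) => hs.
      have : nrm (4 *: f (y +i* v)) <= nrm (s - 4 *: f (y +i* v)) + nrm s.
        by rewrite nrm_distC -{1}[4 *: _](subrK s) nrmD.
      have -> : nrm (4 *: f (y +i* v)) = nrm (f (y +i* v)) * 4.
        rewrite nrmZ mulrC; congr (_ * _).
        by rewrite -[4 in LHS](rmorph_nat (@real_complex R)) nrm_real ger0_norm.
      move=> h4; have hs' : nrm s <= h k.+2 + h k + 2 * h k.+1.
        rewrite /s; rewrite (le_trans (nrmD _ _))//.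
        have -> : h k.+2 + h k + 2 * h k.+1 = h k.+2 + h k + h k.+1 + h k.+1.
          by ring.
        rewrite lerD ?fh// (le_trans (nrmD _ _))// lerD ?fh//.
        by rewrite (le_trans (nrmD _ _))// lerD ?fh.
      by lra.
    by lra.
  have eps0 : 0 <= C * r ^+ 3 by rewrite mulr_ge0 ?exprn_ge0// ltW.
  have nN : (n <= T * n)%N by rewrite leq_pmull.
  have := almost_convex_seq eps0 hB hc nN.
  rewrite natrM => H.
  have {}H : T%:R * (h n - h 0%N) <= B + C * r ^+ 3 * (T%:R * n%:R) ^+ 2 / 2.
    by rewrite -(ler_pM2l np) mulrA [n%:R * T%:R]mulrC.
  apply: le_trans (le_trans H _); last first.
    rewrite lerD2l /r expr_div_n exprMn.
    rewrite (_ : _ / 2 = C * L ^+ 3 * T%:R ^+ 2 / (2 * n%:R))//.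
    by field; rewrite gt_eqF.
  rewrite ler_wpM2l ?ler0n// lerB//.
  have <- : a + n%:R * r = x by rewrite /r mulrC divfK ?gt_eqF// /L addrC subrK.
  exact: fh.
apply/ler_addgt0Pr => e e0.
have [T T0 hT] : exists2 T : nat, (0 < T)%N & B <= T%:R * (e / 2).
  exists (Num.truncn (B / (e / 2))).+1 => //.
  by rewrite -ler_pdivrMr ?divr_gt0// ltW// truncnS_gt.
(* [T] is fixed at this stage: [n] makes the steps at most 1 and the accumulated error at most
   [T * (e / 2)]. *)
pose n := (maxn (Num.truncn L) (Num.truncn (C * L ^+ 3 * T%:R / e))).+1.
have nL : L <= n%:R.
  by rewrite ltW// (lt_le_trans (truncnS_gt _))// ler_nat ltnS leq_maxl.
have nC : C * L ^+ 3 * T%:R / e <= n%:R.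
  by rewrite ltW// (lt_le_trans (truncnS_gt _))// ler_nat ltnS leq_maxr.
have n0 : (0 < n)%N by [].
have Tp : 0 < T%:R :> R by rewrite ltr0n.
have np : 0 < n%:R :> R by rewrite ltr0n.
have H := main n T n0 T0 nL.
rewrite addrC -lerBlDr -(ler_pM2l Tp); apply: (le_trans H).
have : C * L ^+ 3 * T%:R ^+ 2 / (2 * n%:R) <= T%:R * (e / 2).
  rewrite ler_pdivrMr ?mulr_gt0// expr2 mulrA.
  rewrite (_ : T%:R * (e / 2) * (2 * n%:R) = n%:R * e * T%:R); last by field.
  by rewrite ler_pM2r// -ler_pdivrMr.
by move: hT; lra.
Qed.

End half_plane.

(** * Resolvents *)

Section resolvent.

(** The sum of four Taylor expansions around one point: [x] and [v] are the first-order terms in the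
    real and imaginary directions, [u] is the second-order term, which changes sign between these
    directions because ['i ^+ 2 = -1], and the [b]'s are the cubic remainders. *)
Lemma four_point_cancel (V : zmodType) (a x v u b1 b2 b3 b4 : V) :
  a - x + u - b1 + (a + x + u - b2) + (a - v - u - b3) + (a + v - u - b4)
    - (a + a + (a + a)) = - b1 - b2 - b3 - b4.
Proof.
have E1 : a - x + u + (a + x + u) = a + a + (u + u).
  by rewrite addrACA (addrACA a (- x)) addNr addr0.
have E2 : a - v - u + (a + v - u) = a + a - (u + u).
  by rewrite addrACA (addrACA a (- v)) addNr addr0 opprD.
rewrite (addrACA (a - x + u)) E1 -(addrA (a + a + (u + u) + _)).
rewrite (addrACA (a - v - u)) E2 (addrACA (a + a + (u + u))).
by rewrite (addrACA (a + a)) subrr addr0 [LHS]addrAC subrr add0r !addrA.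
Qed.

Context {R : realType}.

Lemma opnorm_ubP (V W : normedModType R[i]) (S : V -> W) (K : R) :
  (forall a x, S (a *: x) = a *: S x) -> 0 <= K ->
  (opnorm S <= K%:E)%E <-> forall x, nrm (S x) <= K * nrm x.
Proof.
move=> SZ K0; split => [h x|h]; last first.
  apply: ge_ereal_sup => _ [x /= x1 <-]; rewrite lee_fin (le_trans (h x))//.
  by rewrite ler_piMr.
have [x0|x0] := eqVneq (nrm x) 0.
  rewrite (nrm0_eq0 x0) -(scale0r (0 : V)) SZ !scale0r !nrm0.
  by rewrite mulr0.
have xp : 0 < nrm x by rewrite lt_neqAle eq_sym x0 nrm_ge0.
have : ((nrm (S ((nrm x)^-1%:C *: x)))%:E <= opnorm S)%E.
  apply: ereal_sup_ubound; exists ((nrm x)^-1%:C *: x) => //=.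
  by rewrite nrmZ nrm_real ger0_norm ?invr_ge0 ?nrm_ge0// mulVf.
move=> /le_trans/(_ h); rewrite lee_fin SZ nrmZ nrm_real ger0_norm ?invr_ge0 ?nrm_ge0//.
by rewrite mulrC ler_pdivrMr.
Qed.

Lemma opnorm_ge0 (V W : normedModType R[i]) (S : V -> W) : (0 <= opnorm S)%E.
Proof.
apply: (@le_trans _ _ (nrm (S 0))%:E); first by rewrite lee_fin nrm_ge0.
by apply: ereal_sup_ubound; exists 0 => //=; rewrite nrm0.
Qed.

Variable X : normedModType R[i].

(** The record [unbounded_operator] carries no algebraic structure; this is the part of it that a
    generator inherits from the linearity of its semigroup. *)
Definition linear_operator (A : unbounded_operator X) : Prop :=
  forall a x y, op_dom A x -> op_dom A y ->
    op_dom A (a *: x + y) /\ op_fun A (a *: x + y) = a *: op_fun A x + op_fun A y.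

Lemma generator_linear (A : unbounded_operator X) :
  is_generator A -> linear_operator A.
Proof.
move=> [S [_ AS]] a x y Ax Ay; apply/AS.
have [/(_ (conj Ax erefl)) cx _] := AS x (op_fun A x).
have [/(_ (conj Ay erefl)) cy _] := AS y (op_fun A y).
rewrite (_ : (fun h : R => _) = fun h : R =>
    a *: ((h^-1)%:C *: (S h x - x)) + (h^-1)%:C *: (S h y - y)).
  by apply: cvgD => //; apply: cvgZr.
apply/funext => h.
by rewrite linearP opprD addrACA -scalerBr scalerDr !scalerA [a * _]mulrC.
Qed.

Variables (A : unbounded_operator X) (lA : linear_operator A).

Lemma resolventP lambda y : resolvent_set A lambda ->
  op_dom A (resolvent A lambda y) /\
  lambda *: resolvent A lambda y - op_fun A (resolvent A lambda y) = y.
Proof.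
move=> [[_ _ sj] _]; have [x Ax xy] := sj y I.
by apply: (@getPex _ [set x | op_dom A x /\ lambda *: x - op_fun A x = y]); exists x.
Qed.

Lemma resolvent_uniq lambda x y : resolvent_set A lambda -> op_dom A x ->
  lambda *: x - op_fun A x = y -> resolvent A lambda y = x.
Proof.
move=> rl Ax xy; have [AR Ry] := resolventP y rl.
have [[_ ij _] _] := rl; apply: ij => //; first exact: mem_set.
  exact: mem_set.
by rewrite Ry xy.
Qed.

Lemma resolvent_linear lambda : resolvent_set A lambda ->
  linear (resolvent A lambda).
Proof.
move=> rl a x y; have [Ax Rx] := resolventP x rl; have [Ay Ry] := resolventP y rl.
have [Axy Exy] := lA a Ax Ay.
apply: resolvent_uniq => //; rewrite Exy -{3}Rx -{3}Ry scalerBr !scalerDr !scalerA.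
by rewrite [lambda * a]mulrC opprD addrACA.
Qed.

(** Applying [lambda - A] to the left side gives [(mu - lambda) *: resolvent A mu y]. *)
Lemma resolvent_identity lambda mu y :
  resolvent_set A lambda -> resolvent_set A mu ->
  resolvent A lambda y - resolvent A mu y =
  (mu - lambda) *: resolvent A lambda (resolvent A mu y).
Proof.
move=> rl rm; have [Al Rl] := resolventP y rl; have [Am Rm] := resolventP y rm.
set u := resolvent A lambda y in Al Rl *; set v := resolvent A mu y in Am Rm *.
have [A1 E1] := lA (-1) Am Al.
have -> : u - v = -1 *: v + u by rewrite scaleN1r addrC.
rewrite -[RHS]addr0; have <- : resolvent A lambda 0 = 0.
  have := resolvent_linear rl (-1) 0 0.
  by rewrite scaler0 addr0 scaleN1r addNr.
rewrite -resolvent_linear// addr0; apply/esym/resolvent_uniq => //.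
have Em : mu *: v = y + op_fun A v by rewrite -{1}Rm subrK.
rewrite E1 !scaleN1r scalerDr scalerN opprD opprK addrACA Rl scalerBl Em.
by rewrite addrC addrA addrAC.
Qed.

Variables (w0 K : R).
Hypothesis K0 : 0 <= K.
Hypothesis rho : forall l, w0 < complex.Re l -> resolvent_set A l.
Hypothesis RK : forall l y, w0 < complex.Re l -> nrm (resolvent A l y) <= K * nrm y.

(** The resolvent identity, used three times, is a Taylor expansion with exact remainder: no
    derivative of the resolvent has to be defined. *)
Lemma resolvent_taylor3 lambda z y :
  w0 < complex.Re lambda -> w0 < complex.Re (lambda + z) ->
  resolvent A (lambda + z) y =
  resolvent A lambda y - z *: iter 2 (resolvent A lambda) y
  + z ^+ 2 *: iter 3 (resolvent A lambda) y
  - z ^+ 3 *: resolvent A (lambda + z) (iter 3 (resolvent A lambda) y).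
Proof.
move=> h1 h2.
have step u : resolvent A (lambda + z) u =
    resolvent A lambda u - z *: resolvent A (lambda + z) (resolvent A lambda u).
  have := resolvent_identity u (rho h2) (rho h1).
  rewrite opprD addrA subrr sub0r scaleNr => <-; by rewrite [RHS]addrC subrK.
rewrite {1}step {1}(step (resolvent A lambda y)).
rewrite {1}(step (resolvent A lambda (resolvent A lambda y))) /=.
by rewrite !scalerBr !scalerA -expr2 opprB -!exprSr (addrC (_ - _)) !addrA.
Qed.

(** Each of the four cubic remainders is a cube of modulus [r ^+ 3] times a product of four
    resolvents applied to [y], whence the constant [4 * (K ^+ 4 * nrm y)]; the terms of lower order
    cancel. *)
Lemma resolvent_half_plane a M y : w0 < a ->
  (forall w, nrm (resolvent A (a +i* w) y) <= M) ->
  forall x w, a <= x -> nrm (resolvent A (x +i* w) y) <= M.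
Proof.
move=> wa hM; pose C := 4 * (K ^+ 4 * nrm y).
have C0 : 0 <= C by rewrite !mulr_ge0 ?nrm_ge0.
apply: (@half_plane_bound R X (fun l => resolvent A l y) a (K * nrm y) C) => //.
  by move=> x w ax; apply: RK => /=; exact: lt_le_trans ax.
move=> x w r r0 r1 ax.
have hx : w0 < complex.Re (x +i* w) by rewrite /= (lt_le_trans wa)// (le_trans ax)// gerBl ltW.
pose l := x +i* w.
have e1 : (x + r) +i* w = l + r%:C by apply/eqP; rewrite eq_complex /= addr0 !eqxx.
have e2 : (x - r) +i* w = l + (- r%:C) by apply/eqP; rewrite eq_complex /= oppr0 addr0 !eqxx.
have e3 : x +i* (w + r) = l + 'i * r%:C.
  by apply/eqP; rewrite eq_complex /= !(mul0r,mul1r,mulr0,subr0,add0r,addr0) !eqxx.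
have e4 : x +i* (w - r) = l + (- ('i * r%:C)).
  by apply/eqP; rewrite eq_complex /= !(mul0r,mul1r,mulr0,subr0,add0r,addr0,oppr0) !eqxx.
have hr z : `|complex.Re z| <= r -> w0 < complex.Re (l + z).
  rewrite ler_norml => /andP[h _]; apply: (lt_le_trans wa); apply: (le_trans ax).
  by rewrite raddfD /= lerD2l.
have R1 : w0 < complex.Re (l + r%:C) by apply: hr; rewrite /= ger0_norm// ltW.
have R2 : w0 < complex.Re (l + - r%:C) by apply: hr; rewrite /= normrN ger0_norm// ltW.
have R3 : w0 < complex.Re (l + 'i * r%:C).
  by apply: hr; rewrite /= !(mul0r,mulr0,subr0) normr0 ltW.
have R4 : w0 < complex.Re (l + - ('i * r%:C)).
  by apply: hr; rewrite /= !(mul0r,mulr0,subr0,oppr0) normr0 ltW.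
rewrite e1 e2 e3 e4 -/l.
rewrite (resolvent_taylor3 y hx R1) (resolvent_taylor3 y hx R2).
rewrite (resolvent_taylor3 y hx R3) (resolvent_taylor3 y hx R4).
set a0 := resolvent A l y; set a1 := iter 2 _ y; set a2 := iter 3 _ y.
set z1 := r%:C; set z3 := 'i * _.
set S1 := resolvent A _ a2; set S2 := resolvent A _ a2.
set S3 := resolvent A _ a2; set S4 := resolvent A _ a2.
have i2 : ('i : R[i]) ^+ 2 = -1 by exact: sqr_i.
have -> : a0 - z1 *: a1 + z1 ^+ 2 *: a2 - z1 ^+ 3 *: S1 +
  (a0 - - z1 *: a1 + (- z1) ^+ 2 *: a2 - (- z1) ^+ 3 *: S2) +
  (a0 - z3 *: a1 + z3 ^+ 2 *: a2 - z3 ^+ 3 *: S3) +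
  (a0 - - z3 *: a1 + (- z3) ^+ 2 *: a2 - (- z3) ^+ 3 *: S4) - 4 *: a0
  = - (z1 ^+ 3 *: S1) + - ((- z1) ^+ 3 *: S2) + - (z3 ^+ 3 *: S3) + - ((- z3) ^+ 3 *: S4).
  have e42 : (4 : R[i]) *: a0 = a0 + a0 + (a0 + a0).
    by rewrite !scaler_nat !mulrS mulr0n addr0 !addrA.
  rewrite e42 !sqrrN [z3 ^+ 2]exprMn i2 mulN1r !scaleNr !opprK.
  exact: four_point_cancel.
have nS l' : w0 < complex.Re l' -> nrm (resolvent A l' a2) <= K ^+ 4 * nrm y.
  move=> hl'; rewrite (le_trans (RK _ hl'))// !exprS expr0 mulr1 -!mulrA.
  do 2! [apply: ler_wpM2l => //; apply: (le_trans (RK _ hx))].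
  by apply: ler_wpM2l => //; exact: RK.
have nz z (S : X) : nrm z = r -> nrm S <= K ^+ 4 * nrm y ->
    nrm (- (z ^+ 3 *: S)) <= r ^+ 3 * (K ^+ 4 * nrm y).
  move=> zr hS; have -> : r ^+ 3 = nrm (z ^+ 3).
    by rewrite !exprS !expr0 !nrmM nrm1 zr.
  by rewrite nrmN nrmZ ler_wpM2l ?nrm_ge0.
have n1 : nrm z1 = r by rewrite nrm_real gtr0_norm.
have n3 : nrm z3 = r by rewrite nrmM nrmi mul1r nrm_real gtr0_norm.
rewrite (_ : C * r ^+ 3 = r ^+ 3 * (K ^+ 4 * nrm y) + r ^+ 3 * (K ^+ 4 * nrm y)
  + r ^+ 3 * (K ^+ 4 * nrm y) + r ^+ 3 * (K ^+ 4 * nrm y)); last by rewrite /C; ring.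
rewrite (le_trans (nrmD _ _))// lerD ?nz ?nrmN ?nS//.
rewrite (le_trans (nrmD _ _))// lerD ?nz ?nS//.
by rewrite (le_trans (nrmD _ _))// lerD ?nz ?nrmN ?nS//.
Qed.

Lemma resolvent_lipschitz lambda mu y : w0 < complex.Re lambda -> w0 < complex.Re mu ->
  nrm (resolvent A lambda y - resolvent A mu y) <= nrm (lambda - mu) * K ^+ 2 * nrm y.
Proof.
move=> hl hm; rewrite resolvent_identity; [|exact: rho..].
rewrite nrmZ nrm_distC -mulrA ler_wpM2l ?nrm_ge0// expr2 -mulrA.
by rewrite (le_trans (RK _ hl))// ler_wpM2l// RK.
Qed.

End resolvent.

(** * Riemann-Stieltjes integrals of continuous functions *)

Section interval_continuity.
Context {R : realType}.

Lemma cauchy_nrm_cvg (V : completeNormedModType R[i]) (u : nat -> V) :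
  (forall e : R, 0 < e -> exists N, forall m n, (N <= m)%N -> (N <= n)%N ->
     nrm (u m - u n) < e) ->
  exists l : V, u n @[n --> \oo] --> l.
Proof.
move=> cu; apply/cvg_ex; apply: cauchy_cvg; apply: cauchy_exP => e e0.
have [e' e'E e'0] : exists2 e' : R, e'%:C = e & 0 < e'.
  move: e e0 => [a b]; rewrite ltcE /= => /andP[/eqP b0 a0]; exists a => //.
  by rewrite b0.
have [N hN] := cu _ e'0; exists (u N); exists N => // n /= Nn.
by rewrite -ball_normE /= -nrmE -e'E ltcR; exact: hN.
Qed.

Lemma cvg_nrm_le (V : normedModType R[i]) (u : nat -> V) (l : V) (x : V) (c : R) :
  u n @[n --> \oo] --> l -> (\forall n \near \oo, nrm (u n - x) <= c) ->
  nrm (l - x) <= c.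
Proof.
move=> /cvg_nrmP ul ux; apply/ler_addgt0Pr => e e0.
near \oo => n; rewrite [c + e]addrC; apply: (@le_trans _ _ (nrm (l - u n) + nrm (u n - x))).
  exact: nrmB_le.
by apply: lerD; [apply/ltW; near: n; exact: ul|near: n].
Unshelve. all: by end_near. Qed.

Variable V : normedModType R[i].

Lemma within_itv_continuousP (a b : R) (f : R -> V) :
  {within `[a, b], continuous f} <->
  forall x, a <= x <= b -> forall e : R, 0 < e -> exists2 d : R, 0 < d &
    forall u, a <= u <= b -> `|x - u| < d -> nrm (f x - f u) < e.
Proof.
split=> [/subspace_continuousP fc x xab e e0|h].
  have := fc x; rewrite /= in_itv /= => /(_ xab)/cvg_nrmP/(_ e e0).
  rewrite /within /= => -[d d0 hd]; exists d => // u uab xu.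
  by apply: hd => //=; rewrite in_itv.
apply/subspace_continuousP => x; rewrite /= in_itv /= => xab.
apply/cvg_nrmP => e e0; have [d d0 hd] := h x xab e e0.
by exists d => // u /= xu; rewrite in_itv /= => uab; exact: hd.
Qed.

(** Heine-Cantor, from the near-covering form of compactness: a radius [d] valid at [x] for [e / 2]
    yields the radius [d / 2], valid for [e], at all points within [d / 2] of [x]. *)
Lemma itv_unif_continuous (a b : R) (f : R -> V) :
  {within `[a, b], continuous f} ->
  forall e : R, 0 < e -> exists2 d : R, 0 < d &
    forall u v, a <= u <= b -> a <= v <= b -> `|u - v| < d -> nrm (f u - f v) < e.
Proof.
move=> /within_itv_continuousP fc e e0.
have /near_covering_withinP : near_covering `[a, b].
  exact/compact_near_coveringP/segment_compact.
pose P (d : R) (x : R) := forall u, a <= u <= b -> `|u - x| < d -> nrm (f u - f x) < e.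
move=> /(_ R 0^'+ P _).
have : forall x, [set` `[a, b]] x ->
    \forall x' \near x & i \near 0^'+, [set` `[a, b]] x' -> P i x'.
  move=> x /=; rewrite in_itv /= => xab.
  have e2 : 0 < e / 2 by rewrite divr_gt0.
  have [d d0 hd] := fc x xab _ e2.
  have d2 : 0 < d / 2 by rewrite divr_gt0.
  exists ([set y | `|x - y| < d / 2], [set y | y < d / 2]) => /=.
    split; last exact: nbhs_right_lt.
    by exists (d / 2).
  move=> -[x' i] /= [xx' id] x'ab u uab ux'.
  move: x'ab; rewrite in_itv /= => x'ab.
  rewrite (le_lt_trans (nrmB_le _ (f x) _))// (splitr e) ltrD//.
    rewrite nrm_distC; apply: hd => //.
    rewrite (le_lt_trans (ler_distD x' _ _))// (splitr d) ltrD// distrC.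
    exact: lt_trans id.
  apply: hd => //; apply: (lt_trans xx').
  by rewrite ltr_pdivrMr// ltr_pMr// ltr1n.
move=> h1 h2; have h3 := h2 h1.
near (0 : R)^'+ => d; exists d; first by near: d; exact: nbhs_right_gt.
have : `[a, b] `<=` P d by near: d.
by move=> h4 u v uab vab; exact: h4.
Unshelve. all: by end_near. Qed.

Lemma itv_bounded_nrm (a b : R) (f : R -> V) : a <= b ->
  {within `[a, b], continuous f} ->
  exists2 c : R, 0 <= c & forall u, a <= u <= b -> nrm (f u) <= c.
Proof.
move=> ab fc.
have gc : {within `[a, b], continuous (@nrm R V \o f)}.
  move=> x; apply: (@continuous_comp (subspace [set` `[a, b]]) _ _ f); first exact: fc.
  exact: continuous_nrm.
have [c _ hc] := EVT_max ab gc.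
exists (nrm (f c)); first exact: nrm_ge0.
by move=> u uab; apply: (hc u); rewrite in_itv.
Qed.

End interval_continuity.

(** * Riemann-Stieltjes sums under refinement *)

Section riemann_stieltjes.
Context {R : realType}.
Variables (X : completeNormedModType R[i]) (a b : R) (eta : R -> X -> X) (M : R).
Hypothesis ab : a < b.
Hypothesis eta_lin : forall t, a <= t <= b -> linear (eta t).
Hypothesis eta_var : forall s, itv_partition a b s ->
    (\sum_(i < size s)
       opnorm (fun x => eta (nth b s i) x - eta (nth b (a :: s) i) x)%R
     <= M%:E)%E.

Lemma etaD t x y : a <= t <= b -> eta t (x + y) = eta t x + eta t y.
Proof. by move=> /eta_lin h; rewrite -{1}[x]scale1r h scale1r. Qed.

Lemma eta0 t : a <= t <= b -> eta t 0 = 0.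
Proof. by move=> /eta_lin h; have := h (-1) 0 0; rewrite scaler0 addr0 scaleN1r addNr. Qed.

Lemma etaZ t (l : R[i]) x : a <= t <= b -> eta t (l *: x) = l *: eta t x.
Proof. by move=> tab; rewrite -[l *: x]addr0 eta_lin// eta0// addr0. Qed.

Lemma itv_partition_mem x s y : itv_partition x b s -> y \in x :: s -> x <= y <= b.
Proof.
move=> xs /(nthP b)[i /= i_s <-].
by rewrite itv_partition_nth_ge ?itv_partition_nth_le.
Qed.

(** A Riemann-Stieltjes sum tagged at right end points. Arbitrary tags are brought to this form by
    replacing the integrand with a step function, and the recursion on the partition suits induction
    along a refinement. *)
Fixpoint rs (x : R) (s : seq R) (g : R -> X) : X :=
  if s is y :: s' then eta y (g y) - eta x (g y) + rs y s' g else 0.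

(** The intervals are open on the left: a partition point belongs to the interval that it ends, in
    agreement with the tags of [rs]. *)
Fixpoint step_on (x : R) (s : seq R) (g : R -> X) : Prop :=
  if s is y :: s' then (forall u, x < u <= y -> g u = g y) /\ step_on y s' g
  else True.

Lemma rs_sumE x s g : rs x s g = \sum_(i < size s)
  (eta (nth b s i) (g (nth b s i)) - eta (nth b (x :: s) i) (g (nth b s i))).
Proof.
elim: s x => [|y s IH] x /=; first by rewrite big_ord0.
by rewrite IH big_ord_recl.
Qed.

Lemma find_nth_path x s i : path <%R x s -> (i < size s)%N ->
  find (fun y => nth b s i <= y) s = i.
Proof.
elim: s x i => // y s IH x [|i] /= /andP[xy ys] i_s; first by rewrite lexx.
rewrite leNgt; have /allP := order_path_min lt_trans ys.
by move=> /(_ (nth b s i)) -> /=; [rewrite (IH y)|rewrite mem_nth].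
Qed.

(** [find] returns the index of the interval, open on the left and closed on the right, that
    contains [u]; the tagged sum of [f] thus becomes the right-end-point sum of a step function. *)
Lemma RS_sum_rs s tau f : path <%R a s -> RS_sum a b eta f s tau =
  rs a s (fun u => f (tau (find (fun y => u <= y) s))).
Proof.
move=> sp; rewrite rs_sumE; apply: eq_bigr => i _.
by rewrite (find_nth_path sp).
Qed.

Lemma step_on_ext x s g g' : path <%R x s -> (forall u, x < u -> g u = g' u) ->
  step_on x s g -> step_on x s g'.
Proof.
elim: s x => // y s IH x /= /andP[xy ys] gg' [h1 h2]; split.
  by move=> u /andP[xu uy]; rewrite -!gg' ?h1 ?xu.
by apply: IH ys _ h2 => u yu; rewrite gg'// (lt_trans xy).
Qed.

Lemma step_on_find x s (h : nat -> X) : path <%R x s ->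
  step_on x s (fun u => h (find (fun y => u <= y) s)).
Proof.
elim: s x h => // y s IH x h /= /andP[xy ys]; split.
  by move=> u /andP[xu uy]; rewrite uy lexx.
apply: step_on_ext ys _ (IH y (h \o S) ys) => u yu /=.
by rewrite leNgt yu.
Qed.

(** On a subdivided interval the step function keeps its value, so that the increments of [eta] over
    the pieces telescope. *)
Lemma rs_refine x s t g : a <= x -> itv_partition x b s -> itv_partition x b t ->
  {subset s <= t} -> step_on x s g -> rs x t g = rs x s g.
Proof.
elim: t x s => [|y t IH] x [|z s] ax xs xt st sg //=.
- by have := st z; rewrite inE eqxx => /(_ isT).
- by move: xt; rewrite (itv_partition_nil xs) => /itv_partitionxx.
have /= /andP[xy yt] := xt.1; have /= /andP[xz zs] := xs.1.
have yt' := itv_partition_cons xt; have zs' := itv_partition_cons xs.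
have ay : a <= y by rewrite (le_trans ax)// ltW.
have /= [sg1 sg2] := sg.
have := st z; rewrite !inE eqxx => /(_ isT) /predU1P[zy|zt].
  rewrite zy; congr (_ + _); apply: IH => //; rewrite -?zy//.
  move=> u us; have := st u; rewrite !inE us orbT => /(_ isT) /predU1P[uy|//].
  have /allP/(_ _ us) := order_path_min lt_trans zs.
  by rewrite uy zy ltxx.
have yz : y < z by have /allP/(_ _ zt) := order_path_min lt_trans yt.
have yzs : itv_partition y b (z :: s).
  by split; [rewrite /= yz zs|exact: xs.2].
have sub : {subset z :: s <= t}.
  move=> u us; have := st u us; rewrite inE => /predU1P[uy|//].
  have : u \in y :: z :: s by rewrite inE us orbT.
  move: us; rewrite inE => /predU1P[uz|us]; first by move: yz; rewrite -uz uy ltxx.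
  have /allP/(_ _ us) := order_path_min lt_trans zs.
  by rewrite uy => /(lt_trans yz); rewrite ltxx.
have step' : step_on y (z :: s) g.
  by split => // u /andP[yu uz]; apply: sg1; rewrite uz (lt_trans xy).
rewrite (IH _ _ ay yzs yt' sub step') /= addrA; congr (_ + _).
rewrite (sg1 y); last by rewrite xy ltW.
by rewrite addrC addrA subrK.
Qed.

Lemma rs_le s g c : itv_partition a b s ->
  (forall u, a < u <= b -> nrm (g u) <= c) -> nrm (rs a s g) <= M * c.
Proof.
move=> sab gc.
have c0 : 0 <= c by apply: le_trans (gc b _); [exact: nrm_ge0|rewrite ab lexx].
rewrite rs_sumE; set D := fun i : 'I_(size s) => fun x =>
  eta (nth b s i) x - eta (nth b (a :: s) i) x.
have mem1 (i : 'I_(size s)) : a <= nth b s i <= b.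
  by apply: (itv_partition_mem sab); rewrite inE mem_nth// orbT.
have mem2 (i : 'I_(size s)) : a <= nth b (a :: s) i <= b.
  by apply: (itv_partition_mem sab); rewrite mem_nth//= ltnW// ltnS.
have DZ i (l : R[i]) x : D i (l *: x) = l *: D i x.
  by rewrite /D !etaZ// scalerBr.
have := eta_var sab; rewrite -/(D _) => hM.
have Dfin i : (opnorm (D i) <= M%:E)%E.
  apply: le_trans hM; rewrite (bigD1 i)//= leeDl//.
  by apply: sume_ge0 => j _; exact: opnorm_ge0.
have DE i : opnorm (D i) = (fine (opnorm (D i)))%:E.
  rewrite fineK// ge0_fin_numE ?opnorm_ge0//.
  by rewrite (le_lt_trans (Dfin i))// ltry.
have {}hM : \sum_i fine (opnorm (D i)) <= M.
  by rewrite -lee_fin -sumEFin; under eq_bigr => i _ do rewrite -DE.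
apply: (le_trans (nrm_sum _ _ _)).
apply: (@le_trans _ _ (\sum_i fine (opnorm (D i)) * c)).
  apply: ler_sum => i _; rewrite -/(D i _).
  have k0 : 0 <= fine (opnorm (D i)) by rewrite fine_ge0// opnorm_ge0.
  have /(opnorm_ubP (DZ i) k0) h : (opnorm (D i) <= (fine (opnorm (D i)))%:E)%E.
    by rewrite -DE.
  rewrite (le_trans (h _))// ler_wpM2l// gc//.
  have /andP[_ ->] := mem1 i; rewrite andbT.
  have /allP := order_path_min lt_trans sab.1; apply; exact: mem_nth.
by rewrite -mulr_suml ler_wpM2r.
Qed.

Lemma rsB x s g g' : a <= x -> itv_partition x b s ->
  rs x s (fun u => g u - g' u) = rs x s g - rs x s g'.
Proof.
move=> ax xs; rewrite !rs_sumE -sumrB; apply: eq_bigr => i _.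
have h y : y \in x :: s -> a <= y <= b.
  by move=> /(itv_partition_mem xs)/andP[xy ->]; rewrite (le_trans ax).
have B t : a <= t <= b -> forall u v, eta t (u - v) = eta t u - eta t v.
  by move=> tab u v; rewrite etaD// -scaleN1r etaZ// scaleN1r.
have m1 : a <= nth b s i <= b by apply: h; rewrite inE mem_nth ?orbT.
have m2 : a <= nth b (x :: s) i <= b by apply: h; rewrite mem_nth//= ltnW// ltnS.
by rewrite !B// !opprB addrACA [RHS]addrACA; congr (_ + _); exact: addrC.
Qed.

Definition tagged_partition (delta : R) (s : seq R) (tau : nat -> R) : Prop :=
  itv_partition a b s /\
  (forall i, (i < size s)%N ->
     nth b s i - nth b (a :: s) i < delta /\
     nth b (a :: s) i <= tau i <= nth b s i).

Lemma tagged_find delta s tau u : tagged_partition delta s tau -> a < u <= b ->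
  let v := tau (find (fun y => u <= y) s) in
  a <= v <= b /\ `|v - u| < delta.
Proof.
move=> [sab sd] /andP[au ub] /=; set i := find _ _.
have hs : has (fun y => u <= y) s.
  apply/hasP; exists b => //; have := mem_last a s; rewrite (eqP sab.2) inE.
  by rewrite gt_eqF.
have i_s : (i < size s)%N by rewrite -has_find.
have [d1 /andP[t1 t2]] := sd i i_s.
have u2 : u <= nth b s i by exact: (nth_find b hs).
have u1 : nth b (a :: s) i <= u.
  case Ei : i => [|j] /=; first exact: ltW.
  have : (j < i)%N by rewrite Ei.
  by move=> /(before_find b)/negbT; rewrite -ltNge => /ltW.
split.
  rewrite (le_trans _ t1) ?(le_trans t2) //.
    have /andP[] // : a <= nth b s i <= b.
    by apply: (itv_partition_mem sab); rewrite inE mem_nth// orbT.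
  have /andP[] // : a <= nth b (a :: s) i <= b.
  by apply: (itv_partition_mem sab); rewrite mem_nth//= ltnW// ltnS.
rewrite ltr_norml; apply/andP; split; lra.
Qed.

Lemma common_refinement s t : itv_partition a b s -> itv_partition a b t ->
  exists w, [/\ itv_partition a b w, {subset s <= w} & {subset t <= w}].
Proof.
move=> sab tab; pose w := sort <=%R (undup (s ++ t)).
have memw y : (y \in w) = (y \in s) || (y \in t).
  by rewrite mem_sort mem_undup mem_cat.
have gta s' y : itv_partition a b s' -> y \in s' -> a < y.
  by move=> h ys; have /allP/(_ _ ys) := order_path_min lt_trans h.1.
have leb s' y : itv_partition a b s' -> y \in s' -> y <= b.
  by move=> h ys; have /andP[] := itv_partition_mem h (y := y) ltac:(by rewrite inE ys orbT).
have bs : b \in s.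
  have := mem_last a s; rewrite (eqP sab.2) inE => /predU1P[ba|//].
  by move: ab; rewrite ba ltxx.
have ws : sorted <%R w.
  by rewrite lt_sorted_uniq_le sort_uniq undup_uniq sort_le_sorted.
have aw : path <%R a w.
  rewrite (path_sortedE lt_trans) ws andbT; apply/allP => y; rewrite memw => /orP[]; exact: gta.
exists w; split; last 2 first.
- by move=> y; rewrite memw => ->.
- by move=> y; rewrite memw => ->; rewrite orbT.
split => //; rewrite eq_le; apply/andP; split.
  have := mem_last a w; rewrite inE => /predU1P[->|]; first exact: ltW.
  by rewrite memw => /orP[]; exact: leb.
have bw : b \in w by rewrite memw bs.
have /(nthP b)[i iw <-] := bw.
have w0 : (0 < size w)%N by exact: leq_ltn_trans iw.
rewrite -nth_last (set_nth_default b a) ?ltn_predL//.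
have ws' : sorted <=%R w by exact: (sub_sorted (@ltW _ _) ws).
apply: (@sorted_leq_nth _ <=%R le_trans lexx b w ws') => //.
  by rewrite inE ltn_predL.
by rewrite -ltnS prednK.
Qed.

(** On a common refinement both sums are right-end-point sums of step functions, each within [e] of
    [f]; their difference is then bounded by the variation of [eta]. *)
Lemma RS_sum_close f e delta :
  0 <= e ->
  (forall u v, a <= u <= b -> a <= v <= b -> `|u - v| < delta -> nrm (f u - f v) <= e) ->
  forall s tau t ups, tagged_partition delta s tau -> tagged_partition delta t ups ->
  nrm (RS_sum a b eta f s tau - RS_sum a b eta f t ups) <= M * (e + e).
Proof.
move=> e0 fe s tau t ups sd td.
have [w [wab sw tw]] := common_refinement sd.1 td.1.
rewrite !RS_sum_rs; [|exact: td.1.1|exact: sd.1.1].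
have sp := step_on_find (f \o tau) sd.1.1.
have tp := step_on_find (f \o ups) td.1.1.
rewrite -(rs_refine (lexx a) sd.1 wab sw sp) -(rs_refine (lexx a) td.1 wab tw tp).
rewrite -rsB//; apply: rs_le => // u uab.
have [s1 s2] := tagged_find sd uab; have [t1 t2] := tagged_find td uab.
have u1 : a <= u <= b by case/andP: uab => /ltW -> ->.
rewrite (le_trans (nrmB_le _ (f u) _))// lerD ?fe//.
by rewrite distrC.
Qed.

End riemann_stieltjes.

(** * Existence, uniqueness and linearity of the Riemann-Stieltjes integral *)

Section riemann_stieltjes_integral.
Context {R : realType}.
Variables (X : completeNormedModType R[i]) (a b : R) (eta : R -> X -> X) (M : R).
Hypothesis ab : a < b.
Hypothesis eta_lin : forall t, a <= t <= b -> linear (eta t).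
Hypothesis eta_var : forall s, itv_partition a b s ->
    (\sum_(i < size s)
       opnorm (fun x => eta (nth b s i) x - eta (nth b (a :: s) i) x)%R
     <= M%:E)%E.

Lemma tagged_exists (delta : R) : 0 < delta -> exists s tau, tagged_partition a b delta s tau.
Proof.
(* Steps of length [delta / 2] keep the mesh strictly below [delta]; [N] controls their number, and
   the recursion stops once less than [delta] remains. *)
move=> d0; suff : forall N x, a <= x -> x < b -> b - x < N%:R * (delta / 2) ->
    exists s, itv_partition x b s /\ forall i, (i < size s)%N ->
      0 <= nth b s i - nth b (x :: s) i < delta.
  have d2 : 0 < delta / 2 by rewrite divr_gt0.
  move=> /(_ (Num.truncn ((b - a) / (delta / 2))).+1 a (lexx _) ab)[].
    by rewrite -ltr_pdivrMr// truncnS_gt.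
  move=> s [sab sd]; exists s, (nth b s); split => // i i_s.
  by have /andP[h1 ->] := sd i i_s; rewrite lexx -subr_ge0 h1.
elim=> [x ax xb bN|N IH x ax xb bN].
  by move: bN; rewrite mul0r subr_lt0 ltNge (ltW xb).
have [h|h] := ltP (b - x) delta.
  exists [:: b]; split; first exact: itv_partition1.
  by move=> [|i]//= _; rewrite h subr_ge0 ltW.
have [|||s [sab sd]] := IH (x + delta / 2); [lra|lra| |].
  by move: bN; rewrite -natr1; lra.
exists (x + delta / 2 :: s); split.
  split; last exact: sab.2.
  by rewrite /= sab.1 andbT; lra.
move=> [|i] /= i_s; last exact: sd.
by apply/andP; split; lra.
Qed.

Lemma eta_variation_ge0 : 0 <= M.
Proof.
have := eta_var (itv_partition1 ab); rewrite big_ord1 -lee_fin.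
exact/le_trans/opnorm_ge0.
Qed.

Lemma RS_sum_le f c delta s tau : tagged_partition a b delta s tau ->
  (forall u, a <= u <= b -> nrm (f u) <= c) ->
  nrm (RS_sum a b eta f s tau) <= M * c.
Proof.
move=> sd fc; rewrite RS_sum_rs; last exact: sd.1.1.
apply: (rs_le ab eta_lin eta_var) => //; first exact: sd.1.
by move=> u /(tagged_find ab sd)[h _]; exact: fc.
Qed.

Lemma is_RS_integral_uniq f v w :
  is_RS_integral a b eta f v -> is_RS_integral a b eta f w -> v = w.
Proof.
move=> fv fw; apply: nrm_lt_eq => e e0.
have e2 : 0 < e / 2 by rewrite divr_gt0.
have [d1 d10 h1] := fv _ e2; have [d2 d20 h2] := fw _ e2.
have d0 : 0 < Num.min d1 d2 by rewrite lt_min d10.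
have [s [tau [sab sd]]] := tagged_exists d0.
rewrite (le_lt_trans (nrmB_le _ (RS_sum a b eta f s tau) _))//.
rewrite (splitr e) ltrD//; first rewrite nrm_distC.
  by apply: h1 => // i /sd; rewrite lt_min => -[/andP[]].
by apply: h2 => // i /sd; rewrite lt_min => -[/andP[]].
Qed.

Lemma is_RS_integral_exists f : {within `[a, b], continuous f} ->
  exists v, is_RS_integral a b eta f v.
Proof.
move=> /itv_unif_continuous fc; have M0 := eta_variation_ge0.
have close e : 0 < e -> exists2 d : R, 0 < d & forall s tau t ups,
    tagged_partition a b d s tau -> tagged_partition a b d t ups ->
    nrm (RS_sum a b eta f s tau - RS_sum a b eta f t ups) < e.
  (* This choice gives [M * (e' + e') < e], also when [M = 0]. *)
  move=> e0; pose e' := e / (4 * (M + 1)).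
  have e'0 : 0 < e' by rewrite divr_gt0// mulr_gt0// ltr_wpDl.
  have [d d0 hd] := fc _ e'0; exists d => // s tau t ups sd td.
  have hd' u v : a <= u <= b -> a <= v <= b -> `|u - v| < d -> nrm (f u - f v) <= e'.
    by move=> *; apply/ltW/hd.
  rewrite (le_lt_trans (RS_sum_close ab eta_lin eta_var (ltW e'0) hd' sd td))//.
  have : e' * (4 * (M + 1)) = e by rewrite /e' divfK// gt_eqF// mulr_gt0// ltr_wpDl.
  by move=> <-; nra.
have dn n : 0 < n.+1%:R^-1 :> R by rewrite invr_gt0.
have [S hS] := choice (fun n => tagged_exists (dn n)).
have [T hT] := choice hS.
pose u n := RS_sum a b eta f (S n) (T n).
have taggedW d d' s tau : d <= d' -> tagged_partition a b d s tau -> tagged_partition a b d' s tau.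
  by move=> dd' [h1 h2]; split => // i /h2[h3 h4]; split => //; exact: lt_le_trans dd'.
have small (d : R) : 0 < d -> exists N, forall n, (N <= n)%N -> n.+1%:R^-1 <= d.
  move=> d0; exists (Num.truncn d^-1) => n Nn.
  rewrite invf_ple ?posrE// ltW// (lt_le_trans (truncnS_gt _))//.
  by rewrite ler_nat ltnS.
have [v uv] : exists v : X, u n @[n --> \oo] --> v.
  apply: cauchy_nrm_cvg => e /close[d /small[N hN] hd].
  by exists N => m n /hN hm /hN hn; apply: hd; exact: taggedW (hT _).
exists v => e e0; have e2 : 0 < e / 2 by rewrite divr_gt0.
have [d d0 hd] := close _ e2; exists d => // s tau sab sd.
apply: (@le_lt_trans _ _ (e / 2)); last by rewrite ltr_pdivrMr// ltr_pMr// ltr1n.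
rewrite nrm_distC; apply: (cvg_nrm_le uv).
have [N hN] := small d d0; exists N => // n /= Nn; apply/ltW/hd => //.
by apply: taggedW (hT n); exact: hN.
Qed.

Lemma RS_integralP f : {within `[a, b], continuous f} ->
  is_RS_integral a b eta f (RS_integral a b eta f).
Proof. by move=> /is_RS_integral_exists[v fv]; apply: (@getPex _ (is_RS_integral a b eta f)); exists v. Qed.

Lemma is_RS_integral_linear l f g v w :
  is_RS_integral a b eta f v -> is_RS_integral a b eta g w ->
  is_RS_integral a b eta (fun t => l *: f t + g t) (l *: v + w).
Proof.
move=> fv gw e e0.
have l0 : 0 < nrm l + 1 by rewrite ltr_wpDl// nrm_ge0.
have e1 : 0 < e / 2 / (nrm l + 1) by rewrite !divr_gt0.
have e2 : 0 < e / 2 by rewrite divr_gt0.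
have [d1 d10 h1] := fv _ e1; have [d2 d20 h2] := gw _ e2.
exists (Num.min d1 d2); first by rewrite lt_min d10.
move=> s tau sab sd.
have -> : RS_sum a b eta (fun t => l *: f t + g t) s tau =
    l *: RS_sum a b eta f s tau + RS_sum a b eta g s tau.
  rewrite /RS_sum scaler_sumr -big_split /=; apply: eq_bigr => i _.
  rewrite !eta_lin; last 2 first.
  - by apply: (itv_partition_mem sab); rewrite mem_nth//= ltnW// ltnS.
  - by apply: (itv_partition_mem sab); rewrite inE mem_nth// orbT.
  by rewrite opprD addrACA scalerBr.
rewrite opprD addrACA -scalerBr (le_lt_trans (nrmD _ _))// (splitr e) ltrD//.
  rewrite nrmZ.
  have H : nrm (RS_sum a b eta f s tau - v) < e / 2 / (nrm l + 1).
    by apply: h1 => // i /sd; rewrite lt_min => -[/andP[]].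
  move: H; rewrite ltr_pdivlMr// => H; apply: le_lt_trans H.
  by rewrite mulrC ler_wpM2l ?nrm_ge0// lerDl.
by apply: h2 => // i /sd; rewrite lt_min => -[/andP[]].
Qed.

Lemma within_continuous_linear (l : R[i]) (f g : R -> X) : {within `[a, b], continuous f} ->
  {within `[a, b], continuous g} ->
  {within `[a, b], continuous (fun t => l *: f t + g t)}.
Proof.
move=> fc gc x; apply: cvgD; last exact: gc.
by apply: cvgZr; exact: fc.
Qed.

Lemma RS_integral_linear l f g : {within `[a, b], continuous f} ->
  {within `[a, b], continuous g} ->
  RS_integral a b eta (fun t => l *: f t + g t) =
  l *: RS_integral a b eta f + RS_integral a b eta g.
Proof.
move=> fc gc; apply: is_RS_integral_uniq; last first.
  by apply: is_RS_integral_linear; exact: RS_integralP.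
by apply: RS_integralP; exact: within_continuous_linear.
Qed.

Lemma RS_integral_le f c : {within `[a, b], continuous f} ->
  (forall u, a <= u <= b -> nrm (f u) <= c) ->
  nrm (RS_integral a b eta f) <= M * c.
Proof.
move=> fc hc; apply/ler_addgt0Pr => e e0.
have [d d0 hd] := RS_integralP fc e0.
have [s [tau sd]] := tagged_exists d0.
rewrite addrC -[RS_integral _ _ _ _](subrK (RS_sum a b eta f s tau)).
rewrite (le_trans (nrmD _ _))// lerD ?(RS_sum_le sd)//.
by rewrite nrm_distC ltW// hd//; [exact: sd.1|exact: sd.2].
Qed.

Lemma RS_integral_ext f g : {within `[a, b], continuous f} ->
  {within `[a, b], continuous g} -> (forall u, a <= u <= b -> f u = g u) ->
  RS_integral a b eta f = RS_integral a b eta g.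
Proof.
move=> fc gc fg; apply/eqP; rewrite -subr_eq0 -scaleN1r addrC -RS_integral_linear//.
apply/eqP/nrm_le0; rewrite -(mulr0 M); apply: RS_integral_le.
  exact: within_continuous_linear.
by move=> u uab; rewrite fg// scaleN1r addNr nrm0.
Qed.

End riemann_stieltjes_integral.

(** * The delay functional on exponentials *)

Section scalar_estimates.
Context {R : realType}.

Lemma sin_MVT (x : R) : 0 <= x -> exists2 c : R, 0 <= c <= x & sin x = cos c * x.
Proof.
move=> x0; have df y : y \in `]0, x[%R -> is_derive y 1 sin (cos y).
  by move=> _; exact: is_derive_sin.
have cf : {within `[0, x], continuous (@sin R)}.
  exact/continuous_subspaceT/continuous_sin.
have [c] := MVT_segment x0 df cf.
by rewrite in_itv /= sin0 !subr0 => cx ->; exists c.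
Qed.

Lemma cos_MVT (x : R) : 0 <= x ->
  exists2 c : R, 0 <= c <= x & cos x - 1 = - sin c * x.
Proof.
move=> x0; have df y : y \in `]0, x[%R -> is_derive y 1 cos ((- sin) y).
  by move=> _; exact: is_derive_cos.
have cf : {within `[0, x], continuous (@cos R)}.
  exact/continuous_subspaceT/continuous_cos.
have [c] := MVT_segment x0 df cf.
by rewrite in_itv /= cos0 subr0 => cx ->; exists c.
Qed.

(** The mean value theorem for the sine, then for the cosine at the intermediate point. *)
Lemma sin_sub_id (x : R) : 0 <= x -> `|sin x - x| <= x ^+ 2.
Proof.
move=> x0; have [c /andP[c0 cx] ->] := sin_MVT x0.
have [d _ cd] := cos_MVT c0.
rewrite -{2}[x]mul1r -mulrBl cd normrM (ger0_norm x0) expr2 ler_wpM2r//.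
rewrite normrM normrN (ger0_norm c0) (le_trans _ cx)// ler_piMl//.
exact: sin_max.
Qed.

(** Invert [1 - x <= expR (- x)] and use [(1 + x + 2 x^2) (1 - x) = 1 + x^2 (1 - 2 x) >= 1]. *)
Lemma expR_le_quad (x : R) : `|x| <= 2^-1 -> expR x <= 1 + x + 2 * x ^+ 2.
Proof.
rewrite ler_norml => /andP[x1 x2].
have h : 1 - x <= expR (- x) by rewrite (le_trans _ (expR_ge1Dx _)).
have x1p : 0 < 1 - x by lra.
have -> : expR x = (expR (- x))^-1 by rewrite expRN invrK.
apply: (@le_trans _ _ (1 - x)^-1); first by rewrite lef_pV2// posrE ?expR_gt0.
rewrite -[leLHS]mul1r ler_pdivrMr//.
have : 0 <= x ^+ 2 * (1 - 2 * x) by rewrite mulr_ge0 ?sqr_ge0//; lra.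
by rewrite !expr2; lra.
Qed.

(** The left side is the four-point mean value defect of the exponential. With [v = u / 2] it equals
    [(expR v - expR (- v))^2 - (2 sin v)^2], a product of a factor of order [v^2] and one of order
    [v], so that quadratic bounds on the functions involved are enough. *)
Lemma cosh_cos_bound (u : R) : `|u| <= 1 ->
  `|expR u + expR (- u) + 2 * cos u - 4| <= 3 * `|u| ^+ 3.
Proof.
wlog u0 : u / 0 <= u.
  move=> h; have [/h//|u0] := leP 0 u.
  move=> u1; have := h (- u); rewrite normrN opprK cosN oppr_ge0 => /(_ (ltW u0) u1).
  by rewrite [expR (- u) + _]addrC.
rewrite (ger0_norm u0) => u1.
pose v := u / 2; have uv : u = v + v by rewrite /v -splitr.
have v0 : 0 <= v by rewrite /v divr_ge0.
have v1 : v <= 2^-1 by rewrite /v; lra.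
have s1 := sin_sub_id v0.
have := expR_ge1Dx v; have := expR_ge1Dx (- v).
have := @expR_le_quad v; have := @expR_le_quad (- v).
rewrite normrN (ger0_norm v0) => /(_ v1) e1 /(_ v1) e2 e3 e4.
have cu : cos u = 1 - 2 * sin v ^+ 2.
  rewrite uv -mulr2n cos_mulr2n cos2sin2; ring.
rewrite cu uv opprD !expRD.
have EE := expRxMexpNx_1 v.
move: (expR v) (expR (- v)) (sin v) e1 e2 e3 e4 s1 EE => E F s e1 e2 e3 e4 s1 EE.
have -> : E * E + F * F + 2 * (1 - 2 * s ^+ 2) - 4 = (E - F - 2 * s) * (E - F + 2 * s).
  rewrite (_ : E * E + F * F + 2 * (1 - 2 * s ^+ 2) - 4 =
     E * E + F * F - 2 * (E * F) - 4 * s ^+ 2); last by rewrite EE; ring.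
  ring.
have [A0 A1] : - v ^+ 2 <= (E - F) / 2 - v /\ (E - F) / 2 - v <= v ^+ 2.
  by move: e1 e2 e3 e4; rewrite sqrrN; move: (v ^+ 2) => w; lra.
move: s1; rewrite ler_norml => /andP[B0 B1].
have vv : v ^+ 2 <= 2^-1 * v by rewrite expr2 ler_wpM2r.
rewrite normrM.
have h1 : `|E - F - 2 * s| <= 4 * v ^+ 2.
  by rewrite ler_norml; apply/andP; split; lra.
have h2 : `|E - F + 2 * s| <= 6 * v.
  by rewrite ler_norml; apply/andP; split; lra.
apply: (le_trans (ler_pM (normr_ge0 _) (normr_ge0 _) h1 h2)).
rewrite (_ : 3 * (v + v) ^+ 3 = 4 * v ^+ 2 * (6 * v))//; ring.
Qed.

Lemma expR_lipschitz (c p q : R) : p <= c -> q <= c ->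
  `|expR p - expR q| <= expR c * `|p - q|.
Proof.
wlog pq : p q / q <= p.
  move=> h pc qc; have [/h|/ltW /h] := leP q p; first by apply.
  by rewrite distrC (distrC q); apply.
move=> pc qc; rewrite !ger0_norm ?subr_ge0 ?ler_expR//.
have -> : expR p - expR q = expR p * (1 - expR (q - p)).
  by rewrite mulrBr mulr1 -expRD [p + _]addrC subrK.
apply: ler_pM; rewrite ?expR_ge0 ?ler_expR ?subr_ge0 ?expR_le1 ?subr_le0//.
by have := expR_ge1Dx (q - p); lra.
Qed.

End scalar_estimates.

(** * The complex exponential along the real axis *)

Section complex_exponential.
Context {R : realType}.
Implicit Types z w : R[i].

Lemma cexpD z w : cexp (z + w) = cexp z * cexp w.
Proof.
case: z w => [a b] [c d]; rewrite /cexp /= expRD cosD sinD.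
apply/eqP; rewrite eq_complex /=; apply/andP; split; apply/eqP; ring.
Qed.

Lemma cexp_real (a : R) : cexp a%:C = (expR a)%:C.
Proof. by rewrite /cexp /= cos0 sin0 mulr1. Qed.

Lemma cexp0 : cexp 0 = 1 :> R[i].
Proof. by rewrite (cexp_real 0) expR0. Qed.

Lemma nrm_cexp z : nrm (cexp z) = expR (complex.Re z).
Proof.
rewrite /cexp nrmM nrm_real ger0_norm ?expR_ge0//.
by rewrite /nrm normc_def /= cos2Dsin2 sqrtr1 mulr1.
Qed.

Lemma cexp_line (a b t : R) :
  cexp ((a +i* b) * t%:C) = (expR (a * t) * cos (b * t)) +i* (expR (a * t) * sin (b * t)).
Proof.
rewrite /cexp /= !mulr0 subr0 add0r.
by apply/eqP; rewrite eq_complex /= !mul0r subr0 addr0 !eqxx.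
Qed.

Lemma continuous_complex (T : topologicalType) (f g : T -> R) :
  continuous f -> continuous g -> continuous (fun t => f t +i* g t : R[i]^o).
Proof.
move=> fc gc t; apply/(@cvg_nrmP R R[i]^o) => e e0.
have e2 : 0 < e / 2 by rewrite divr_gt0.
have /cvgrPdist_lt/(_ _ e2) := fc t; have /cvgrPdist_lt/(_ _ e2) := gc t.
apply: filterS2 => s h1 h2.
have -> : f t +i* g t - (f s +i* g s) = (f t - f s) +i* (g t - g s) by [].
by rewrite (le_lt_trans (nrm_complex _ _))// (splitr e) ltrD.
Qed.

Lemma continuous_cexp (l : R[i]) : continuous (fun t : R => cexp (l * t%:C) : R[i]^o).
Proof.
case: l => a b; under eq_fun do rewrite cexp_line.
have lin (c : R) : continuous (fun t : R => c * t).
  by move=> t; exact: mulrl_continuous.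
have e1 : continuous (fun t : R => expR (a * t)).
  by move=> t; apply: continuous_comp; [exact: lin|exact: continuous_expR].
apply: continuous_complex => t; apply: cvgM; try exact: e1.
  by apply: continuous_comp; [exact: lin|exact: continuous_cos].
by apply: continuous_comp; [exact: lin|exact: continuous_sin].
Qed.

Lemma within_continuousZ (V : normedModType R[i]) (a b : R) (k : R -> R[i]^o) (f : R -> V) :
  {within `[a, b], continuous k} -> {within `[a, b], continuous f} ->
  {within `[a, b], continuous (fun t => k t *: f t)}.
Proof. by move=> kc fc x; apply: cvgZ; [exact: kc|exact: fc]. Qed.

Lemma within_continuous_cexp (V : normedModType R[i]) (l : R[i]) (a b : R) (f : R -> V) :
  {within `[a, b], continuous f} ->
  {within `[a, b], continuous (fun t => cexp (l * t%:C) *: f t)}.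
Proof.
by apply: within_continuousZ; exact/continuous_subspaceT/continuous_cexp.
Qed.

End complex_exponential.

(** * Linearity, bounds and half-plane estimates for [Phi] *)

Section delay_functional.
Context {R : realType}.
Variables (X : completeNormedModType R[i]) (eta : R -> X -> X) (M : R).
Hypothesis eta_lin : forall t : R, -1 <= t <= 0 -> linear (eta t).
Hypothesis eta_var : forall s : seq R, itv_partition (-1) 0 s ->
    (\sum_(i < size s)
       opnorm (fun x => eta (nth 0 s i) x - eta (nth 0 (-1 :: s) i) x)%R
     <= M%:E)%E.

Let N10 : -1 < 0 :> R. Proof. by rewrite ltrN10. Qed.

Lemma within_continuous_exp (l : R[i]) (x : X) :
  {within `[-1, 0], continuous (fun t : R => cexp (l * t%:C) *: x)}.
Proof.
by apply: within_continuous_cexp; apply: continuous_subspaceT => t; exact: cvg_cst.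
Qed.

Lemma PhiD (f g : R -> X) : {within `[-1, 0], continuous f} ->
  {within `[-1, 0], continuous g} -> Phi eta (fun t => f t + g t) = Phi eta f + Phi eta g.
Proof.
move=> fc gc; have := RS_integral_linear N10 eta_lin eta_var 1 fc gc.
by rewrite scale1r => <-; congr (RS_integral _ _ _ _); apply/funext => t; rewrite scale1r.
Qed.

Lemma PhiZ l (f : R -> X) : {within `[-1, 0], continuous f} ->
  Phi eta (fun t => l *: f t) = l *: Phi eta f.
Proof.
move=> fc; have c0 : {within `[-1, 0], continuous (fun _ : R => 0 : X)}.
  by apply: continuous_subspaceT => t; exact: cvg_cst.
have := RS_integral_linear N10 eta_lin eta_var l fc c0.
have -> : RS_integral (-1) 0 eta (fun=> 0) = 0.
  apply/nrm_le0; apply: (@le_trans _ _ (M * 0)); last by rewrite mulr0.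
  apply: (RS_integral_le N10 eta_lin eta_var) => //.
  by move=> u _; rewrite nrm0.
by rewrite addr0 => <-; congr (RS_integral _ _ _ _); apply/funext => t; rewrite addr0.
Qed.

Lemma PhiB (f g : R -> X) : {within `[-1, 0], continuous f} ->
  {within `[-1, 0], continuous g} -> Phi eta (fun t => f t - g t) = Phi eta f - Phi eta g.
Proof.
move=> fc gc; rewrite -[- Phi eta g]scaleN1r -PhiZ// -PhiD//.
  by congr (Phi _ _); apply/funext => t; rewrite scaleN1r.
by move=> t; apply: cvgZr; exact: gc.
Qed.

Lemma Phi_le (f : R -> X) c : {within `[-1, 0], continuous f} ->
  (forall t, -1 <= t <= 0 -> nrm (f t) <= c) -> nrm (Phi eta f) <= M * c.
Proof. exact: (RS_integral_le N10 eta_lin eta_var). Qed.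

Lemma Phi_ext (f g : R -> X) : {within `[-1, 0], continuous f} ->
  {within `[-1, 0], continuous g} -> (forall t, -1 <= t <= 0 -> f t = g t) ->
  Phi eta f = Phi eta g.
Proof. exact: (RS_integral_ext N10 eta_lin eta_var). Qed.

Lemma Phi_expZ l a x : Phi_exp eta l (a *: x) = a *: Phi_exp eta l x.
Proof.
rewrite /Phi_exp -PhiZ; last exact: within_continuous_exp.
by congr (Phi _ _); apply/funext => t; rewrite !scalerA mulrC.
Qed.

Lemma Phi_expD l x y : Phi_exp eta l (x + y) = Phi_exp eta l x + Phi_exp eta l y.
Proof.
rewrite /Phi_exp -PhiD; try exact: within_continuous_exp.
by congr (Phi _ _); apply/funext => t; rewrite scalerDr.
Qed.

(** Since [t] is nonpositive, only a lower bound on the real part of [l] enters; the estimates built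
    on this one are therefore uniform on right half planes. *)
Lemma nrm_cexp_line_le (l : R[i]) (c t : R) : 0 <= c -> - c <= complex.Re l ->
  -1 <= t <= 0 -> nrm (cexp (l * t%:C)) <= expR c.
Proof.
move=> c0 cl /andP[t1 t0]; rewrite nrm_cexp ler_expR; case: l cl => a b /= cl.
by rewrite mulr0 subr0; nra.
Qed.

Lemma Phi_exp_le l c x : 0 <= c -> - c <= complex.Re l ->
  nrm (Phi_exp eta l x) <= M * (expR c * nrm x).
Proof.
move=> c0 cl; apply: Phi_le; first exact: within_continuous_exp.
by move=> t tI; rewrite nrmZ ler_wpM2r ?nrm_ge0// nrm_cexp_line_le.
Qed.

(** The two exponentials share an oscillating factor of modulus 1, so the constant is independent of
    [b]. *)
Lemma Phi_exp_lipschitz (a a' b c : R) x : 0 <= c -> - c <= a -> - c <= a' ->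
  nrm (Phi_exp eta (a +i* b) x - Phi_exp eta (a' +i* b) x) <=
  M * (expR c * `|a - a'| * nrm x).
Proof.
move=> c0 ca ca'; rewrite /Phi_exp -PhiB; try exact: within_continuous_exp.
apply: Phi_le => [|t /andP[t1 t0]].
  move=> t; apply: cvgB; exact: within_continuous_exp.
rewrite -scalerBl nrmZ ler_wpM2r ?nrm_ge0//.
have -> : cexp ((a +i* b) * t%:C) - cexp ((a' +i* b) * t%:C) =
    (expR (a * t) - expR (a' * t))%:C * (cos (b * t) +i* sin (b * t)).
  by rewrite !cexp_line; apply/eqP; rewrite eq_complex /= !mul0r subr0 addr0 !mulrBl !eqxx.
rewrite nrmM nrm_real.
have -> : nrm (cos (b * t) +i* sin (b * t)) = 1.
  by rewrite /nrm normc_def /= cos2Dsin2 sqrtr1.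
rewrite mulr1 (le_trans (@expR_lipschitz _ c _ _ _ _))//; try nra.
rewrite ler_wpM2l ?expR_ge0// -mulrBl normrM ler_piMr// ler_norml t1 /=.
exact: le_trans t0 _.
Qed.

(** By linearity the four-point combination is formed under [Phi], where [cosh_cos_bound] controls
    it; the constant 3 comes from there. *)
Lemma Phi_exp_half_plane (a m : R) x :
  (forall w, nrm (Phi_exp eta (a +i* w) x) <= m) ->
  forall y w, a <= y -> nrm (Phi_exp eta (y +i* w) x) <= m.
Proof.
move=> hm; pose c := `|a|.
have c0 : 0 <= c by exact: normr_ge0.
have ca y : a <= y -> - c <= y.
  by move=> ay; apply: le_trans ay; rewrite /c lerNl -normrN ler_norm.
have M0 : 0 <= M by exact: eta_variation_ge0 N10 eta_var.
have C0 : 0 <= M * (3 * expR c * nrm x) by rewrite !mulr_ge0 ?expR_ge0 ?nrm_ge0.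
apply: (@half_plane_bound R X (fun l => Phi_exp eta l x) a (M * (expR c * nrm x)) _ _ C0) => //.
  by move=> y w ay; apply: Phi_exp_le => //=; exact: ca.
move=> y w r r0 r1 ay.
(* The four neighbouring exponentials, minus four times the central one, are [k t] times the central
   one: the horizontal pair gives the real exponentials, the vertical pair the cosine. *)
pose k (t : R) := expR (r * t) + expR (- (r * t)) + 2 * cos (r * t) - 4.
have wD (f g : R -> X) : {within `[-1, 0], continuous f} ->
    {within `[-1, 0], continuous g} -> {within `[-1, 0], continuous (fun t => f t + g t)}.
  by move=> fc gc t; apply: cvgD; [exact: fc|exact: gc].
have wB (f g : R -> X) : {within `[-1, 0], continuous f} ->
    {within `[-1, 0], continuous g} -> {within `[-1, 0], continuous (fun t => f t - g t)}.
  by move=> fc gc t; apply: cvgB; [exact: fc|exact: gc].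
have c1 := @within_continuous_exp ((y + r) +i* w) x.
have c2 := @within_continuous_exp ((y - r) +i* w) x.
have c3 := @within_continuous_exp (y +i* (w + r)) x.
have c4 := @within_continuous_exp (y +i* (w - r)) x.
have c5 := @within_continuous_exp (y +i* w) (4 *: x).
have c12 := wD _ _ c1 c2; have c123 := wD _ _ c12 c3; have c1234 := wD _ _ c123 c4.
have cB := wB _ _ c1234 c5.
rewrite -Phi_expZ /Phi_exp -(PhiD c1 c2) -(PhiD c12 c3) -(PhiD c123 c4) -(PhiB c1234 c5).
rewrite (_ : M * _ * _ = M * (3 * expR c * nrm x * r ^+ 3)); last by ring.
apply: (Phi_le cB) => t tI.
have -> : cexp (((y + r) +i* w) * t%:C) *: x + cexp (((y - r) +i* w) * t%:C) *: x +
    cexp ((y +i* (w + r)) * t%:C) *: x + cexp ((y +i* (w - r)) * t%:C) *: x -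
    cexp ((y +i* w) * t%:C) *: (4 *: x) = (k t)%:C *: (cexp ((y +i* w) * t%:C) *: x).
  rewrite [in RHS]scalerA scalerA -!scalerDl -scalerBl; congr (_ *: _).
  rewrite !cexp_line !mulrDl !expRD !cosD !sinD !mulNr !cosN !sinN.
  rewrite -[4](rmorph_nat (@real_complex R)) /k.
  by apply/eqP; rewrite eq_complex /=; apply/andP; split; apply/eqP; ring.
rewrite nrmZ nrm_real nrmZ.
have := tI => /andP[t1 t0].
have rt : `|r * t| <= r.
  by rewrite normrM (gtr0_norm r0) ler_piMr ?(ltW r0)// ler_norml t1 /= (le_trans t0).
have := @cosh_cos_bound _ (r * t) (le_trans rt r1); rewrite -/(k t) => kt.
have kt' : `|k t| <= 3 * r ^+ 3.
  by rewrite (le_trans kt)// ler_wpM2l// lerXn2r// nnegrE ltW.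
rewrite (_ : 3 * expR c * _ * _ = 3 * r ^+ 3 * (expR c * nrm x)); last by ring.
apply: ler_pM => //; first by rewrite mulr_ge0 ?nrm_ge0.
rewrite ler_wpM2r ?nrm_ge0// nrm_cexp_line_le//=; apply: ca.
by rewrite (le_trans ay)// gerBl ltW.
Qed.

End delay_functional.

(** * Bochner integration *)

Section simple_maps.
Context d (T : measurableType d) {R : realType}.

(** [simple_fun] without a norm on the codomain, so that pairs of simple functions, truth values and
    real-valued simple functions are covered; sums, products and truncations are then
    compositions. *)
Definition simple_map (Y : Type) (q : T -> Y) : Prop :=
  finite_set (range q) /\ forall y, measurable (q @^-1` [set y]).

Lemma simple_map_preimage (Y : Type) (q : T -> Y) (B : set Y) :
  simple_map q -> measurable (q @^-1` B).
Proof.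
move=> [fq mq].
have -> : q @^-1` B = \bigcup_(y in range q `&` B) q @^-1` [set y].
  apply/seteqP; split => [t Bt|t [y [_ By] /= qy]]; last by rewrite /= qy.
  by exists (q t) => //; split => //; exists t.
by apply: fin_bigcup_measurable => //; apply: sub_finite_set fq => y [].
Qed.

Lemma simple_map_comp (Y Z : Type) (q : T -> Y) (h : Y -> Z) :
  simple_map q -> simple_map (h \o q).
Proof.
move=> sq; split; first by rewrite -(image_comp q h); exact: (finite_image h sq.1).
by move=> z; rewrite comp_preimage; exact: simple_map_preimage.
Qed.

Lemma simple_map_pair (Y Z : Type) (q : T -> Y) (r : T -> Z) :
  simple_map q -> simple_map r -> simple_map (fun t => (q t, r t)).
Proof.
move=> [fq mq] [fr mr]; split.
  apply: (@sub_finite_set _ _ (range q `*` range r)); last exact: finite_setX.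
  by move=> _ [t _ <-]; split; exists t.
move=> [y z]; have -> : (fun t => (q t, r t)) @^-1` [set (y, z)] =
    q @^-1` [set y] `&` r @^-1` [set z].
  by apply/seteqP; split => [t /= [-> ->]|t /= [-> ->]].
exact: measurableI.
Qed.

Lemma simple_map_mem (A : set T) : measurable A -> simple_map (fun t => t \in A).
Proof.
move=> mA; split.
  apply: (@sub_finite_set _ _ [set true; false]); last exact: finite_set2.
  by move=> [] _; [left|right].
move=> [].
  have -> : (fun t => t \in A) @^-1` [set true] = A => //.
  by apply/seteqP; split => t /= => [/set_mem//|At]; rewrite mem_set.
have -> : (fun t => t \in A) @^-1` [set false] = ~` A; last exact: measurableC.
apply/seteqP; split => t /=; first by move=> + At; rewrite mem_set.
by move=> ?; rewrite memNset.
Qed.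

Variables (mu : {measure set T -> \bar R}) (mu_fin : (mu setT < +oo)%E).

Lemma fin_mu (A : set T) : measurable A -> mu A \is a fin_num.
Proof.
move=> mA; rewrite ge0_fin_numE// (le_lt_trans _ mu_fin)//.
by apply: le_measure; rewrite ?inE.
Qed.

Lemma bounded_integrable (k : T -> R) (c : R) : measurable_fun setT k ->
  (forall t, `|k t| <= c) -> mu.-integrable setT (EFin \o k).
Proof.
move=> mk kc; apply: (@le_integrable _ _ _ mu setT measurableT _ (EFin \o cst c)).
- exact/measurable_EFinP.
- by move=> t _ /=; rewrite lee_fin (le_trans (kc t))// ler_norm.
- apply/integrableP; split; first exact/measurable_EFinP.
  under eq_integral do rewrite /=.
  by rewrite integral_cst//= lte_mul_pinfty.
Qed.

Variables (Y : choiceType) (q : T -> Y) (sq : simple_map q).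

Definition fiber_mass (y : Y) : R := fine (mu (q @^-1` [set y])).

Lemma integral_simple_map (k : Y -> R) :
  (\int[mu]_t (k (q t))%:E)%E =
  (\sum_(y <- fset_set (range q)) fiber_mass y * k y)%:E.
Proof.
have mI (y : Y) : measurable (q @^-1` [set y]) by exact: sq.2.
have kE t : (k (q t))%:E = (\sum_(y <- fset_set (range q))
    (k y)%:E * (\1_(q @^-1` [set y]) t)%:E)%E.
  rewrite (bigD1_seq (q t)) ?fset_uniq//=; last first.
    by rewrite in_fset_set ?inE; [exists t|exact: sq.1].
  rewrite indicE mem_set// mule1 big1 ?adde0// => y yq.
  rewrite indicE memNset ?mule0//= => qy; by rewrite qy eqxx in yq.
under eq_integral do rewrite kE.
rewrite (@integral_sum _ _ _ mu setT measurableT) /=; last first.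
  move=> y; apply: integrableZl => //.
  by apply: (@bounded_integrable _ 1) => // t; rewrite indicE; case: (_ \in _);
    rewrite ?normr1 ?normr0.
rewrite -sumEFin; apply: eq_bigr => y _.
have i1 : mu.-integrable setT (EFin \o (\1_(q @^-1` [set y]) : T -> R)).
  by apply: (@bounded_integrable _ 1) => // t; rewrite indicE; case: (_ \in _);
    rewrite ?normr1 ?normr0.
rewrite (integralZl measurableT i1) integral_indic// setIT muleC EFinM.
by rewrite /fiber_mass fineK// fin_mu.
Qed.

Variable X : normedModType R[i].

(** The sum may run over the values of [q] instead of those of [h \o q]. With [q] a pair of simple
    functions, this puts both of them and their linear combinations over one index set. *)
Lemma simple_integral_comp (h : Y -> X) :
  simple_integral mu (h \o q) =
  \sum_(y <- fset_set (range q)) (fiber_mass y)%:C *: h y.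
Proof.
have shq := simple_map_comp h sq.
rewrite /simple_integral fsbig_finite; last exact: shq.1.
have E (x : X) : fine (mu ((h \o q) @^-1` [set x])) =
    \sum_(y <- fset_set (range q)) fiber_mass y * (h y == x)%:R.
  have := integral_simple_map (fun y => (h y == x)%:R).
  have -> : (\int[mu]_t ((h (q t) == x)%:R)%:E)%E = mu ((h \o q) @^-1` [set x]).
    transitivity (\int[mu]_t (\1_((h \o q) @^-1` [set x]) t)%:E)%E; last first.
      by rewrite integral_indic ?setIT//; exact: shq.2.
    apply: eq_integral => t _; congr (_%:E); rewrite indicE; congr (_%:R).
    have [hx|hx] := eqVneq (h (q t)) x; first by rewrite mem_set.
    by rewrite memNset// => /= /eqP; rewrite (negbTE hx).
  by move=> ->.
under eq_bigr => x _ do rewrite E rmorph_sum /= scaler_suml.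
rewrite exchange_big /=; apply: eq_big_seq => y yq.
have hyF : h y \in fset_set (range (h \o q)).
  rewrite in_fset_set ?inE; last exact: shq.1.
  by move: yq; rewrite in_fset_set ?inE; [move=> [t _ <-]; exists t|exact: sq.1].
rewrite (bigD1_seq (h y)) ?fset_uniq//= eqxx mulr1 big1 ?addr0// => x xy.
by rewrite eq_sym (negbTE xy) mulr0 scale0r.
Qed.

End simple_maps.

(** * The Bochner integral for a finite measure *)

Section bochner_theory.
Context d (T : measurableType d) {R : realType}.

Lemma ecvg0P (u : nat -> \bar R) : (forall n, (0 <= u n)%E) ->
  u n @[n --> \oo] --> 0%E <->
  forall e : R, 0 < e -> \forall n \near \oo, (u n < e%:E)%E.
Proof.
move=> u0; split=> [/fine_cvgP[ufin /cvgrPdist_lt uc] e e0|h].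
  have := uc e e0; apply: filterS2 ufin => n un.
  rewrite sub0r normrN /= ger0_norm; last exact: fine_ge0.
  by rewrite -lte_fin fineK.
apply/fine_cvgP; split.
  have := h 1 ltr01; apply: filterS => n un.
  by rewrite ge0_fin_numE// (lt_le_trans un)// leey.
apply/cvgrPdist_lt => e e0; have := h e e0; apply: filterS => n un /=.
rewrite sub0r normrN ger0_norm; last exact: fine_ge0.
by rewrite -lte_fin fineK// ge0_fin_numE// (lt_le_trans un)// leey.
Qed.

Variables (mu : {measure set T -> \bar R}) (mu_fin : (mu setT < +oo)%E).

Definition L1norm (V : normedModType R[i]) (f : T -> V) : \bar R :=
  (\int[mu]_t (nrm (f t))%:E)%E.

Section normed.
Variable X : normedModType R[i].
Implicit Types (f g h s u : T -> X).

Lemma L1norm_ge0 f : (0 <= L1norm f)%E.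
Proof. by apply: integral_ge0 => t _; rewrite lee_fin nrm_ge0. Qed.

Lemma simple_strongly_measurable s : simple_fun s -> strongly_measurable s.
Proof. by move=> ss; exists (fun=> s); split => // t; exact: cvg_cst. Qed.

Lemma strongly_measurableB f g : strongly_measurable f ->
  strongly_measurable g -> strongly_measurable (fun t => f t - g t).
Proof.
move=> mf mg; have := strongly_measurableD mf (strongly_measurableZ (-1) mg).
by congr (strongly_measurable _); apply/funext => t; rewrite !fctE scaleN1r.
Qed.

Lemma strongly_measurable_cst (x : X) : strongly_measurable (fun _ : T => x).
Proof.
apply: simple_strongly_measurable; split.
  by apply: (@sub_finite_set _ _ [set x]) => // _ [t _ <-].
by move=> y; rewrite preimage_cst; case: ifP.
Qed.

Lemma measurable_nrmE f : strongly_measurable f ->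
  measurable_fun setT (fun t => (nrm (f t))%:E).
Proof. by move=> /measurable_nrm mf; apply/measurable_EFinP. Qed.

Lemma L1norm_le (V : normedModType R[i]) f (g : T -> V) : strongly_measurable f ->
  strongly_measurable g -> (forall t, nrm (f t) <= nrm (g t)) ->
  (L1norm f <= L1norm g)%E.
Proof.
move=> mf mg fg; apply: ge0_le_integral => //.
- by move=> t _; rewrite lee_fin nrm_ge0.
- exact: measurable_nrmE.
- by apply/measurable_EFinP; exact: measurable_nrm.
- by move=> t _; rewrite lee_fin fg.
Qed.

Lemma L1normD f g : strongly_measurable f -> strongly_measurable g ->
  (L1norm (fun t => f t + g t)%R <= L1norm f + L1norm g)%E.
Proof.
move=> mf mg; rewrite -ge0_integralD//; try exact: measurable_nrmE;
  try by move=> t _; rewrite lee_fin nrm_ge0.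
apply: ge0_le_integral => //.
- by move=> t _; rewrite lee_fin nrm_ge0.
- by apply: measurable_nrmE; exact: strongly_measurableD.
- by apply: emeasurable_funD; exact: measurable_nrmE.
- by move=> t _; rewrite -EFinD lee_fin nrmD.
Qed.

Lemma L1normB_le f g h : strongly_measurable f -> strongly_measurable g ->
  strongly_measurable h ->
  (L1norm (fun t => f t - h t)%R <=
   L1norm (fun t => f t - g t)%R + L1norm (fun t => g t - h t)%R)%E.
Proof.
move=> mf mg mh; rewrite (le_trans _ (L1normD _ _))//; try exact: strongly_measurableB.
by rewrite le_eqVlt; apply/orP; left; apply/eqP; congr L1norm; apply/funext => t; rewrite addrA subrK.
Qed.

Lemma L1norm_distC f g : L1norm (fun t => f t - g t) = L1norm (fun t => g t - f t).
Proof. by apply: eq_integral => t _; rewrite nrm_distC. Qed.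

Lemma L1normZ (a : R[i]) f : strongly_measurable f ->
  L1norm (fun t => a *: f t) = ((nrm a)%:E * L1norm f)%E.
Proof.
move=> mf; rewrite /L1norm -ge0_integralZl//.
- by apply: eq_integral => t _; rewrite nrmZ EFinM.
- exact: measurable_nrmE.
- by move=> t _; rewrite lee_fin nrm_ge0.
- by rewrite lee_fin nrm_ge0.
Qed.

Lemma L1norm_simple s : simple_fun s -> L1norm s =
  (\sum_(y <- fset_set (range s)) fiber_mass mu s y * nrm y)%:E.
Proof. by move=> ss; exact: (integral_simple_map mu_fin ss). Qed.

Lemma L1norm_simple_fin s : simple_fun s -> (L1norm s < +oo)%E.
Proof. by move=> ss; rewrite L1norm_simple// ltry. Qed.

Lemma simple_integralE s : simple_fun s -> simple_integral mu s =
  \sum_(y <- fset_set (range s)) (fiber_mass mu s y)%:C *: y.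
Proof. by move=> ss; exact: (simple_integral_comp mu_fin ss id). Qed.

Lemma simple_integral_le s : simple_fun s ->
  ((nrm (simple_integral mu s))%:E <= L1norm s)%E.
Proof.
move=> ss; rewrite L1norm_simple// simple_integralE// lee_fin.
rewrite (le_trans (nrm_sum _ _ _))//; apply: ler_sum => y _.
by rewrite nrmZ nrm_real ger0_norm// fine_ge0.
Qed.

Lemma simple_fun_linear (a : R[i]) s u : simple_fun s -> simple_fun u ->
  simple_fun (fun t => a *: s t + u t).
Proof.
move=> ss su.
exact: (simple_map_comp (fun y : X * X => a *: y.1 + y.2) (simple_map_pair ss su)).
Qed.

Lemma simple_integral_linear (a : R[i]) s u : simple_fun s -> simple_fun u ->
  simple_integral mu (fun t => a *: s t + u t) =
  a *: simple_integral mu s + simple_integral mu u.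
Proof.
move=> ss su; have sp := simple_map_pair ss su.
rewrite (simple_integral_comp mu_fin sp (fun y : X * X => a *: y.1 + y.2)).
rewrite (simple_integral_comp mu_fin sp fst) (simple_integral_comp mu_fin sp snd).
rewrite scaler_sumr -big_split /=; apply: eq_bigr => y _.
by rewrite scalerDr !scalerA [a * _]mulrC.
Qed.

Lemma simple_integralB s u : simple_fun s -> simple_fun u ->
  simple_integral mu (fun t => s t - u t) =
  simple_integral mu s - simple_integral mu u.
Proof.
move=> ss su; have := simple_integral_linear (-1) su ss.
rewrite scaleN1r addrC => <-; congr simple_integral.
by apply/funext => t; rewrite scaleN1r addrC.
Qed.

Lemma simple_funB s u : simple_fun s -> simple_fun u ->
  simple_fun (fun t => s t - u t).
Proof.
move=> ss su.
exact: (simple_map_comp (fun y : X * X => y.1 - y.2) (simple_map_pair ss su)).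
Qed.

Lemma simple_nrm_integrable s : simple_fun s ->
  mu.-integrable setT (EFin \o (@nrm R X \o s)).
Proof.
move=> ss; apply/integrableP; split.
  exact/measurable_nrmE/simple_strongly_measurable.
under eq_integral => t _ do rewrite /= ger0_norm ?nrm_ge0//.
exact: L1norm_simple_fin.
Qed.

Lemma is_bochner_integral_uniq f v w :
  is_bochner_integral mu f v -> is_bochner_integral mu f w -> v = w.
Proof.
move=> [mf [s [ss _ fs sv]]] [_ [u [su _ fu uw]]]; apply: nrm_lt_eq => e e0.
have e4 : 0 < e / 4 by rewrite divr_gt0.
have pos (z : nat -> T -> X) n : (0 <= L1norm (fun t => f t - z n t)%R)%E.
  exact: L1norm_ge0.
have {}fs := (ecvg0P (pos s)).1 fs _ e4; have {}fu := (ecvg0P (pos u)).1 fu _ e4.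
move: sv uw => /cvg_nrmP/(_ _ e4) sv /cvg_nrmP/(_ _ e4) uw.
near \oo => n.
have h1 : nrm (v - simple_integral mu (s n)) < e / 4 by near: n.
have h2 : nrm (w - simple_integral mu (u n)) < e / 4 by near: n.
have h3 : (L1norm (fun t => f t - s n t)%R < (e / 4)%:E)%E by near: n.
have h4 : (L1norm (fun t => f t - u n t)%R < (e / 4)%:E)%E by near: n.
have h5 : nrm (simple_integral mu (s n) - simple_integral mu (u n)) < e / 2.
  rewrite -simple_integralB// -lte_fin.
  apply: (le_lt_trans (simple_integral_le (simple_funB (ss n) (su n)))).
  have := L1normB_le (simple_strongly_measurable (ss n)) mf
    (simple_strongly_measurable (su n)).
  rewrite [X in (_ <= X + _)%E]L1norm_distC => /le_lt_trans; apply.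
  have -> : e / 2 = e / 4 + e / 4 by lra.
  by rewrite EFinD lteD.
rewrite -(subrK (simple_integral mu (s n)) v) -addrA (le_lt_trans (nrmD _ _))//.
have -> : e = e / 4 + (e / 2 + e / 4) by lra.
rewrite ltrD// (le_lt_trans (nrmB_le _ (simple_integral mu (u n)) _))// ltrD//.
by rewrite nrm_distC.
Unshelve. all: by end_near. Qed.

(** Approximants are replaced by 0 wherever they exceed [2 * nrm (f t)]. If [f t] is nonzero this
    eventually changes nothing at [t], because the approximants come within [nrm (f t)] of [f t]; if
    it is zero the truncated values are all zero. *)
Lemma simple_approx_dominated f : strongly_measurable f ->
  exists s : nat -> T -> X, [/\ forall n, simple_fun (s n),
    forall t, s n t @[n --> \oo] --> f t &
    forall n t, nrm (s n t) <= 2 * nrm (f t)].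
Proof.
move=> mf; have [s [ss sf]] := mf.
pose A n := [set t | nrm (s n t) <= 2 * nrm (f t)].
have mA n : measurable (A n).
  have := @measurable_fun_ler _ _ _ setT (@nrm R X \o s n) (fun t => 2 * nrm (f t)).
  move=> /(_ (measurable_nrm (simple_strongly_measurable (ss n)))) H.
  have /H{H} : measurable_fun setT (fun t => 2 * nrm (f t)).
    by apply: measurable_funM => //; exact: measurable_nrm.
  move=> mle; have mtrue : measurable [set true] by [].
  by have := mle measurableT _ mtrue; rewrite setTI.
exists (fun n t => if t \in A n then s n t else 0); split.
- move=> n; exact: (simple_map_comp (fun y : bool * X => if y.1 then y.2 else 0)
    (simple_map_pair (simple_map_mem (mA n)) (ss n))).
- move=> t; have /cvg_nrmP st := sf t; apply/cvg_nrmP => e e0.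
  have [ft|ft] := eqVneq (f t) 0.
    apply: nearW => n; case: ifPn => [|_]; last by rewrite ft subr0 nrm0.
    rewrite inE /A /= ft nrm0 mulr0 => /nrm_le0 ->.
    by rewrite subr0 nrm0.
  have ft0 : 0 < nrm (f t).
    by rewrite lt_neqAle nrm_ge0 andbT eq_sym; apply: contra_neq ft; exact: nrm0_eq0.
  apply: filterS2 (st _ ft0) (st _ e0) => n h1 h2.
  rewrite mem_set// /A /=.
  rewrite -[s n t](subrK (f t)) (le_trans (nrmD _ _))// nrm_distC.
  by rewrite mulr_natl mulr2n lerD2r ltW.
- move=> n t; case: ifPn => [|_]; first by rewrite inE.
  by rewrite nrm0 mulr_ge0 ?nrm_ge0.
Qed.

Lemma L1norm_dominated_cvg (f_ : nat -> T -> X) f (k : T -> R) :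
  (forall n, strongly_measurable (f_ n)) -> strongly_measurable f ->
  mu.-integrable setT (EFin \o k) ->
  {ae mu, forall t, f_ n t @[n --> \oo] --> f t} ->
  (forall n t, nrm (f t - f_ n t) <= k t) ->
  L1norm (fun t => f t - f_ n t) @[n --> \oo] --> 0%E.
Proof.
move=> mf_ mf ik ff fk.
have H := @dominated_convergence _ _ _ mu setT measurableT
  (fun n t => (nrm (f t - f_ n t))%:E) (cst 0%E) (EFin \o k) _ _ _ ik _.
have [||||_ _] := H.
- by move=> n; apply: measurable_nrmE; exact: strongly_measurableB.
- exact: measurable_cst.
- apply: filterS ff => t ft _; apply/fine_cvgP; split; first exact: nearW.
  apply/cvgrPdist_lt => e e0; move: ft => /cvg_nrmP/(_ _ e0).
  by apply: filterS => n h; rewrite sub0r normrN /= ger0_norm ?nrm_ge0.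
- apply: nearW => t n _ /=; rewrite lee_fin ger0_norm ?nrm_ge0//.
by rewrite integral0.
Qed.

End normed.

Section complete.
Variable X : completeNormedModType R[i].
Implicit Types (f g h s u : T -> X).

Definition L1 f : Prop := strongly_measurable f /\ (L1norm f < +oo)%E.

Lemma L1_integrable f : L1 f -> mu.-integrable setT (fun t => (nrm (f t))%:E).
Proof.
move=> [mf f1]; apply/integrableP; split; first exact: measurable_nrmE.
by under eq_integral => t _ do rewrite /= ger0_norm ?nrm_ge0//.
Qed.

Lemma L1_simple_approx f : L1 f -> exists s : nat -> T -> X,
  (forall n, simple_fun (s n)) /\ L1norm (fun t => f t - s n t) @[n --> \oo] --> 0%E.
Proof.
move=> f1; have [mf _] := f1.
have [s [ss sf sd]] := simple_approx_dominated mf; exists s; split => //.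
(* The dominating function adds [nrm (f t)] to the bound [2 * nrm (f t)] on the approximants. *)
apply: (@L1norm_dominated_cvg _ s f (fun t => 3 * nrm (f t))) => //.
- by move=> n; exact: simple_strongly_measurable.
- exact: (integrableZl measurableT 3 (L1_integrable f1)).
- exact: nearW.
- move=> n t; rewrite (le_trans (nrmD _ _))// nrmN.
  by have := sd n t; lra.
Qed.

Lemma is_bochner_integral_exists f : L1 f -> exists v, is_bochner_integral mu f v.
Proof.
move=> f1; have [s [ss sf]] := L1_simple_approx f1; have [mf _] := f1.
have [v sv] : exists v : X, simple_integral mu (s n) @[n --> \oo] --> v.
  apply: cauchy_nrm_cvg => e e0; have e2 : 0 < e / 2 by rewrite divr_gt0.
  have pos n : (0 <= L1norm (fun t => f t - s n t)%R)%E by exact: L1norm_ge0.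
  have [N _ hN] := (ecvg0P pos).1 sf _ e2; exists N => m n Nm Nn.
  rewrite -simple_integralB// -lte_fin.
  apply: (le_lt_trans (simple_integral_le (simple_funB (ss m) (ss n)))).
  have := L1normB_le (simple_strongly_measurable (ss m)) mf
    (simple_strongly_measurable (ss n)).
  rewrite [X in (_ <= X + _)%E]L1norm_distC => /le_lt_trans; apply.
  by rewrite (splitr e) EFinD lteD//; exact: hN.
exists v; split => //; exists s; split => // n; exact: simple_nrm_integrable.
Qed.

Lemma bochner_integralP f : L1 f -> is_bochner_integral mu f (bochner_integral mu f).
Proof.
move=> /is_bochner_integral_exists[v fv].
by apply: (@getPex _ (is_bochner_integral mu f)); exists v.
Qed.

Lemma bochner_integralE f v : is_bochner_integral mu f v -> bochner_integral mu f = v.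
Proof.
move=> fv; apply/esym/(is_bochner_integral_uniq fv).
by apply: (@getPex _ (is_bochner_integral mu f)); exists v.
Qed.

Lemma L1_linear (a : R[i]) f g : L1 f -> L1 g -> L1 (fun t => a *: f t + g t).
Proof.
move=> [mf f1] [mg g1]; have maf := strongly_measurableZ a mf.
split; first exact: strongly_measurableD.
rewrite (le_lt_trans (L1normD maf mg))// lte_add_pinfty// L1normZ//.
by rewrite lte_mul_pinfty// lee_fin nrm_ge0.
Qed.

Lemma bochner_integral_linear (a : R[i]) f g : L1 f -> L1 g ->
  bochner_integral mu (fun t => a *: f t + g t) =
  a *: bochner_integral mu f + bochner_integral mu g.
Proof.
move=> f1 g1; apply: bochner_integralE; split; first by have [] := L1_linear a f1 g1.
have [mf [s [ss _ fs sv]]] := bochner_integralP f1.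
have [mg [u [su _ gu uw]]] := bochner_integralP g1.
exists (fun n t => a *: s n t + u n t); split.
- by move=> n; exact: simple_fun_linear.
- by move=> n; apply: simple_nrm_integrable; exact: simple_fun_linear.
- have pos (z : nat -> T -> X) k n : (0 <= L1norm (fun t => k t - z n t)%R)%E.
    exact: L1norm_ge0.
  rewrite -/(L1norm _); apply/ecvg0P => [n|e e0]; first exact: L1norm_ge0.
  have l0 : 0 < nrm a + 1 by rewrite ltr_wpDl// nrm_ge0.
  have e1 : 0 < e / 2 / (nrm a + 1) by rewrite !divr_gt0.
  have e2 : 0 < e / 2 by rewrite divr_gt0.
  have {}fs := (ecvg0P (pos s f)).1 fs _ e1; have {}gu := (ecvg0P (pos u g)).1 gu _ e2.
  apply: filterS2 fs gu => n h1 h2.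
  have mfs := strongly_measurableB mf (simple_strongly_measurable (ss n)).
  have mgu := strongly_measurableB mg (simple_strongly_measurable (su n)).
  have := L1normD (strongly_measurableZ a mfs) mgu.
  rewrite L1normZ// => h3.
  change (L1norm (fun t => a *: f t + g t - (a *: s n t + u n t))%R < e%:E)%E.
  have -> : (fun t => a *: f t + g t - (a *: s n t + u n t)) =
    (fun t => (a *: (fun t0 => f t0 - s n t0)) t + (g t - u n t)).
    by apply/funext => t; rewrite !fctE opprD addrACA scalerBr.
  apply: (le_lt_trans h3); rewrite (splitr e) EFinD lteD//.
  have lf : (L1norm (fun t => f t - s n t)%R) \is a fin_num.
    by rewrite ge0_fin_numE ?L1norm_ge0// (lt_le_trans h1)// leey.
  move: h1; rewrite -(fineK lf) -EFinM !lte_fin ltr_pdivlMr//.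
  apply: le_lt_trans; rewrite mulrC ler_wpM2l ?lerDl//.
  by rewrite fine_ge0// L1norm_ge0.
- rewrite (_ : (fun n => _) = (fun n => a *: simple_integral mu (s n) + simple_integral mu (u n))).
    by apply: cvgD; [apply: cvgZr; exact: sv|exact: uw].
  by apply/funext => n; rewrite simple_integral_linear.
Qed.

Lemma bochner_integral_le f : L1 f ->
  ((nrm (bochner_integral mu f))%:E <= L1norm f)%E.
Proof.
move=> f1; have [mf [s [ss _ fs sv]]] := bochner_integralP f1.
set v := bochner_integral mu f in sv *.
have lf : (L1norm f) \is a fin_num by rewrite ge0_fin_numE ?L1norm_ge0//; case: f1.
rewrite -(fineK lf) lee_fin; apply/ler_addgt0Pr => e e0.
have pos n : (0 <= L1norm (fun t => f t - s n t)%R)%E by exact: L1norm_ge0.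
have e2 : 0 < e / 2 by rewrite divr_gt0.
have {}fs := (ecvg0P pos).1 fs _ e2; move: sv => /cvg_nrmP/(_ _ e2) sv.
near \oo => n.
have h1 : nrm (v - simple_integral mu (s n)) < e / 2 by near: n.
have h2 : (L1norm (fun t => f t - s n t)%R < (e / 2)%:E)%E by near: n.
have h3 : nrm (simple_integral mu (s n)) <= fine (L1norm f) + e / 2.
  rewrite -lee_fin EFinD fineK//; apply: le_trans (simple_integral_le (ss n)) _.
  have := @L1normD _ f (fun t => s n t - f t) mf
    (strongly_measurableB (simple_strongly_measurable (ss n)) mf).
  have -> : (fun t => f t + (s n t - f t)) = s n.
    by apply/funext => t; rewrite addrC subrK.
  by move=> /le_trans; apply; rewrite leeD2l// L1norm_distC ltW.
rewrite -(subrK (simple_integral mu (s n)) v) (le_trans (nrmD _ _))//.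
by move: h1 h3; lra.
Unshelve. all: by end_near. Qed.

End complete.
End bochner_theory.

(** * Scalar factors, and comparison with the Lebesgue integral *)

Section bochner_products.
Context d (T : measurableType d) {R : realType}.
Variables (mu : {measure set T -> \bar R}) (mu_fin : (mu setT < +oo)%E).

Lemma strongly_measurableM (V : normedModType R[i]) (k : T -> R[i]^o) (f : T -> V) :
  strongly_measurable k -> strongly_measurable f ->
  strongly_measurable (fun t => k t *: f t).
Proof.
move=> [s [ss sk]] [u [su uf]]; exists (fun n t => s n t *: u n t); split.
  move=> n; exact: (simple_map_comp (fun y : R[i]^o * V => y.1 *: y.2)
    (simple_map_pair (ss n) (su n))).
by move=> t; apply: cvgZ; [exact: sk|exact: uf].
Qed.

Lemma strongly_measurable_indic (A : set T) : measurable A ->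
  strongly_measurable (fun t => (\1_A t)%:C : R[i]^o).
Proof.
move=> mA; apply: simple_strongly_measurable.
exact: (simple_map_comp (fun b : bool => (b%:R : R)%:C : R[i]^o) (simple_map_mem mA)).
Qed.

Lemma L1norm_ae_le (V : normedModType R[i]) (f : T -> V) (k : T -> R) :
  strongly_measurable f -> measurable_fun setT k -> (forall t, 0 <= k t) ->
  {ae mu, forall t, nrm (f t) <= k t} ->
  (L1norm mu f <= \int[mu]_t (k t)%:E)%E.
Proof.
move=> mf mk k0 fk; apply: ae_ge0_le_integral => //.
- by move=> t _; rewrite lee_fin nrm_ge0.
- exact: measurable_nrmE.
- by move=> t _; rewrite lee_fin.
- exact/measurable_EFinP.
- by apply: filterS fk => t h _; rewrite lee_fin.
Qed.

Lemma L1norm_aeM_le (V W : normedModType R[i]) (f : T -> V) (g : T -> W) (c : R) :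
  0 <= c -> strongly_measurable f -> strongly_measurable g ->
  {ae mu, forall t, nrm (f t) <= c * nrm (g t)} ->
  (L1norm mu f <= c%:E * L1norm mu g)%E.
Proof.
move=> c0 mf mg fg; have := @L1norm_ae_le _ f (fun t => c * nrm (g t)) mf.
have mcg : measurable_fun setT (fun t => c * nrm (g t)).
  by apply: measurable_funM => //; exact: measurable_nrm.
move=> /(_ mcg) h; apply: (le_trans (h _ fg)) => [t|]; first by rewrite mulr_ge0 ?nrm_ge0.
rewrite /L1norm -ge0_integralZl//.
- exact: measurable_nrmE.
- by move=> t _; rewrite lee_fin nrm_ge0.
Qed.

Lemma L1_ae_bounded (V : completeNormedModType R[i]) (f : T -> V) (c : R) :
  strongly_measurable f -> {ae mu, forall t, nrm (f t) <= c} -> L1 mu f.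
Proof.
move=> mf fc; split => //.
apply: (@le_lt_trans _ _ (\int[mu]_t (`|c|)%:E)%E).
  apply: L1norm_ae_le => //.
  by apply: filterS fc => t /le_trans; apply; rewrite ler_norm.
by rewrite integral_cst// lte_mul_pinfty.
Qed.

Variable X : completeNormedModType R[i].

Lemma L1M (k : T -> R[i]^o) (f : T -> X) (c : R) : strongly_measurable k ->
  {ae mu, forall t, nrm (k t) <= c} -> L1 mu f -> L1 mu (fun t => k t *: f t).
Proof.
move=> mk kc [mf f1]; have mkf := strongly_measurableM mk mf; split => //.
apply: (@le_lt_trans _ _ (`|c|%:E * L1norm mu f)%E).
  apply: L1norm_aeM_le => //; apply: filterS kc => t kc.
  by rewrite nrmZ ler_wpM2r ?nrm_ge0// (le_trans kc)// ler_norm.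
by rewrite lte_mul_pinfty.
Qed.

Lemma L1Z (a : R[i]) (f : T -> X) : L1 mu f -> L1 mu (fun t => a *: f t).
Proof.
by apply: (@L1M (cst a) f (nrm a)); [exact: strongly_measurable_cst|exact: nearW].
Qed.

Lemma L1D (f g : T -> X) : L1 mu f -> L1 mu g -> L1 mu (fun t => f t + g t).
Proof.
move=> f1 g1; have := L1_linear 1 f1 g1; congr (L1 _ _).
by apply/funext => t; rewrite scale1r.
Qed.

Lemma L1B (f g : T -> X) : L1 mu f -> L1 mu g -> L1 mu (fun t => f t - g t).
Proof.
move=> f1 g1; have := L1_linear (-1) g1 f1; congr (L1 _ _).
by apply/funext => t; rewrite scaleN1r addrC.
Qed.

Lemma L10 : L1 mu (fun=> 0 : X).
Proof.
apply: (@L1_ae_bounded _ _ 0); first exact: strongly_measurable_cst.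
by apply: nearW => t; rewrite nrm0.
Qed.

Lemma bochner_integralB (f g : T -> X) : L1 mu f -> L1 mu g ->
  bochner_integral mu (fun t => f t - g t) = bochner_integral mu f - bochner_integral mu g.
Proof.
move=> f1 g1; have := bochner_integral_linear mu_fin (-1) g1 f1.
rewrite scaleN1r addrC => <-; congr bochner_integral; apply/funext => t.
by rewrite scaleN1r addrC.
Qed.

Lemma bochner_integral0 : bochner_integral mu (fun=> 0 : X) = 0.
Proof.
transitivity (bochner_integral mu (fun=> (0 - 0 : X))).
  by congr bochner_integral; apply/funext => t; rewrite subrr.
by rewrite (bochner_integralB L10 L10) subrr.
Qed.

Lemma bochner_integralZ (a : R[i]) (f : T -> X) : L1 mu f ->
  bochner_integral mu (fun t => a *: f t) = a *: bochner_integral mu f.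
Proof.
move=> f1; have := bochner_integral_linear mu_fin a f1 L10.
rewrite bochner_integral0 addr0 => <-; congr bochner_integral; apply/funext => t.
by rewrite addr0.
Qed.

Lemma bochner_integral_ae_le (f : T -> X) (c : R) : L1 mu f ->
  (L1norm mu f <= c%:E)%E -> nrm (bochner_integral mu f) <= c.
Proof.
by move=> f1 h; rewrite -lee_fin (le_trans (bochner_integral_le mu_fin f1)).
Qed.

Lemma bochner_integral_ae_eq (f g : T -> X) : L1 mu f -> L1 mu g ->
  {ae mu, forall t, f t = g t} -> bochner_integral mu f = bochner_integral mu g.
Proof.
move=> f1 g1 fg; apply/eqP; rewrite -subr_eq0 -bochner_integralB//.
apply/eqP/nrm_le0/bochner_integral_ae_le; first exact: L1B.
have [mfg _] := L1B f1 g1.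
have := @L1norm_ae_le _ _ (cst 0) mfg (measurable_cst _) (fun _ => lexx _).
rewrite integral0; apply; apply: filterS fg => t ->.
by rewrite subrr nrm0.
Qed.

(** The bridge to real integration: Fubini and the fundamental theorem of calculus are applied to
    real functions and carried over to vectors through functions of this form. *)
Lemma bochner_integral_real (k : T -> R) (x : X) : mu.-integrable setT (EFin \o k) ->
  is_bochner_integral mu (fun t => (k t)%:C *: x) ((fine (\int[mu]_t (k t)%:E)%E)%:C *: x).
Proof.
move=> ik; have [g [ig gk gL]] := approximation_sfun_integrable measurableT ik.
have sg n : simple_map (g n : T -> R).
  split; first exact: fimfunP.
  by move=> y; exact: measurable_sfunP.
have sgx n : simple_fun (fun t => (g n t)%:C *: x).
  exact: (simple_map_comp (fun y : R => y%:C *: x) (sg n)).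
have mkx : strongly_measurable (fun t => (k t)%:C *: x).
  exists (fun n t => (g n t)%:C *: x); split => // t.
  apply/cvg_nrmP => e e0.
  have e1 : 0 < e / (nrm x + 1) by rewrite divr_gt0// ltr_wpDl// nrm_ge0.
  have /fine_cvgP[_ /cvgrPdist_lt/(_ _ e1)] := gk t I.
  apply: filterS => n /= h; rewrite -scalerBl -rmorphB nrmZ nrm_real.
  move: h; rewrite ltr_pdivlMr ?ltr_wpDl ?nrm_ge0//; apply: le_lt_trans.
  by rewrite ler_wpM2l// lerDl.
split => //; exists (fun n t => (g n t)%:C *: x); split => //.
- by move=> n; exact: simple_nrm_integrable.
- have gL' := (ecvg0P (fun n => integral_ge0 _ (fun t _ => abse_ge0 _))).1 gL.
  apply/ecvg0P => [n|e e0]; first exact: L1norm_ge0.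
  have e1 : 0 < e / (nrm x + 1) by rewrite divr_gt0// ltr_wpDl// nrm_ge0.
  have := gL' _ e1; apply: filterS => n.
  have igk : mu.-integrable setT (fun t => (k t - g n t)%:E).
    have := integrableB measurableT ik (ig n); apply: eq_integrable => // t _.
  under [X in _ -> (X < _)%E]eq_integral => t _ do
    rewrite -scalerBl -rmorphB nrmZ nrm_real mulrC EFinM.
  rewrite ge0_integralZl//; last 2 first.
  + by have /integrableP[/measurable_EFinP m _] := igk;
      apply/measurable_EFinP; exact: measurableT_comp.
  + by rewrite lee_fin nrm_ge0.
  under eq_integral => t _ do rewrite -EFinB abse_EFin.
  set I := integral _ _ _ => h.
  have I0 : (0 <= I)%E by exact: integral_ge0.
  have If : I \is a fin_num by rewrite ge0_fin_numE// (lt_le_trans h)// leey.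
  move: h; rewrite -(fineK If) -EFinM !lte_fin ltr_pdivlMr ?ltr_wpDl ?nrm_ge0//.
  apply: le_lt_trans; rewrite mulrC ler_wpM2l ?lerDl//.
  by rewrite fine_ge0.
- have E n : simple_integral mu (fun t => (g n t)%:C *: x) =
      (fine (\int[mu]_t (g n t)%:E)%E)%:C *: x.
    rewrite (simple_integral_comp mu_fin (sg n) (fun y : R => y%:C *: x)).
    rewrite (integral_simple_map mu_fin (sg n) id) /= rmorph_sum scaler_suml.
    by apply: eq_bigr => y _; rewrite scalerA rmorphM.
  rewrite (_ : (fun n => _) = (fun n => (fine (\int[mu]_t (g n t)%:E)%E)%:C *: x)); last first.
    by apply/funext.
  apply/cvg_nrmP => e e0.
  have gL' := (ecvg0P (fun n => integral_ge0 _ (fun t _ => abse_ge0 _))).1 gL.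
  have e1 : 0 < e / (nrm x + 1) by rewrite divr_gt0// ltr_wpDl// nrm_ge0.
  have := gL' _ e1; apply: filterS => n h.
  rewrite -scalerBl -rmorphB nrmZ nrm_real.
  have ikf := integrable_fin_num measurableT ik.
  have igf := integrable_fin_num measurableT (ig n).
  have h2 : (`|\int[mu]_t (k t)%:E - \int[mu]_t (g n t)%:E| < (e / (nrm x + 1))%:E)%E.
    rewrite -(integralB measurableT ik (ig n)); apply: le_lt_trans h.
    apply: le_abse_integral => //.
    by have /integrableP[] := integrableB measurableT ik (ig n).
  move: h2; rewrite -(fineK ikf) -(fineK igf) -EFinB abse_EFin lte_fin.
  rewrite ltr_pdivlMr ?ltr_wpDl ?nrm_ge0//=; apply: le_lt_trans.
  by rewrite ler_wpM2l// lerDl.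
Qed.

End bochner_products.

(** * Weak derivatives *)

Section unit_interval.
Context {R : realType}.
Local Notation T := (measurableTypeR R).
Local Notation mu := (@mu10 R).

Lemma mu10E (A : set T) : mu A = lebesgue_measure (A `&` `[-1, 0]).
Proof. by []. Qed.

Lemma mu10_setT : mu setT = 1%E.
Proof.
rewrite mu10E setTI lebesgue_measure_itv /= lte_fin ltrN10 -EFinD.
by rewrite opprK add0r.
Qed.

Lemma mu10_fin : (mu setT < +oo)%E.
Proof. by rewrite mu10_setT ltry. Qed.

Lemma mu10_ae : {ae mu, forall t : T, -1 <= t <= 0}.
Proof.
exists (~` `[-1, 0]); split; first exact: measurableC.
  by rewrite mu10E setICl measure0.
by move=> t /= h tI; apply: h; move: tI; rewrite /= in_itv.
Qed.

Lemma mu10_ae_neq (a : R) : {ae mu, forall t : T, t <> a}.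
Proof.
exists [set a]; split => //.
  rewrite mu10E; apply/eqP; rewrite eq_le measure_ge0 andbT.
  rewrite -(@lebesgue_measure_set1 R a) le_measure ?inE//.
  exact: measurableI.
by move=> t /= /contrapT.
Qed.

Lemma integral_mu10 (f : R -> \bar R) : measurable_fun setT (f : T -> \bar R) ->
  (\int[mu]_t f t = \int[lebesgue_measure]_(t in `[(-1)%R, 0%R]) f t)%E.
Proof.
move=> mf; have mI : measurable (`[-1, 0] : set T) by [].
transitivity (\int[mu]_(t in `[(-1)%R, 0%R]) f t)%E.
  rewrite [RHS]integral_mkcond; apply: ae_eq_integral => //.
    by apply/(measurable_restrictT _ mI); exact: measurable_funTS.
  apply: filterS mu10_ae => t tI _.
  by rewrite patchE mem_set//= in_itv.
apply: eq_measure_integral => A mA AI.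
by rewrite mu10E setIidl.
Qed.

(** For the zero measure every measurable function is integrable, in particular the identity; the
    approximation theorem then gives simple functions [q n] converging to the identity at every
    point, and [g \o q n] converges to [g]. *)
Lemma continuous_strongly_measurable (V : normedModType R[i]) (g : R -> V) :
  continuous g -> strongly_measurable (g : T -> V).
Proof.
move=> gc; have iid : (@mzero _ T R).-integrable setT (EFin \o (id : T -> R)).
  apply/integrableP; split; first exact/measurable_EFinP.
  by rewrite integral_measure_zero.
have [q [_ qk _]] := approximation_sfun_integrable measurableT iid.
exists (fun n => g \o q n); split => [n|t].
  apply: (simple_map_comp g); split; first exact: fimfunP.
  by move=> y; exact: measurable_sfunP.
have /fine_cvgP[_ h] := qk t I.
have h' : (q n t : R) @[n --> \oo] --> (t : R) by exact: h.
exact: (continuous_cvg _ (gc t) h').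
Qed.

Lemma continuous_ae_eq (V : normedModType R[i]) (f g : R -> V) :
  {within `[-1, 0], continuous f} -> {within `[-1, 0], continuous g} ->
  {ae mu, forall t : T, f t = g t} -> forall t, -1 <= t <= 0 -> f t = g t.
Proof.
move=> /within_itv_continuousP fc /within_itv_continuousP gc [N [mN N0 fgN]] t tI.
apply: contrapT => fg; have c0 : 0 < nrm (f t - g t).
  rewrite lt_neqAle nrm_ge0 andbT eq_sym; apply/eqP => /nrm0_eq0/eqP.
  by rewrite subr_eq0 => /eqP.
have c2 : 0 < nrm (f t - g t) / 2 by rewrite divr_gt0.
have [d1 d10 h1] := fc t tI _ c2; have [d2 d20 h2] := gc t tI _ c2.
pose dl := Num.min d1 d2; have dl0 : 0 < dl by rewrite lt_min d10.
(* A one-sided interval that stays inside [-1, 0]: to the left of [t], or to its right when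
   [t = -1]. There [f] and [g] still differ, against the exceptional set being null. *)
have [a [b [ab abI]]] : exists a b, a < b /\
    forall u, a < u < b -> -1 <= u <= 0 /\ `|t - u| < dl.
  move: tI => /andP[t1 t0]; have [tN|tN] := ltP (-1) t.
    exists (Num.max (-1) (t - dl)), t; split; first by rewrite gt_max tN gtrBl.
    move=> u /andP[]; rewrite gt_max => /andP[u1 u2] ut; split.
      by rewrite ltW//= (le_trans (ltW ut)).
    by rewrite ger0_norm ?subr_ge0 ?ltW// ltrBlDl -ltrBlDr.
  exists t, (Num.min 0 (t + dl)); split.
    by rewrite lt_min ltrDl dl0 andbT (le_lt_trans tN)// ltrN10.
  move=> u /andP[tu]; rewrite lt_min => /andP[u0 ud]; split.
    by rewrite (ltW u0) andbT (le_trans t1)// ltW.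
  by rewrite distrC ger0_norm ?subr_ge0 ?ltW// ltrBlDl.
have sub : `]a, b[ `<=` N `&` `[-1, 0].
  move=> u; rewrite /= in_itv /= => /abI[uI ud]; split; last by rewrite /= in_itv.
  apply: fgN => /= fgu.
  have := h1 u uI; have := h2 u uI; move: ud; rewrite lt_min => /andP[ud1 ud2].
  move=> /(_ ud2) k2 /(_ ud1) k1.
  have : nrm (f t - g t) < nrm (f t - g t).
    rewrite {2}(splitr (nrm (f t - g t))).
    rewrite (le_lt_trans (nrmB_le _ (f u) _))// ltrD// fgu nrm_distC.
    exact: k2.
  by rewrite ltxx.
have : (lebesgue_measure (`]a, b[ : set T) <= 0)%E.
  rewrite -N0 mu10E le_measure ?inE//.
  exact: measurableI.
by rewrite lebesgue_measure_itv /= lte_fin ab -EFinD lee_fin subr_le0 leNgt ab.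
Qed.

Variable X : completeNormedModType R[i].

(** For [s] in [-1, 0] this is the integral of [w] from [s] to 0. The indicator of a ray makes it a
    function on the whole line: constant to the left of -1 and zero to the right of 0. *)
Definition tail_integral (w : R -> X) (s : R) : X :=
  bochner_integral mu (fun t : T => (\1_(`[s, +oo[ : set T) t)%:C *: w t).

Lemma L1_indic (A : set T) (w : T -> X) : measurable A -> L1 mu w ->
  L1 mu (fun t => (\1_A t)%:C *: w t).
Proof.
move=> mA; apply: (@L1M _ _ _ _ _ (fun t => (\1_A t)%:C) _ 1).
  exact: strongly_measurable_indic.
apply: nearW => t; rewrite nrm_real indicE.
by case: (_ \in _); rewrite ?normr1 ?normr0.
Qed.

(** The tails at two nearby points differ at most by the integral of [nrm (w t)] over a small
    interval around [s], and this tends to 0 by dominated convergence because a point is null. *)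
Lemma tail_integral_continuous (w : T -> X) : L1 mu w -> continuous (tail_integral w).
Proof.
move=> w1; suff cs (s : R) : tail_integral w x @[x --> s] --> tail_integral w s.
  by move=> s; exact: cs.
apply/cvg_nrmP => e e0.
have near_le (u k : R) : s - k <= u -> u <= s + k -> `|u - s| <= k.
  by move=> h1 h2; rewrite ler_norml; apply/andP; split; lra.
have same_side (u k s' : R) : (u < s - k) || (s + k < u) -> - k < s - s' ->
    s - s' < k -> (s <= u) = (s' <= u).
  by move=> /orP[] h1 h2 h3; apply/idP/idP => h4; lra.
pose A n := (`[s - n.+1%:R^-1, s + n.+1%:R^-1]%classic : set T).
have mA n : measurable (A n) by exact: measurable_itv.
have fA n := L1_indic (mA n) w1.
have nA n t : nrm ((\1_(A n) t)%:C *: w t) <= nrm (w t).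
  rewrite nrmZ nrm_real indicE; case: (_ \in _); rewrite ?normr1 ?mul1r//.
  by rewrite normr0 mul0r nrm_ge0.
have H := @L1norm_dominated_cvg _ _ _ mu X
  (fun n t => (\1_(A n) t)%:C *: w t) (fun=> 0) (fun t => nrm (w t)).
have {}H : L1norm mu (fun t => 0 - (\1_(A n) t)%:C *: w t) @[n --> \oo] --> 0%E.
  apply: H => //.
  - by move=> n; have [] := fA n.
  - exact: strongly_measurable_cst.
  - exact: L1_integrable.
  - apply: filterS (mu10_ae_neq s) => t ts; apply/cvg_nrmP => e' e'0.
    have d0 : 0 < `|t - s| by rewrite normr_gt0 subr_eq0; apply/eqP.
    exists (Num.truncn `|t - s|^-1) => // n /= Nn.
    rewrite sub0r nrmN indicE memNset ?scale0r ?nrm0// /A /= in_itv /= => /andP[h1 h2].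
    have : `|t - s| <= n.+1%:R^-1 by exact: near_le h1 h2.
    apply/negP; rewrite -ltNge invf_plt ?posrE//.
    by rewrite (lt_le_trans (truncnS_gt _))// ler_nat ltnS.
  - by move=> n t; rewrite sub0r nrmN.
have [N _ /(_ N (leqnn N)) hN] := (ecvg0P (fun n => L1norm_ge0 _ _)).1 H _ e0.
have N0 : 0 < N.+1%:R^-1 :> R by rewrite invr_gt0.
exists N.+1%:R^-1 => // s' /= ss'.
have ms (a : R) : measurable (`[a, +oo[ : set T) by [].
rewrite /tail_integral -bochner_integralB; [|exact: mu10_fin|exact: L1_indic..].
have L := L1B (L1_indic (ms s) w1) (L1_indic (ms s') w1).
rewrite -lte_fin; apply: le_lt_trans (bochner_integral_le mu10_fin L) _.
apply: le_lt_trans hN; apply: L1norm_le; first by have [] := L.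
  apply: strongly_measurableB; first exact: strongly_measurable_cst.
  by have [] := fA N.
move=> t; rewrite sub0r nrmN -scalerBl -rmorphB !nrmZ !nrm_real ler_wpM2r ?nrm_ge0//.
rewrite !indicE /=; case: (boolP (t \in A N)) => tA.
  by case: (_ \in _); case: (_ \in _); rewrite ?subrr ?subr0 ?sub0r ?normrN ?normr0 ?normr1.
move: ss'; rewrite ltr_norml => /andP[ss1 ss2].
have -> : (t \in (`[s, +oo[%classic : set T)) = (t \in (`[s', +oo[%classic : set T)).
  move: tA; rewrite notin_setE /A /= in_itv /= => /negP; rewrite negb_and -!ltNge => tA.
  have E := same_side _ _ _ tA ss1 ss2.
  by apply/idP/idP; rewrite !inE /= !in_itv /= !andbT E.
by rewrite subrr normr0.
Qed.

Lemma tail_integral0 (w : T -> X) : L1 mu w -> tail_integral w 0 = 0.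
Proof.
move=> w1; rewrite /tail_integral -(bochner_integral0 mu10_fin X).
apply: bochner_integral_ae_eq; [exact: mu10_fin|by apply: L1_indic|by apply: L10; exact: mu10_fin|].
apply: filterS2 mu10_ae (mu10_ae_neq 0) => t /andP[_ t0] tn0.
rewrite indicE memNset ?scale0r//= in_itv /= andbT => ht; apply: tn0.
by apply/eqP; rewrite eq_le t0.
Qed.

End unit_interval.

(** * Fubini on the square of [-1, 0] *)

Section tail_integral_by_parts.
Context {R : realType}.
Local Notation T := (measurableTypeR R).
Local Notation mu := (@mu10 R).

Lemma mu10_Fubini (f : T * T -> R) (C : R) : measurable_fun setT f ->
  (forall z, `|f z| <= C) ->
  (\int[mu]_s \int[mu]_t (f (s, t))%:E = \int[mu]_t \int[mu]_s (f (s, t))%:E)%E.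
Proof.
move=> mf fC.
pose I := (`[(-1 : R), 0]%classic : set T).
have mI : measurable I by exact: measurable_itv.
have finI : (@lebesgue_measure R I < +oo)%E.
  by have := @mu10_fin R; rewrite mu10E setTI.
(* The same measure, now with its finiteness as part of the structure, as the product measure
   demands. *)
pose m : {finite_measure set T -> \bar R} := mfrestr mI finI.
have mfE : measurable_fun setT (EFin \o f) by exact/measurable_EFinP.
have intf : (m \x m)%E.-integrable setT (EFin \o f).
  apply/(integrable12ltyP _ _ mfE).
  apply: (@le_lt_trans _ _ (\int[m]_s \int[m]_t (`|C|)%:E)%E).
    apply: ge0_le_integral => //.
    - by move=> s _; apply: integral_ge0.
    - apply: (@measurable_fun_fubini_tonelli_F _ _ _ _ _ m (abse \o (EFin \o f))).
        by apply: measurableT_comp.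
      by move=> z; exact: abse_ge0.
    - move=> s _; apply: ge0_le_integral => //.
      + by apply: measurableT_comp => //; exact: (measurable_fun_pair2 _ mfE).
      + by move=> t _ /=; rewrite lee_fin (le_trans (fC _))// ler_norm.
  have mT : (m setT < +oo)%E by exact: (@mu10_fin R).
  have mfin : m setT \is a fin_num by rewrite ge0_fin_numE.
  have cstE (c : R) : (\int[m]_t c%:E = (c * fine (m setT))%:E)%E.
    by rewrite integral_cst//= -[in LHS](fineK mfin).
  by under eq_integral do rewrite cstE; rewrite cstE ltry.
exact: (Fubini intf).
Qed.

End tail_integral_by_parts.

(** * Test functions and scalar integration by parts *)

Section test_functions.
Context {R : realType}.
Local Notation T := (measurableTypeR R).
Local Notation mu := (@mu10 R).

Lemma derivable_continuous1 (f : R -> R) : (forall t, derivable f t 1) -> continuous f.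
Proof. by move=> df t; exact/differentiable_continuous/derivable1_diffP. Qed.

Lemma test_function_out (psi : R -> R) : test_function psi ->
  forall t, (t <= -1) || (0 <= t) -> psi t = 0 /\ derive1 psi t = 0.
Proof.
move=> [dpsi cpsi [a [b [a1 b0 psi0]]]] t tI.
have n0 : \forall u \near t, psi u = 0.
  case/orP: tI => tI.
    have : \forall u \near t, u < a by apply: lt_nbhsl; exact: le_lt_trans tI _.
    by apply: filterS => u ua; apply: psi0 => /andP[]; rewrite leNgt ua.
  have : \forall u \near t, b < u by apply: lt_nbhsr; exact: lt_le_trans tI.
  by apply: filterS => u ub; apply: psi0 => /andP[_]; rewrite leNgt ub.
split; first exact: nbhs_singleton n0.
rewrite derive1E (@near_eq_derive _ _ _ psi (cst 0)) ?derive_cst ?oner_neq0//.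
Qed.

Lemma test_function_bounded (psi : R -> R) : test_function psi ->
  exists2 C : R, 0 <= C & forall t, `|psi t| <= C /\ `|derive1 psi t| <= C.
Proof.
move=> tpsi; have [dpsi cpsi _] := tpsi.
have bnd (f : R -> R) : continuous f -> (forall t, (t <= -1) || (0 <= t) -> f t = 0) ->
    exists2 C : R, 0 <= C & forall t, `|f t| <= C.
  move=> fc f0.
  have nfc : {within `[-1, 0], continuous (fun t => `|f t|)}.
    apply: continuous_subspaceT => t; apply: continuous_comp; first exact: fc.
    exact: norm_continuous.
  have [c _ hc] := EVT_max (lerN10 R) nfc.
  exists `|f c| => // t; have [tI|] := boolP ((t <= -1) || (0 <= t)).
    by rewrite f0// normr0.
  rewrite negb_or -!ltNge => /andP[t1 t0]; apply: hc.
  by rewrite in_itv /= !ltW.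
have [C1 C10 h1] := bnd psi (derivable_continuous1 dpsi) (fun t h => (test_function_out tpsi h).1).
have [C2 C20 h2] := bnd _ cpsi (fun t h => (test_function_out tpsi h).2).
exists (C1 + C2); first exact: addr_ge0.
by move=> t; split; [rewrite (le_trans (h1 t))// lerDl|rewrite (le_trans (h2 t))// lerDr].
Qed.

Lemma test_function_FTC (psi : R -> R) (t : R) : test_function psi -> -1 <= t ->
  (\int[lebesgue_measure]_(s in `[(-1)%R, t]) (derive1 psi s)%:E = (psi t)%:E)%E.
Proof.
move=> tpsi; have [dpsi cpsi _] := tpsi.
have p1 : psi (-1) = 0 by have [] := test_function_out tpsi (t := -1); rewrite ?lexx.
rewrite le_eqVlt => /predU1P[<-|t1]; first by rewrite set_itv1 integral_set1 p1.
have pc := derivable_continuous1 dpsi.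
have dc : {within `[-1, t], continuous (derive1 psi)} by exact: continuous_subspaceT.
have dp : derivable_oo_LRcontinuous psi (-1) t.
  by split => //; [exact: cvg_at_right_filter (pc _)|exact: cvg_at_left_filter (pc _)].
have pp : {in `]-1, t[, derive1 psi =1 derive1 psi} by [].
by have := continuous_FTC2 t1 dc dp pp; rewrite p1 sube0.
Qed.

Lemma measurable_cont (f : R -> R) : continuous f -> measurable_fun setT (f : T -> R).
Proof. exact: continuous_measurable_fun. Qed.

Lemma mem_tail (s t : R) : (t \in (`[s, +oo[%classic : set T)) = (s <= t).
Proof. by apply/idP/idP; rewrite inE /= in_itv /= andbT. Qed.

Lemma mem_segment (a b s : R) : (s \in (`[a, b]%classic : set T)) = (a <= s <= b).
Proof. by apply/idP/idP; rewrite inE /= in_itv. Qed.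

(** Exchanging the integrals over the triangle [-1 <= s <= t <= 0] leaves the integral of
    [derive1 psi] from -1 to [t] as inner integral, which is [psi t]. *)
Lemma tail_indic_by_parts (psi : R -> R) (E : set T) : test_function psi -> measurable E ->
  (\int[mu]_s (derive1 psi s *
     fine (\int[mu]_t (\1_(`[s, +oo[%classic : set T) t * \1_E t)%:E))%:E =
   \int[mu]_t (psi t * \1_E t)%:E)%E.
Proof.
move=> tpsi mE; have [dpsi cpsi _] := tpsi.
have [C C0 hC] := test_function_bounded tpsi.
pose f (z : T * T) : R := if z.1 <= z.2 then derive1 psi z.1 * \1_E z.2 else 0.
have ind1 (A : set T) t : `|\1_A t : R| <= 1.
  by rewrite indicE; case: (_ \in _); rewrite ?normr0 ?normr1.
have mf : measurable_fun setT f.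
  apply: measurable_fun_ifT => //.
    by apply: measurable_fun_ler; [exact: measurable_fst|exact: measurable_snd].
  apply: measurable_funM.
    by apply: (measurableT_comp (measurable_cont cpsi)); exact: measurable_fst.
  by apply: (measurableT_comp (measurable_indic mE)); exact: measurable_snd.
have fC z : `|f z| <= C.
  rewrite /f; case: ifP; rewrite ?normr0// normrM => _.
  by rewrite -[leRHS]mulr1 ler_pM// (hC _).2.
have fE1 s t : f (s, t) = derive1 psi s * (\1_(`[s, +oo[%classic : set T) t * \1_E t).
  rewrite /f /= (indicE _ (`[s, +oo[%classic : set T)) mem_tail.
  by case: ifP; rewrite ?mul1r ?mul0r ?mulr0.
transitivity (\int[mu]_s \int[mu]_t (f (s, t))%:E)%E.
  apply: eq_integral => s _; under [RHS]eq_integral do rewrite fE1 EFinM.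
  have ik : mu.-integrable setT (EFin \o (fun t : T =>
      \1_(`[s, +oo[%classic : set T) t * \1_E t : R)).
    apply: (@bounded_integrable _ _ _ _ mu10_fin _ 1).
      by apply: measurable_funM => //; exact: measurable_indic.
    by move=> t; rewrite normrM mulr_ile1.
  rewrite (integralZl measurableT ik) EFinM fineK//.
  exact: (integrable_fin_num measurableT ik).
rewrite (mu10_Fubini mf fC); apply: eq_integral => t _.
rewrite integral_mu10; last first.
  by apply/measurable_EFinP; exact: (measurable_fun_pair1 _ mf).
have out0 (u : R) : (u <= -1) || (0 <= u) -> psi u = 0.
  by move=> /(test_function_out tpsi)[].
(* The variable [t] ranges over the whole line while [s] is confined to [-1, 0], so the inner
   integral stops at [tau]; since [psi] vanishes on the right of 0, its values at [tau] and [t]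
   agree. *)
pose tau : R := Num.min (t : R) 0.
have psitau : psi tau = psi t.
  rewrite /tau; case: leP => // t0.
  by rewrite !out0 ?lexx ?orbT// (ltW t0) orbT.
have [t1|t1] := ltP t (-1).
  rewrite out0 ?(ltW t1)// mul0r.
  rewrite -[RHS](integral0 lebesgue_measure `[(-1)%R, 0%R]); apply: eq_integral => s.
  rewrite inE /= in_itv /= => /andP[s1 _].
  by rewrite /f /= leNgt (lt_le_trans t1 s1).
have tau1 : -1 <= tau by rewrite le_min t1 lerN10.
transitivity (\int[lebesgue_measure]_(s in `[(-1)%R, tau]) ((\1_E t)%:E * (derive1 psi s)%:E))%E.
  rewrite [LHS]integral_mkcond [RHS]integral_mkcond; apply: eq_integral => s _.
  rewrite !patchE !mem_segment /tau le_min /f /=.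
  case: (-1 <= s) => //=; case: (s <= 0); rewrite ?andbF ?andbT//=.
  by case: (s <= t) => //=; rewrite EFinM muleC.
rewrite integralZl//; last first.
  apply: continuous_compact_integrable; first exact: segment_compact.
  exact: continuous_subspaceT.
by rewrite test_function_FTC// psitau mulrC EFinM.
Qed.

End test_functions.

(** * Integration by parts against a tail integral *)

Section weak_primitive.
Context {R : realType}.
Variable X : completeNormedModType R[i].
Local Notation T := (measurableTypeR R).
Local Notation mu := (@mu10 R).
Implicit Types (w v : T -> X).

Lemma L1_contM (k : R -> R[i]^o) w (C : R) : continuous k ->
  (forall t : R, -1 <= t <= 0 -> nrm (k t) <= C) -> L1 mu w ->
  L1 mu (fun t : T => k t *: w t).
Proof.
move=> kc kC w1; apply: (@L1M _ T R mu X (k : T -> R[i]^o) w C) w1.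
  exact: continuous_strongly_measurable.
by apply: filterS mu10_ae => t; exact: kC.
Qed.

Lemma continuous_realC (k : R -> R) : continuous k -> continuous (fun t => (k t)%:C : R[i]^o).
Proof. by move=> kc; apply: continuous_complex => // t; exact: cvg_cst. Qed.

Lemma L1_realM (k : R -> R) w (C : R) : continuous k ->
  (forall t : R, `|k t| <= C) -> L1 mu w -> L1 mu (fun t : T => (k t)%:C *: w t).
Proof.
move=> kc kC; apply: (@L1_contM (fun t => (k t)%:C) _ C); first exact: continuous_realC.
by move=> t _; rewrite nrm_real.
Qed.

Lemma L1norm_fineK w : L1 mu w -> (fine (L1norm mu w))%:E = L1norm mu w.
Proof. by move=> [_ wf]; rewrite fineK// ge0_fin_numE// L1norm_ge0. Qed.

Lemma tail_integral_le w (s : R) : L1 mu w -> nrm (tail_integral w s) <= fine (L1norm mu w).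
Proof.
move=> w1; have mtail : measurable (`[s, +oo[%classic : set T) by exact: measurable_itv.
apply: bochner_integral_ae_le; [exact: mu10_fin|exact: L1_indic|].
rewrite L1norm_fineK//; apply: L1norm_le; [by have [] := L1_indic mtail w1|by case: w1|].
move=> t; rewrite nrmZ nrm_real indicE; case: (_ \in _); rewrite ?normr1 ?mul1r//.
by rewrite normr0 mul0r nrm_ge0.
Qed.

Lemma tail_integral_linear (a : R[i]) w v (s : R) : L1 mu w -> L1 mu v ->
  tail_integral (fun t => a *: w t + v t) s = a *: tail_integral w s + tail_integral v s.
Proof.
move=> w1 v1; have mtail : measurable (`[s, +oo[%classic : set T) by exact: measurable_itv.
rewrite /tail_integral -bochner_integral_linear; [|exact: mu10_fin|exact: L1_indic..].
by congr bochner_integral; apply/funext => t; rewrite scalerDr !scalerA mulrC.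
Qed.

Lemma continuous_L1 (V : completeNormedModType R[i]) (f : R -> V) :
  continuous f -> L1 mu (f : T -> V).
Proof.
move=> fc; have fc' : {within `[-1, 0], continuous f} by exact: continuous_subspaceT.
have [c _ hc] := itv_bounded_nrm (lerN10 R) fc'.
apply: (@L1_ae_bounded _ _ _ mu mu10_fin _ _ c); first exact: continuous_strongly_measurable.
by apply: filterS mu10_ae => t; exact: hc.
Qed.

Lemma tail_integral_L1 w : L1 mu w -> L1 mu (tail_integral w : T -> X).
Proof. by move=> w1; apply: continuous_L1; exact: tail_integral_continuous. Qed.

Section defect.
Variables (psi : R -> R) (tpsi : test_function psi).

Let dpsi : continuous (derive1 psi). Proof. by case: tpsi. Qed.
Let cpsi : continuous psi.
Proof. by apply: derivable_continuous1; case: tpsi. Qed.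

Lemma L1_testM w : L1 mu w -> L1 mu (fun t : T => (psi t)%:C *: w t).
Proof.
have [C _ hC] := test_function_bounded tpsi.
by apply: (@L1_realM _ _ C) => // t; case: (hC t).
Qed.

Lemma L1_test1M w : L1 mu w -> L1 mu (fun t : T => (derive1 psi t)%:C *: w t).
Proof.
have [C _ hC] := test_function_bounded tpsi.
by apply: (@L1_realM _ _ C) => // t; case: (hC t).
Qed.

(* The defect is linear and continuous for the L1 norm, so that its vanishing
   reduces to indicators, where it is an instance of Fubini's theorem. *)
Definition by_parts_defect w : X :=
  bochner_integral mu (fun t : T => (derive1 psi t)%:C *: tail_integral w t) -
  bochner_integral mu (fun t : T => (psi t)%:C *: w t).

Lemma by_parts_defect_linear (a : R[i]) w v : L1 mu w -> L1 mu v ->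
  by_parts_defect (fun t => a *: w t + v t) = a *: by_parts_defect w + by_parts_defect v.
Proof.
move=> w1 v1; have [tw tv] := (tail_integral_L1 w1, tail_integral_L1 v1).
have E1 := bochner_integral_linear mu10_fin a (L1_test1M tw) (L1_test1M tv).
have E2 := bochner_integral_linear mu10_fin a (L1_testM w1) (L1_testM v1).
have EP : bochner_integral mu (fun t : T => (derive1 psi t)%:C *:
      tail_integral (fun t => a *: w t + v t) t) =
    a *: bochner_integral mu (fun t : T => (derive1 psi t)%:C *: tail_integral w t)
    + bochner_integral mu (fun t : T => (derive1 psi t)%:C *: tail_integral v t).
  apply: etrans E1; congr bochner_integral; apply/funext => t.
  by rewrite tail_integral_linear// scalerDr !scalerA mulrC.
have EQ : bochner_integral mu (fun t : T => (psi t)%:C *: (a *: w t + v t)) =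
    a *: bochner_integral mu (fun t : T => (psi t)%:C *: w t)
    + bochner_integral mu (fun t : T => (psi t)%:C *: v t).
  apply: etrans E2; congr bochner_integral; apply/funext => t.
  by rewrite scalerDr !scalerA mulrC.
apply: (etrans (congr2 (fun P Q => P - Q) EP EQ)).
by rewrite opprD addrACA scalerBr.
Qed.

Lemma by_parts_defect_le : exists2 C : R, 0 <= C &
  forall w, L1 mu w -> nrm (by_parts_defect w) <= C * fine (L1norm mu w).
Proof.
have [C C0 hC] := test_function_bounded tpsi.
exists (C + C); first exact: addr_ge0.
move=> w w1; have tw := tail_integral_L1 w1; have L0 := L1norm_ge0 mu w.
rewrite mulrDl (le_trans (nrmD _ _))// nrmN lerD//.
  apply: bochner_integral_ae_le; [exact: mu10_fin|exact: L1_test1M|].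
  have [mtw _] := L1_test1M tw.
  set c := C * _; have cE : (\int[mu]_t c%:E = c%:E)%E.
    by rewrite integral_cst//= [X in (_ * X)%E]mu10_setT mule1.
  rewrite -cE; apply: L1norm_ae_le => //.
    by move=> t; rewrite mulr_ge0// fine_ge0.
  apply: nearW => t; rewrite nrmZ nrm_real ler_pM ?nrm_ge0 ?(hC t).2//.
  exact: tail_integral_le.
apply: bochner_integral_ae_le; [exact: mu10_fin|exact: L1_testM|].
rewrite EFinM L1norm_fineK//; apply: L1norm_aeM_le => //.
- by have [] := L1_testM w1.
- by case: w1.
- apply: nearW => t; rewrite nrmZ nrm_real ler_wpM2r ?nrm_ge0//.
  by have [] := hC t.
Qed.

Lemma L1_indic_cst (E : set T) (x : X) : measurable E ->
  L1 mu (fun t => (\1_E t)%:C *: x).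
Proof.
move=> mE; apply: L1_indic => //; apply: continuous_L1 => t; exact: cvg_cst.
Qed.

Lemma by_parts_defect_indic (E : set T) (x : X) : measurable E ->
  by_parts_defect (fun t => (\1_E t)%:C *: x) = 0.
Proof.
move=> mE; have [C C0 hC] := test_function_bounded tpsi.
have ind1 (A : set T) t : `|\1_A t : R| <= 1.
  by rewrite indicE; case: (_ \in _); rewrite ?normr0 ?normr1.
pose m (s : R) := fine (\int[mu]_t (\1_(`[s, +oo[%classic : set T) t * \1_E t)%:E)%E.
have tE s : tail_integral (fun t => (\1_E t)%:C *: x) s = (m s)%:C *: x.
  have mtail : measurable (`[s, +oo[%classic : set T) by exact: measurable_itv.
  have ik : mu.-integrable setT (EFin \o (fun t : T =>
      \1_(`[s, +oo[%classic : set T) t * \1_E t : R)).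
    apply: (@bounded_integrable _ _ _ _ mu10_fin _ 1).
      by apply: measurable_funM => //; exact: measurable_indic.
    by move=> t; rewrite normrM mulr_ile1.
  rewrite -(bochner_integralE mu10_fin (bochner_integral_real mu10_fin x ik)).
  by congr bochner_integral; apply/funext => t; rewrite scalerA rmorphM.
have ik2 : mu.-integrable setT (EFin \o (fun t : T => psi t * \1_E t : R)).
  apply: (@bounded_integrable _ _ _ _ mu10_fin _ C).
    by apply: measurable_funM; [exact: measurable_cont|exact: measurable_indic].
  by move=> t; rewrite normrM -[leRHS]mulr1 ler_pM// (hC t).1.
(* For nonzero [x], the function [m] is the norm of a continuous tail integral divided by [nrm x],
   and this is how its measurability is obtained; the case [x = 0] is therefore treated apart. *)
have [x0|x0] := eqVneq x 0.
  have h1 : (fun t => (\1_E t)%:C *: x) = (fun t : T => (0 : R[i]) *: (0 : X) + 0).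
    by apply/funext => t; rewrite x0 !scaler0 addr0.
  have L0 := L10 mu10_fin X.
  have h2 : by_parts_defect (fun=> 0) = 0.
    apply: (etrans _ (etrans (by_parts_defect_linear (-1) L0 L0) _)).
      by congr by_parts_defect; apply/funext => t; rewrite scaler0 addr0.
    by rewrite scaleN1r addNr.
  by rewrite h1 -[RHS]h2; congr by_parts_defect; apply/funext => t; rewrite scaler0 addr0.
have ik1 : mu.-integrable setT (EFin \o (fun t : T => derive1 psi t * m t)).
  have x0' : 0 < nrm x.
    by rewrite lt_neqAle nrm_ge0 andbT eq_sym; apply: contra_neq x0; exact: nrm0_eq0.
  have m0 s : 0 <= m s.
    by apply: fine_ge0; apply: integral_ge0 => t _; rewrite lee_fin mulr_ge0.
  have mE' s : m s = nrm (tail_integral (fun t => (\1_E t)%:C *: x) s) / nrm x.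
    by rewrite tE nrmZ nrm_real ger0_norm// mulfK// gt_eqF.
  have mm : measurable_fun setT (m : T -> R).
    have cm : continuous m.
      move=> s; rewrite (funext mE'); apply: cvgM; last exact: cvg_cst.
      apply: continuous_comp; last exact: continuous_nrm.
      exact: tail_integral_continuous (L1_indic_cst x mE) s.
    exact: measurable_cont.
  have m1 s : m s <= 1.
    rewrite -lee_fin fineK.
      rewrite -mu10_setT -[leRHS]mul1e -(integral_cst mu measurableT).
      apply: ge0_le_integral => //.
      + by apply/measurable_EFinP/measurable_funM => //; exact: measurable_indic.
      + by move=> t _; rewrite lee_fin mulr_ile1// -[leLHS]ger0_norm.
    apply: (integrable_fin_num measurableT).
    apply: (@bounded_integrable _ _ _ _ mu10_fin _ 1).
      by apply: measurable_funM => //; exact: measurable_indic.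
    by move=> t; rewrite normrM mulr_ile1.
  apply: (@bounded_integrable _ _ _ _ mu10_fin _ C).
    by apply: measurable_funM => //; exact: measurable_cont.
  by move=> t; rewrite normrM -[leRHS]mulr1 ler_pM ?(hC t).2// ger0_norm.
rewrite /by_parts_defect; apply/eqP; rewrite subr_eq0; apply/eqP.
transitivity ((fine (\int[mu]_t (derive1 psi t * m t)%:E)%E)%:C *: x).
  rewrite -(bochner_integralE mu10_fin (bochner_integral_real mu10_fin x ik1)).
  by congr bochner_integral; apply/funext => t; rewrite tE scalerA rmorphM.
rewrite tail_indic_by_parts//.
rewrite -(bochner_integralE mu10_fin (bochner_integral_real mu10_fin x ik2)).
by congr bochner_integral; apply/funext => t; rewrite scalerA rmorphM.
Qed.

End defect.
End weak_primitive.

(** * Functions whose integrals over all measurable sets vanish *)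

Section null_functions.
Context d (T : measurableType d) {R : realType}.
Variables (mu : {measure set T -> \bar R}) (mu_fin : (mu setT < +oo)%E).
Variable X : completeNormedModType R[i].

Lemma simple_fun_sumE (s : T -> X) t : simple_fun s ->
  s t = \sum_(y <- fset_set (range s)) (\1_(s @^-1` [set y]) t : R)%:C *: y.
Proof.
move=> ss; rewrite (bigD1_seq (s t)) ?fset_uniq//=; last first.
  by rewrite in_fset_set ?inE; [exists t|exact: ss.1].
rewrite indicE mem_set// scale1r big1 ?addr0// => y yst.
rewrite indicE memNset ?scale0r//= => sty; by rewrite sty eqxx in yst.
Qed.

Lemma L1norm_fibers (s f : T -> X) : simple_fun s -> strongly_measurable f ->
  (\sum_(y <- fset_set (range s)) L1norm mu (fun t => (\1_(s @^-1` [set y]) t : R)%:C *: f t)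
   = L1norm mu f)%E.
Proof.
move=> ss mf; rewrite /L1norm -ge0_integral_sum//; last 2 first.
- move=> y; apply: measurable_nrmE; apply: strongly_measurableM => //.
  exact: strongly_measurable_indic (ss.2 y).
- by move=> y t _; rewrite lee_fin nrm_ge0.
apply: eq_integral => t _; rewrite sumEFin; congr (_%:E).
rewrite (bigD1_seq (s t)) ?fset_uniq//=; last first.
  by rewrite in_fset_set ?inE; [exists t|exact: ss.1].
rewrite indicE mem_set// scale1r big1 ?addr0// => y yst.
rewrite indicE memNset ?scale0r ?nrm0//= => sty; by rewrite sty eqxx in yst.
Qed.

Lemma L1_indicM (A : set T) (w : T -> X) : measurable A -> L1 mu w ->
  L1 mu (fun t => (\1_A t : R)%:C *: w t).
Proof.
move=> mA; apply: (@L1M _ _ _ _ _ (fun t => (\1_A t)%:C) _ 1).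
  exact: strongly_measurable_indic.
apply: nearW => t; rewrite nrm_real indicE.
by case: (_ \in _); rewrite ?normr1 ?normr0.
Qed.

Lemma L1_simple (s : T -> X) : simple_fun s -> L1 mu s.
Proof.
by move=> ss; split; [exact: simple_strongly_measurable|exact: L1norm_simple_fin].
Qed.

(* A simple s close to v has [|int_E s| = mu E * |value|] on each fiber E, and
   [int_E s = int_E (s - v)], so that the L1 norm of s is at most that of s - v. *)
Lemma L1_eq0_sets (v : T -> X) : L1 mu v ->
  (forall E, measurable E -> bochner_integral mu (fun t => (\1_E t : R)%:C *: v t) = 0) ->
  {ae mu, forall t, v t = 0}.
Proof.
move=> v1 v0; have [mv vfin] := v1.
have v00 : L1norm mu v = 0%E.
  apply/eqP; rewrite eq_le L1norm_ge0 andbT; apply/lee_addgt0Pr => e e0.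
  rewrite add0e; have e2 : 0 < e / 2 by rewrite divr_gt0.
  have [s [ss sv]] := L1_simple_approx v1.
  have [N _ /(_ N (leqnn N)) hN] := (ecvg0P (fun n => L1norm_ge0 mu _)).1 sv _ e2.
  have sN1 := L1_simple (ss N); have dN := L1B sN1 v1.
  have LsN : (L1norm mu (s N) <= L1norm mu (fun t => s N t - v t)%R)%E.
    rewrite -(L1norm_fibers (ss N) dN.1) L1norm_simple// -sumEFin.
    apply: lee_sum => y _; have mE := (ss N).2 y.
    apply: (@le_trans _ _ (nrm (bochner_integral mu
        (fun t => (\1_(s N @^-1` [set y]) t : R)%:C *: (s N t - v t))))%:E); last first.
      exact: (bochner_integral_le mu_fin (L1_indicM mE dN)).
    have -> : bochner_integral mu (fun t => (\1_(s N @^-1` [set y]) t : R)%:C *: (s N t - v t))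
        = (fiber_mass mu (s N) y)%:C *: y.
      transitivity (bochner_integral mu (fun t => (\1_(s N @^-1` [set y]) t : R)%:C *: s N t)).
        rewrite -[RHS]subr0 -(v0 _ mE).
        rewrite -(bochner_integralB mu_fin (L1_indicM mE sN1) (L1_indicM mE v1)).
        by congr bochner_integral; apply/funext => t; rewrite scalerBr.
      have ik : mu.-integrable setT (EFin \o (\1_(s N @^-1` [set y]) : T -> R)).
        by apply: (@bounded_integrable _ _ _ _ mu_fin _ 1) => // t;
          rewrite indicE; case: (_ \in _); rewrite ?normr0 ?normr1.
      transitivity (bochner_integral mu (fun t => (\1_(s N @^-1` [set y]) t : R)%:C *: y)).
        congr bochner_integral; apply/funext => t; rewrite indicE.
        case: (boolP (t \in _)) => [|_]; last by rewrite !scale0r.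
        by rewrite inE /= => ->.
      rewrite (bochner_integralE mu_fin (bochner_integral_real mu_fin y ik)).
      by rewrite /= integral_indic// setIT.
    by rewrite nrmZ nrm_real ger0_norm// fine_ge0.
  have := @L1normD _ _ _ mu _ (fun t => v t - s N t) (s N)
    (strongly_measurableB mv sN1.1) sN1.1.
  have -> : (fun t => v t - s N t + s N t) = v by apply/funext => t; rewrite subrK.
  move=> /le_trans; apply; rewrite (splitr e) EFinD leeD//; first exact: ltW.
  by rewrite (le_trans LsN)// L1norm_distC ltW.
have /(ae_eq_integral_abs mu measurableT) : measurable_fun setT (fun t => (nrm (v t))%:E).
  exact: measurable_nrmE.
move=> [+ _]; have -> : (\int[mu]_t `|(nrm (v t))%:E| = L1norm mu v)%E.
  by apply: eq_integral => t _; rewrite abse_EFin ger0_norm// nrm_ge0.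
move=> /(_ v00); apply: filterS => t /(_ I) [] /nrm0_eq0.
by [].
Qed.

End null_functions.

(** * Integration by parts in general, and functions with zero primitive *)

Section du_bois_reymond.
Context {R : realType}.
Variable X : completeNormedModType R[i].
Local Notation T := (measurableTypeR R).
Local Notation mu := (@mu10 R).
Implicit Types (f g w v : T -> X).

Lemma by_parts_defect_eq0 (psi : R -> R) w : test_function psi -> L1 mu w ->
  by_parts_defect psi w = 0.
Proof.
move=> tpsi w1; have [C C0 hC] := by_parts_defect_le X tpsi.
have simple0 (s : T -> X) : simple_fun s -> by_parts_defect psi s = 0.
  move=> ss.
  suff H (r : seq X) : L1 mu (fun t => \sum_(y <- r) (\1_(s @^-1` [set y]) t : R)%:C *: y)
      /\ by_parts_defect psi (fun t => \sum_(y <- r) (\1_(s @^-1` [set y]) t : R)%:C *: y) = 0.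
    rewrite -[RHS](H (fset_set (range s))).2; congr by_parts_defect.
    by apply/funext => t; exact: simple_fun_sumE.
  elim: r => [|y r [IH1 IH2]].
    have E0 : (fun t => \sum_(y <- [::]) (\1_(s @^-1` [set y]) t : R)%:C *: y) =
        (fun=> 0 : X) by apply/funext => t; rewrite big_nil.
    rewrite E0; have L0 := L10 mu10_fin X; split => //.
    apply: (etrans _ (etrans (by_parts_defect_linear tpsi (-1) L0 L0) _)).
      by congr by_parts_defect; apply/funext => t; rewrite scaler0 addr0.
    by rewrite scaleN1r addNr.
  have mE : measurable (s @^-1` [set y]) by exact: ss.2.
  have Ly := L1_indic_cst y mE.
  have EC : (fun t => \sum_(z <- y :: r) (\1_(s @^-1` [set z]) t : R)%:C *: z) =
      (fun t => 1 *: ((\1_(s @^-1` [set y]) t : R)%:C *: y) +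
        \sum_(z <- r) (\1_(s @^-1` [set z]) t : R)%:C *: z).
    by apply/funext => t; rewrite big_cons scale1r.
  rewrite EC; split; first exact: L1_linear.
  apply: etrans (by_parts_defect_linear tpsi 1 Ly IH1) _.
  by rewrite by_parts_defect_indic// IH2 scaler0 addr0.
apply/nrm_le0/ler_addgt0Pr => e e0; rewrite add0r.
have e1 : 0 < e / (C + 1) by rewrite divr_gt0// ltr_wpDl.
have [s [ss sw]] := L1_simple_approx w1.
have [N _ /(_ N (leqnn N)) hN] := (ecvg0P (fun n => L1norm_ge0 mu _)).1 sw _ e1.
have sN1 := L1_simple mu10_fin (ss N); have dN := L1B w1 sN1.
have -> : by_parts_defect psi w = by_parts_defect psi (fun t => w t - s N t).
  have E := by_parts_defect_linear tpsi (-1) sN1 w1.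
  rewrite (simple0 _ (ss N)) scaler0 add0r in E; apply: (etrans (esym E)).
  by congr by_parts_defect; apply/funext => t; rewrite scaleN1r addrC.
rewrite (le_trans (hC _ dN))//.
rewrite -L1norm_fineK// lte_fin ltr_pdivlMr ?ltr_wpDl// in hN.
apply/ltW; apply: le_lt_trans hN; rewrite mulrC ler_wpM2l ?lerDl//.
exact/fine_ge0/L1norm_ge0.
Qed.

(** The measurable sets over which [v] integrates to zero form a lambda-system; it contains the
    rays, which are stable under intersection and generate the Borel sets. *)
Lemma tail_integral_eq0 v : L1 mu v -> (forall s, tail_integral v s = 0) ->
  {ae mu, forall t : T, v t = 0}.
Proof.
move=> v1 tv0; apply: (L1_eq0_sets mu10_fin v1) => E mE.
pose H : set (set T) := [set E | measurable E /\
  bochner_integral mu (fun t => (\1_E t : R)%:C *: v t) = 0].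
suff [] : H E by [].
have vT : bochner_integral mu v = 0.
  rewrite -(tv0 (-1)); apply: bochner_integral_ae_eq => //; first exact: mu10_fin.
    by apply: L1_indicM => //; exact: measurable_itv.
  apply: filterS mu10_ae => t /andP[t1 _].
  by rewrite indicE mem_set ?scale1r//= in_itv /= t1.
have lH : lambda_system setT H.
  split.
  - by [].
  - split; first exact: measurableT.
    rewrite -[RHS]vT; congr bochner_integral; apply/funext => t.
    by rewrite indicE mem_set// scale1r.
  - move=> A B BA [mA A0] [mB B0]; split; first exact: measurableD.
    have := bochner_integralB mu10_fin (L1_indicM mA v1) (L1_indicM mB v1).
    rewrite A0 B0 subr0 => AB; rewrite -[RHS]AB; congr bochner_integral.
    apply/funext => t; rewrite -scalerBl; congr (_ *: _); rewrite -rmorphB; congr (_%:C).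
    rewrite !indicE in_setD; case: (boolP (t \in B)) => tB; last by rewrite andbT subr0.
    by rewrite andbF mem_set ?subrr//; apply: BA; rewrite -inE.
  - move=> F ndF HF; have mF n : measurable (F n) by case: (HF n).
    have mUF : measurable (\bigcup_n F n) by exact: bigcupT_measurable.
    split; first exact: mUF.
    apply/nrm_le0/ler_addgt0Pr => e e0; rewrite add0r.
    have nA (A : set T) t : nrm ((\1_A t : R)%:C *: v t) <= nrm (v t).
      rewrite nrmZ nrm_real indicE; case: (_ \in _); rewrite ?normr1 ?mul1r//.
      by rewrite normr0 mul0r nrm_ge0.
    have HL := @L1norm_dominated_cvg _ _ _ mu X
      (fun n t => (\1_(F n) t : R)%:C *: v t)
      (fun t => (\1_(\bigcup_n F n) t : R)%:C *: v t) (fun t => 2 * nrm (v t)).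
    have {}HL : L1norm mu (fun t => (\1_(\bigcup_n F n) t : R)%:C *: v t -
        (\1_(F n) t : R)%:C *: v t) @[n --> \oo] --> 0%E.
      apply: HL.
      + by move=> n; case: (L1_indicM (mF n) v1).
      + by case: (L1_indicM mUF v1).
      + exact: (integrableZl measurableT 2 (L1_integrable v1)).
      + apply: nearW => t; apply/cvg_nrmP => e' e'0.
        have [[N _ FN]|nU] := pselect ((\bigcup_n F n) t).
          exists N => // n /= Nn; rewrite !indicE !mem_set ?subrr ?nrm0//.
            by have /subsetPset := ndF _ _ Nn; apply.
          by exists N.
        apply: nearW => n; rewrite !indicE !memNset ?subrr ?nrm0//.
        by move=> Fn; apply: nU; exists n.
      + move=> n t; rewrite (le_trans (nrmD _ _))// nrmN mulrDl mul1r lerD//.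
    have [N _ /(_ N (leqnn N)) hN] := (ecvg0P (fun n => L1norm_ge0 mu _)).1 HL _ e0.
    have := bochner_integralB mu10_fin (L1_indicM mUF v1) (L1_indicM (mF N) v1).
    have [_ ->] := HF N; rewrite subr0 => <-.
    have LD := L1B (L1_indicM mUF v1) (L1_indicM (mF N) v1).
    by rewrite -lee_fin (le_trans (bochner_integral_le mu10_fin LD))// ltW.
apply: (lambda_system_subset (G := @RGenCInfty.G R) _ lH).
- move=> A B [x ->] [y ->]; exists (Num.max x y).
  apply/seteqP; split => t /=; rewrite !in_itv /= !andbT ge_max.
    by move=> [-> ->].
  by move=> /andP[].
- move=> A [x ->]; split; first exact: measurable_itv.
  exact: tv0.
- by [].
- have h : (@ocitv R).-sigma.-measurable E by exact: mE.
  by rewrite RGenCInfty.measurableE in h.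
Qed.

End du_bois_reymond.

(** * Products and piecewise quadratic test functions *)

Section test_function_constructions.
Context {R : realType}.

Lemma derive1_val (f : R -> R) (t df : R) : is_derive t 1 f df -> derive1 f t = df.
Proof. by move=> h; rewrite derive1E; exact: derive_val. Qed.

(** The real and imaginary parts of an exponential times a test function are handled by this rule,
    test functions being real. *)
Lemma test_functionM (phi k dk : R -> R) : test_function phi ->
  (forall t : R, is_derive t 1 k (dk t)) -> continuous dk ->
  test_function (fun t => phi t * k t) /\
  forall t, derive1 (fun t => phi t * k t) t = derive1 phi t * k t + phi t * dk t.
Proof.
move=> tphi hk cdk; have [dphi cphi [a [b [a1 b0 phi0]]]] := tphi.
have dE (t : R) : is_derive t 1 (fun t => phi t * k t) (derive1 phi t * k t + phi t * dk t).
  have h1 : is_derive t 1 phi (derive1 phi t).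
    by split; [exact: dphi|rewrite derive1E].
  have h2 := hk t.
  have h3 := is_deriveM h1 h2.
  apply: is_derive_eq h3 _ => //.
  by rewrite /GRing.scale /= addrC mulrC [phi t * _]mulrC; congr (_ + _); rewrite mulrC.
have d1E t := derive1_val (dE t).
split; last exact: d1E.
split; first by move=> t; case: (dE t).
  rewrite (funext d1E).
  have ck : continuous k by apply: derivable_continuous1 => t; case: (hk t).
  move=> t; apply: cvgD; apply: cvgM; [exact: cphi|exact: ck| |exact: cdk].
  exact: derivable_continuous1.
exists a, b; split => // t tab; by rewrite phi0// mul0r.
Qed.

Definition pos_part (x : R) : R := Num.max x 0.
(** A primitive of [pos_part]: continuously differentiable across 0, which is the regularity
    required of test functions. *)
Definition half_sqr (x : R) : R := (pos_part x) ^+ 2 / 2.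

Lemma pos_part_continuous : continuous pos_part.
Proof. by move=> x; apply: continuous_max; [exact: cvg_id|exact: cvg_cst]. Qed.

Lemma is_derive_half_sqr (x : R) : is_derive x 1 half_sqr (pos_part x).
Proof.
rewrite /pos_part; case: (ltgtP x 0) => x0.
- have h : \forall y \near x, cst 0 y = half_sqr y.
    have : \forall y \near x, y < 0 by exact: lt_nbhsl.
    by apply: filterS => y y0; rewrite /half_sqr /pos_part max_r ?ltW// expr0n /= mul0r.
  exact: (near_eq_is_derive h (is_derive_cst _ _ _)).
- have h : \forall y \near x, (fun y => y ^+ 2 / 2) y = half_sqr y.
    have : \forall y \near x, 0 < y by exact: lt_nbhsr.
    by apply: filterS => y y0; rewrite /half_sqr /pos_part max_l// ltW.
  apply: (near_eq_is_derive h).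
  apply: is_derive_eq.
  by rewrite /GRing.scale /=; lra.
- rewrite x0.
  have H : (fun h : R => h^-1 *: (half_sqr (h *: 1 + 0) - half_sqr 0)) @ 0^' --> (0 : R).
    apply/cvgrPdist_lt => e e0; exists e => // h /= he h0.
    rewrite sub0r normrN /half_sqr /pos_part maxxx expr0n /= mul0r subr0 addr0.
    rewrite /GRing.scale /= mulr1; move: he; rewrite sub0r normrN => he.
    case: (leP h 0) => hp; first by rewrite expr0n /= mul0r mulr0 normr0.
    rewrite expr2 -mulrA mulKf ?gt_eqF// ger0_norm ?divr_ge0 ?ltW//.
    by move: he; rewrite gtr0_norm// => he; lra.
  split; first by apply/cvg_ex; exists 0.
  by rewrite /derive; apply/cvg_lim.
Qed.

(** It rises linearly from 0 at 0 to 1 at [h]: a continuous approximation of the indicator of the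
    positive half line that has an explicit primitive. *)
Definition ramp (h x : R) : R := h^-1 * (pos_part x - pos_part (x - h)).
Definition ramp_primitive (h x : R) : R := h^-1 * (half_sqr x - half_sqr (x - h)).

Lemma is_derive_shift (f : R -> R) (df a x : R) : is_derive (x - a) 1 f df ->
  is_derive x 1 (fun x => f (x - a)) df.
Proof.
move=> hf; have h1 : is_derive x 1 (fun x => x - a) (1 - 0).
  by apply: is_deriveB.
have := @is_derive1_comp _ f (fun x => x - a) x _ _ hf h1.
by rewrite subr0 mulr1.
Qed.

Lemma is_derive_ramp_primitive (h x : R) : is_derive x 1 (ramp_primitive h) (ramp h x).
Proof.
have h1 := is_derive_half_sqr x.
have h2 := is_derive_shift (is_derive_half_sqr (x - h)).
exact: (is_deriveZ h^-1 (is_deriveB h1 h2)).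
Qed.

Lemma ramp_continuous (h : R) : continuous (ramp h).
Proof.
move=> x; apply: cvgM; first exact: cvg_cst.
apply: cvgB; first exact: pos_part_continuous.
apply: (@continuous_comp _ _ _ (fun x : R => x - h) pos_part); last exact: pos_part_continuous.
by apply: cvgB; [exact: cvg_id|exact: cvg_cst].
Qed.

Lemma ramp_bound (h x : R) : 0 < h -> 0 <= ramp h x <= 1.
Proof.
move=> h0; have H : 0 <= pos_part x - pos_part (x - h) <= h.
  rewrite /pos_part; case: (leP x 0) => ?; case: (leP (x - h) 0) => ?;
  by apply/andP; split; lra.
move/andP: H => [h1 h2]; rewrite /ramp; apply/andP; split.
  by apply: mulr_ge0 => //; rewrite invr_ge0 ltW.
by rewrite mulrC ler_pdivrMr// mul1r.
Qed.

Lemma ramp_eq1 (h x : R) : 0 < h -> h <= x -> ramp h x = 1.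
Proof.
move=> h0 hx; rewrite /ramp /pos_part !max_l; [|lra|lra].
by rewrite opprB addrC subrK mulVf// gt_eqF.
Qed.

Lemma ramp_eq0 (h x : R) : 0 < h -> x <= 0 -> ramp h x = 0.
Proof.
by move=> h0 hx; rewrite /ramp /pos_part !max_r ?subrr ?mulr0//; lra.
Qed.

Lemma ramp_primitive_eq0 (h x : R) : 0 < h -> x <= 0 -> ramp_primitive h x = 0.
Proof.
by move=> h0 hx; rewrite /ramp_primitive /half_sqr /pos_part !max_r ?subrr ?mulr0//; lra.
Qed.

Lemma ramp_primitive_affine (h x : R) : 0 < h -> h <= x -> ramp_primitive h x = x - h / 2.
Proof.
move=> h0 hx; rewrite /ramp_primitive /half_sqr /pos_part !max_l; [|lra|lra].
by field; rewrite gt_eqF.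
Qed.

(* The coefficients annihilate affine functions, so that the combination of
   [ramp_primitive]s vanishes to the right of [b + h]. *)
Definition hat (a c b h t : R) : R := (b - c) * ramp_primitive h (t - a) +
  (a - b) * ramp_primitive h (t - c) + (c - a) * ramp_primitive h (t - b).
Definition dhat (a c b h t : R) : R := (b - c) * ramp h (t - a) +
  (a - b) * ramp h (t - c) + (c - a) * ramp h (t - b).

Lemma test_function_hat (a c b h : R) : -1 < a -> a < b -> -1 < c -> c < b ->
  0 < h -> b + h < 0 -> test_function (hat a c b h) /\ derive1 (hat a c b h) = dhat a c b h.
Proof.
move=> a1 ab c1 cb h0 bh.
have dE (t : R) : is_derive t 1 (hat a c b h) (dhat a c b h t).
  have q (x : R) := is_derive_shift (is_derive_ramp_primitive h (t - x)).
  exact: (is_deriveD (is_deriveD (is_deriveZ _ (q a)) (is_deriveZ _ (q c)))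
    (is_deriveZ _ (q b))).
have d1E : derive1 (hat a c b h) = dhat a c b h.
  by apply/funext => t; exact: derive1_val.
split => //; split; first by move=> t; case: (dE t).
  rewrite d1E => t.
  have cr (x : R) : ramp h (t - x) @[t --> t] --> ramp h (t - x).
    apply: (@continuous_comp _ _ _ (fun t : R => t - x) (ramp h)); last exact: ramp_continuous.
    by apply: cvgB; [exact: cvg_id|exact: cvg_cst].
  by apply: cvgD; [apply: cvgD|]; apply: cvgM => //; exact: cvg_cst.
exists (Num.min a c), (b + h); split => //; first by rewrite lt_min a1.
move=> t /negP; rewrite negb_and -!ltNge => /orP[|bt].
  rewrite lt_min => /andP[ta tc].
  by rewrite /hat !ramp_primitive_eq0 ?mulr0 ?addr0//; lra.
rewrite /hat !ramp_primitive_affine//; lra.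
Qed.

End test_function_constructions.

(** * Weak derivatives of functions *)

Section weak_derivatives.
Context {R : realType}.
Variable X : completeNormedModType R[i].
Local Notation T := (measurableTypeR R).
Local Notation mu := (@mu10 R).
Implicit Types (f g w v : T -> X).

(** [is_weak_derivative] for functions instead of classes, so that tail integrals and exponentials
    can be differentiated without first being placed in L^p. *)
Definition weak_deriv f g : Prop := forall phi : R -> R, test_function phi ->
  bochner_integral mu (fun t : T => (derive1 phi t)%:C *: f t) =
  - bochner_integral mu (fun t : T => (phi t)%:C *: g t).

Lemma weak_deriv_linear (a : R[i]) f f' g g' : L1 mu f -> L1 mu f' ->
  L1 mu g -> L1 mu g' -> weak_deriv f g -> weak_deriv f' g' ->
  weak_deriv (fun t => a *: f t + f' t) (fun t => a *: g t + g' t).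
Proof.
move=> f1 f1' g1 g1' fg fg' phi tphi.
have E1 := bochner_integral_linear mu10_fin a (L1_test1M tphi f1) (L1_test1M tphi f1').
have E2 := bochner_integral_linear mu10_fin a (L1_testM tphi g1) (L1_testM tphi g1').
rewrite (fg _ tphi) (fg' _ tphi) scalerN -opprD -E2 in E1.
apply: (etrans (etrans _ E1) _).
  by congr bochner_integral; apply/funext => t; rewrite scalerDr !scalerA mulrC.
congr (- bochner_integral _ _); apply/funext => t.
by rewrite scalerDr !scalerA mulrC.
Qed.

Lemma weak_deriv_ae f f' g g' : L1 mu f -> L1 mu f' -> L1 mu g -> L1 mu g' ->
  {ae mu, forall t, f t = f' t} -> {ae mu, forall t, g t = g' t} ->
  weak_deriv f g -> weak_deriv f' g'.
Proof.
move=> f1 f1' g1 g1' ff gg fg phi tphi.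
have E1 : bochner_integral mu (fun t : T => (derive1 phi t)%:C *: f t) =
    bochner_integral mu (fun t : T => (derive1 phi t)%:C *: f' t).
  apply: (bochner_integral_ae_eq mu10_fin); [exact: L1_test1M|exact: L1_test1M|].
  by apply: filterS ff => t ->.
have E2 : bochner_integral mu (fun t : T => (phi t)%:C *: g t) =
    bochner_integral mu (fun t : T => (phi t)%:C *: g' t).
  apply: (bochner_integral_ae_eq mu10_fin); [exact: L1_testM|exact: L1_testM|].
  by apply: filterS gg => t ->.
by rewrite -E1 -E2; exact: fg.
Qed.

Lemma weak_deriv_tail w : L1 mu w -> weak_deriv (tail_integral w) (fun t => - w t).
Proof.
move=> w1 phi tphi; have /eqP := by_parts_defect_eq0 tphi w1.
rewrite subr_eq0 => /eqP ->; rewrite -[LHS]opprK; congr (- _).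
have E := bochner_integralZ mu10_fin (-1) (L1_testM tphi w1).
rewrite -scaleN1r -E; congr bochner_integral; apply/funext => t.
by rewrite scaleN1r scalerN.
Qed.

Lemma L1_cst (x : X) : L1 mu (fun=> x).
Proof. by apply: continuous_L1 => t; exact: cvg_cst. Qed.

Lemma weak_deriv_cst (x : X) : weak_deriv (fun=> x) (fun=> 0).
Proof.
move=> phi tphi; have [dphi cphi _] := tphi.
have [C C0 hC] := test_function_bounded tphi.
have ik : mu.-integrable setT (EFin \o (derive1 phi : T -> R)).
  by apply: (@bounded_integrable _ _ _ _ mu10_fin _ C) => [|t];
    [exact: measurable_cont|case: (hC t)].
rewrite (bochner_integralE mu10_fin (bochner_integral_real mu10_fin x ik)).
have -> : (\int[mu]_t (derive1 phi t)%:E = 0)%E.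
  rewrite integral_mu10; last by apply/measurable_EFinP; exact: (measurable_cont cphi).
  have p0 : phi 0 = 0.
    by have [] := test_function_out tphi (t := 0); rewrite ?lexx ?orbT.
  by rewrite test_function_FTC ?lerN10// p0.
rewrite scale0r; apply/esym/eqP; rewrite oppr_eq0; apply/eqP.
apply: etrans (bochner_integral0 mu10_fin X).
by congr bochner_integral; apply/funext => t; rewrite scaler0.
Qed.

Lemma tail_integral_gt0 v (s : R) : L1 mu v -> 0 < s -> tail_integral v s = 0.
Proof.
move=> v1 s0; apply: etrans (bochner_integral0 mu10_fin X).
apply: (bochner_integral_ae_eq mu10_fin);
  [exact: (L1_indic (measurable_itv _) v1)|exact: (L10 mu10_fin)|].
apply: filterS mu10_ae => t /andP[_ t0].
rewrite indicE memNset ?scale0r//= in_itv /= andbT => st.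
by have := lt_le_trans s0 (le_trans st t0); rewrite ltxx.
Qed.

Lemma tail_integral_ltN1 v (s : R) : L1 mu v -> s < -1 ->
  tail_integral v s = tail_integral v (-1).
Proof.
move=> v1 s1; apply: (bochner_integral_ae_eq mu10_fin);
  [exact: (L1_indic (measurable_itv _) v1)|exact: (L1_indic (measurable_itv _) v1)|].
apply: filterS mu10_ae => t /andP[t1 _].
rewrite !indicE !mem_set//= in_itv /= ?t1// andbT.
exact: le_trans (ltW s1) t1.
Qed.

Lemma tail_integral_itv_eq0 v : L1 mu v ->
  (forall s : R, -1 <= s <= 0 -> tail_integral v s = 0) -> {ae mu, forall t, v t = 0}.
Proof.
move=> v1 v0; apply: tail_integral_eq0 => // s.
have [s0|s0] := ltP 0 s; first exact: tail_integral_gt0.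
have [s1|s1] := ltP s (-1); last by apply: v0; rewrite s1.
by rewrite tail_integral_ltN1// v0// lexx lerN10.
Qed.

Lemma tail_integral_cst (x : X) (s : R) : -1 <= s <= 0 ->
  tail_integral (fun=> x) s = (- s)%:C *: x.
Proof.
move=> /andP[s1 s0]; have mtail : measurable (`[s, +oo[%classic : set T) by exact: measurable_itv.
have ik : mu.-integrable setT (EFin \o (\1_(`[s, +oo[%classic : set T) : T -> R)).
  by apply: (@bounded_integrable _ _ _ _ mu10_fin _ 1) => // t;
    rewrite indicE; case: (_ \in _); rewrite ?normr0 ?normr1.
rewrite /tail_integral (bochner_integralE mu10_fin (bochner_integral_real mu10_fin x ik)).
congr ((_%:C) *: _); rewrite integral_indic// setIT mu10E.
have -> : `[s, +oo[%classic `&` `[-1, 0]%classic = `[s, 0]%classic :> set R.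
  apply/seteqP; split => t /=; rewrite !in_itv /= ?andbT.
    by move=> [-> /andP[_ ->]].
  by move=> /andP[st ->]; rewrite st (le_trans s1 st).
rewrite lebesgue_measure_itv /= lte_fin; case: ltP => h; first by rewrite -EFinD /= sub0r.
by have -> : s = 0 by [apply/eqP; rewrite eq_le s0 h]; rewrite oppr0.
Qed.

Lemma dhat_cvg (a c b k : R) (t : R) : 0 < k ->
  dhat a c b (k / n.+1%:R) t @[n --> \oo] -->
  ((b - c) * (a < t)%R%:R + (a - b) * (c < t)%R%:R + (c - a) * (b < t)%R%:R : R).
Proof.
move=> k0; have r (x : R) : ramp (k / n.+1%:R) (t - x) @[n --> \oo] --> ((x < t)%R%:R : R).
  have kn n : 0 < k / n.+1%:R by rewrite divr_gt0.
  case: ltP => xt; last first.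
    by rewrite (_ : (fun n => _) = cst 0);
      [exact: cvg_cst|apply/funext => n; rewrite ramp_eq0// subr_le0].
  have xt0 : 0 < t - x by rewrite subr_gt0.
  apply: cvg_near_cst.
  exists (Num.truncn (k / (t - x))) => // n /= Nn; apply: ramp_eq1 => //.
  rewrite ler_pdivrMr// mulrC -ler_pdivrMr// ltW// (lt_le_trans (truncnS_gt _))//.
  by rewrite ler_nat ltnS.
by apply: cvgD; [apply: cvgD|]; apply: cvgM; try exact: cvg_cst; exact: r.
Qed.

(** The weak equation is tested against [hat], whose derivative is a combination of ramps. As [h]
    tends to 0 the ramps become indicators of rays, and what remains says that the tail integral
    takes collinear values at the three points, that is, depends affinely on its argument. *)
Lemma weak_deriv0_tail w (a c b : R) : L1 mu w -> weak_deriv w (fun=> 0) ->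
  -1 < a -> a < b -> -1 < c -> c < b -> b < 0 ->
  (b - c)%:C *: tail_integral w a + (a - b)%:C *: tail_integral w c +
  (c - a)%:C *: tail_integral w b = 0.
Proof.
move=> w1 w0 a1 ab c1 cb b0.
(* The width is at most [- b / 2], so the support of the test function ends before 0. *)
pose h (n : nat) := (- b / 2) / n.+1%:R.
have k0 : 0 < - b / 2 by lra.
have h0 n : 0 < h n by rewrite divr_gt0.
have hb n : b + h n < 0.
  have : h n <= - b / 2 by rewrite ler_pdivrMr// ler_peMr ?ler1n// ltW.
  by lra.
have th n := test_function_hat a1 ab c1 cb (h0 n) (hb n).
pose k (t : R) : R := (b - c) * (a <= t)%R%:R + (a - b) * (c <= t)%R%:R + (c - a) * (b <= t)%R%:R.
pose ind (x : R) := (fun t : T => (\1_(`[x, +oo[%classic : set T) t : R)%:C *: w t).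
have ind1 x : L1 mu (ind x) by exact: (L1_indic (measurable_itv _) w1).
pose F := fun t : T => (b - c)%:C *: ind a t + ((a - b)%:C *: ind c t + (c - a)%:C *: ind b t).
have F1 : L1 mu F by apply: L1_linear => //; apply: L1_linear => //; exact: L1Z.
have FE : bochner_integral mu F = (b - c)%:C *: tail_integral w a +
    (a - b)%:C *: tail_integral w c + (c - a)%:C *: tail_integral w b.
  have Z1 := L1Z (c - a)%:C (ind1 b).
  rewrite /F (bochner_integral_linear mu10_fin (b - c)%:C (ind1 a)
    (L1_linear (a - b)%:C (ind1 c) Z1)).
  rewrite (bochner_integral_linear mu10_fin (a - b)%:C (ind1 c) Z1).
  by rewrite (bochner_integralZ mu10_fin (c - a)%:C (ind1 b)) addrA.
rewrite -FE; apply/nrm_le0/ler_addgt0Pr => e e0; rewrite add0r.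
pose f_ n := fun t : T => (derive1 (hat a c b (h n)) t)%:C *: w t.
have f1 n : L1 mu (f_ n) by exact: (L1_test1M (th n).1 w1).
have f0 n : bochner_integral mu (f_ n) = 0.
  rewrite (w0 _ (th n).1); apply/eqP; rewrite oppr_eq0; apply/eqP.
  apply: etrans (bochner_integral0 mu10_fin X).
  by congr bochner_integral; apply/funext => t; rewrite scaler0.
pose K := `|b - c| + `|a - b| + `|c - a|.
have kF t : F t = (k t)%:C *: w t.
  rewrite /F /ind !indicE !mem_tail /k; move: (b - c) (a - b) (c - a) => x y z.
  by rewrite !rmorphD !rmorphM !scalerDl !scalerA addrA.
have b01 (i : bool) : 0 <= (i%:R : R) <= 1 by case: i; rewrite /= ?lexx ?ler01.
have bound3 (x y z : R) : 0 <= x <= 1 -> 0 <= y <= 1 -> 0 <= z <= 1 ->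
    `|(b - c) * x + (a - b) * y + (c - a) * z| <= K.
  move=> /andP[x0 x1] /andP[y0 y1] /andP[z0 z1].
  rewrite (le_trans (ler_normD _ _))// lerD//; last first.
    by rewrite normrM (ger0_norm z0) ler_piMr.
  rewrite (le_trans (ler_normD _ _))// lerD//.
    by rewrite normrM (ger0_norm x0) ler_piMr.
  by rewrite normrM (ger0_norm y0) ler_piMr.
have HL : L1norm mu (fun t => F t - f_ n t) @[n --> \oo] --> 0%E.
  apply: (@L1norm_dominated_cvg _ _ _ mu X f_ F (fun t => (2 * K) * nrm (w t))).
  - by move=> n; case: (f1 n).
  - by case: F1.
  - exact: (integrableZl measurableT (2 * K) (L1_integrable w1)).
  (* The ramps tend to indicators of open rays while tail integrals use closed ones; the two differ
     only at [a], [b] and [c]. *)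
  - apply: filterS3 (mu10_ae_neq a) (mu10_ae_neq b) (mu10_ae_neq c) => t ta tb tc.
    apply/cvg_nrmP => e' e'0.
    have e1 : 0 < e' / (nrm (w t) + 1) by rewrite divr_gt0// ltr_wpDl// nrm_ge0.
    have /cvgrPdist_lt/(_ _ e1) := @dhat_cvg a c b _ t k0.
    have lt_le (x : R) : t <> x -> (x < t) = (x <= t).
      by move=> tx; rewrite lt_neqAle; case: eqP => // xt; case: tx.
    rewrite !lt_le// -/(k t).
    apply: filterS => n hn; rewrite kF /f_ (th n).2 -scalerBl -rmorphB nrmZ nrm_real.
    move: hn; rewrite ltr_pdivlMr ?ltr_wpDl ?nrm_ge0//; apply: le_lt_trans.
    by rewrite ler_wpM2l// lerDl.
  - move=> n t; rewrite kF /f_ (th n).2 -scalerBl -rmorphB nrmZ nrm_real.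
    rewrite ler_wpM2r ?nrm_ge0// (le_trans (ler_normB _ _))// mulrDl mul1r lerD//.
      by apply: bound3; exact: b01.
    by apply: bound3; exact: ramp_bound.
have [N _ /(_ N (leqnn N)) hN] := (ecvg0P (fun n => L1norm_ge0 mu _)).1 HL _ e0.
rewrite -[bochner_integral mu F]subr0 -(f0 N).
rewrite -(bochner_integralB mu10_fin F1 (f1 N)).
have LD := L1B F1 (f1 N).
by rewrite -lee_fin (le_trans (bochner_integral_le mu10_fin LD))// ltW.
Qed.

End weak_derivatives.

(** * Constancy, uniqueness and multiplication by exponentials *)

Section weak_derivative_uniqueness.
Context {R : realType}.
Variable X : completeNormedModType R[i].
Local Notation T := (measurableTypeR R).
Local Notation mu := (@mu10 R).
Implicit Types (f g w v : T -> X).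

(** The three-point relation holds inside the open interval only. It is applied to the images of
    [s], [-1] and [0] under the contraction [u |-> (1 - e) * u - e / 2]; the common factor [1 - e]
    drops out, and continuity allows [e = 0]. *)
Lemma tail_integral_affine w : L1 mu w -> weak_deriv w (fun=> 0) ->
  forall s : R, -1 <= s <= 0 -> tail_integral w s = (- s)%:C *: tail_integral w (-1).
Proof.
move=> w1 w0 s /andP[s1]; rewrite le_eqVlt => /predU1P[->|s0].
  by rewrite oppr0 scale0r tail_integral0.
pose g (e : R) : X := tail_integral w ((1 - e) * s - e / 2) +
  (s%:C *: tail_integral w (-1 + e / 2) - (1 + s)%:C *: tail_integral w (- (e / 2))).
have g0 e : 0 < e -> e < 1 -> g e = 0.
  move=> e0 e1; have e1' : 0 < 1 - e by rewrite subr_gt0.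
  have := @weak_deriv0_tail _ _ w ((1 - e) * s - e / 2) (-1 + e / 2) (- (e / 2)) w1 w0.
  have h1 : -1 < (1 - e) * s - e / 2 by nra.
  have h2 : (1 - e) * s - e / 2 < - (e / 2) by nra.
  have h3 : -1 < -1 + e / 2 by lra.
  have h4 : -1 + e / 2 < - (e / 2) by lra.
  have h5 : - (e / 2) < 0 by lra.
  move=> /(_ h1 h2 h3 h4 h5).
  have -> : - (e / 2) - (-1 + e / 2) = 1 - e by field.
  have -> : (1 - e) * s - e / 2 - - (e / 2) = (1 - e) * s by ring.
  have -> : -1 + e / 2 - ((1 - e) * s - e / 2) = (1 - e) * - (1 + s) by field.
  rewrite !rmorphM -!scalerA -!scalerDr => /eqP; rewrite scaler_eq0 => /orP[|/eqP].
    by rewrite fmorph_eq0 (gt_eqF e1').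
  by rewrite /g rmorphN scaleNr addrA.
have cW := tail_integral_continuous w1.
have comp (k : R -> R) : continuous k -> continuous (fun e => tail_integral w (k e)).
  by move=> kc e; apply: (@continuous_comp _ _ _ k (tail_integral w)); [exact: kc|exact: cW].
have cmul (c : R) : continuous (fun e : R => c * e).
  by move=> e; exact: mulrl_continuous.
have chalf : continuous (fun e : R => e / 2) by move=> e; exact: mulrr_continuous.
have gc : continuous g.
  move=> e; apply: cvgD.
    apply: (comp (fun e => (1 - e) * s - e / 2)) => {}e.
    apply: cvgB; last exact: chalf.
    apply: cvgM; last exact: cvg_cst.
    by apply: cvgB; [exact: cvg_cst|exact: cvg_id].
  apply: cvgB; apply: cvgZr.
    apply: (comp (fun e => -1 + e / 2)) => {}e.
    by apply: cvgD; [exact: cvg_cst|exact: chalf].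
  by apply: (comp (fun e => - (e / 2))) => {}e; apply: cvgN; exact: chalf.
have : g 0 = 0.
  apply: nrm_lt_eq => e e0; have /cvg_nrmP/(_ _ e0)[d /= d0 hd] := gc 0.
  have [m [m0 m1 md]] : exists m : R, [/\ 0 < m, m < 1 & m < d].
    case: (ltP d 1) => d1; first by exists (d / 2); split; lra.
    by exists (1 / 2); split; lra.
  rewrite -(g0 m m0 m1); apply: hd.
  by rewrite /= sub0r normrN gtr0_norm.
rewrite /g !(mul0r, subr0, addr0, mul1r, oppr0) (tail_integral0 w1) scaler0 subr0.
by move=> /eqP; rewrite addr_eq0 -scaleNr -rmorphN => /eqP.
Qed.

(* du Bois-Reymond *)
Lemma weak_deriv0_cst w : L1 mu w -> weak_deriv w (fun=> 0) ->
  exists c : X, {ae mu, forall t, w t = c}.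
Proof.
move=> w1 w0; exists (tail_integral w (-1)); set c := tail_integral w (-1).
have wc : L1 mu (fun t => w t - c) by exact: (L1B w1 (L1_cst c)).
have : {ae mu, forall t, w t - c = 0}.
  apply: tail_integral_itv_eq0 => // s sI.
  have E := tail_integral_linear (-1) s (L1_cst c) w1.
  rewrite (tail_integral_cst c sI) in E; apply: etrans (etrans E _).
    by congr tail_integral; apply/funext => t; rewrite scaleN1r addrC.
  by rewrite (tail_integral_affine w1 w0 sI) -/c scaleN1r addNr.
by apply: filterS => t /eqP; rewrite subr_eq0 => /eqP.
Qed.

(** Adding [tail_integral g], whose weak derivative is [- g], shows that this tail integral has weak
    derivative zero. It is then constant, and equal to its value 0 at the point 0. *)
Lemma weak_deriv_of0 g : L1 mu g -> weak_deriv (fun=> 0) g ->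
  {ae mu, forall t, g t = 0}.
Proof.
move=> g1 g0; have t1 := tail_integral_L1 g1.
have wt : weak_deriv (tail_integral g) (fun=> 0).
  have L0 := L10 mu10_fin X.
  have Lg : L1 mu (fun t => - g t).
    by have := L1Z (-1) g1; congr L1; apply/funext => t; rewrite scaleN1r.
  have := weak_deriv_linear 1 L0 t1 g1 Lg g0 (weak_deriv_tail g1).
  by congr weak_deriv; apply/funext => t; [rewrite scaler0 add0r|rewrite scale1r subrr].
have [c gc] := weak_deriv0_cst t1 wt.
have tc := tail_integral_continuous g1.
have E : forall s : R, -1 <= s <= 0 -> tail_integral g s = c.
  apply: (@continuous_ae_eq _ _ (tail_integral g) (fun=> c)) => //.
    exact: continuous_subspaceT.
  by apply: continuous_subspaceT => t; exact: cvg_cst.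
have c0 : c = 0 by rewrite -(E 0) ?lexx ?lerN10// tail_integral0.
by apply: tail_integral_itv_eq0 => // s /E ->.
Qed.

Lemma weak_deriv_uniq f g g' : L1 mu f -> L1 mu g -> L1 mu g' ->
  weak_deriv f g -> weak_deriv f g' -> {ae mu, forall t, g t = g' t}.
Proof.
move=> f1 g1 g1' fg fg'.
have h := weak_deriv_linear (-1) f1 f1 g1' g1 fg' fg.
have gg1 : L1 mu (fun t => -1 *: g' t + g t) by exact: L1_linear.
have := @weak_deriv_of0 _ gg1.
have -> : (fun=> 0 : X) = (fun t : T => -1 *: f t + f t).
  by apply/funext => t; rewrite scaleN1r addNr.
move=> /(_ h); apply: filterS => t /eqP.
by rewrite scaleN1r addrC subr_eq0 => /eqP.
Qed.

Lemma is_derive_exp_cos (a b t : R) :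
  is_derive t 1 (fun t : R => expR (a * t) * cos (b * t))
    (a * (expR (a * t) * cos (b * t)) - b * (expR (a * t) * sin (b * t))).
Proof.
apply: is_derive_eq; rewrite /GRing.scale /= ?mulr0 ?addr0 ?mulr1; ring.
Qed.

Lemma is_derive_exp_sin (a b t : R) :
  is_derive t 1 (fun t : R => expR (a * t) * sin (b * t))
    (a * (expR (a * t) * sin (b * t)) + b * (expR (a * t) * cos (b * t))).
Proof.
apply: is_derive_eq; rewrite /GRing.scale /= ?mulr0 ?addr0 ?mulr1; ring.
Qed.

Lemma continuous_exp_trig (a b : R) :
  continuous (fun t : R => expR (a * t) * cos (b * t)) /\
  continuous (fun t : R => expR (a * t) * sin (b * t)).
Proof.
split; apply: derivable_continuous1 => t.
  by case: (is_derive_exp_cos a b t).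
by case: (is_derive_exp_sin a b t).
Qed.

Lemma L1_cexpM (z : R[i]) w : L1 mu w -> L1 mu (fun t : T => cexp (z * (t : R)%:C) *: w t).
Proof.
apply: (@L1_contM _ _ (fun t => cexp (z * t%:C)) _ (expR `|complex.Re z|)).
  exact: continuous_cexp.
move=> t tI; apply: nrm_cexp_line_le => //.
by rewrite lerNl -normrN ler_norm.
Qed.

(** The Leibniz rule. As test functions are real, the factor is split into its real and imaginary
    parts [C] and [S]; the equation is tested against [phi * C] and [phi * S], and the results are
    recombined with coefficient ['i]. *)
Lemma weak_deriv_cexp (z : R[i]) f g : L1 mu f -> L1 mu g -> weak_deriv f g ->
  weak_deriv (fun t : T => cexp (z * (t : R)%:C) *: f t)
    (fun t : T => cexp (z * (t : R)%:C) *: (g t + z *: f t)).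
Proof.
move=> f1 g1 fg phi tphi; case: z => a b.
pose C (t : R) := expR (a * t) * cos (b * t).
pose S (t : R) := expR (a * t) * sin (b * t).
have [cC cS] := continuous_exp_trig a b.
have cdC : continuous (fun t => a * C t - b * S t).
  by move=> t; apply: cvgB; apply: cvgM; try exact: cvg_cst; [exact: cC|exact: cS].
have cdS : continuous (fun t => a * S t + b * C t).
  by move=> t; apply: cvgD; apply: cvgM; try exact: cvg_cst; [exact: cS|exact: cC].
have [tC dC] := test_functionM tphi (is_derive_exp_cos a b) cdC.
have [tS dS] := test_functionM tphi (is_derive_exp_sin a b) cdS.
set z := a +i* b.
have eE (t : R) : cexp (z * t%:C) = C t +i* S t by rewrite cexp_line.
pose dCf := fun t : T => (derive1 (fun t => phi t * C t) t)%:C *: f t.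
pose dSf := fun t : T => (derive1 (fun t => phi t * S t) t)%:C *: f t.
pose Cg := fun t : T => (phi t * C t)%:C *: g t.
pose Sg := fun t : T => (phi t * S t)%:C *: g t.
pose ef := fun t : T => (phi t)%:C *: (cexp (z * (t : R)%:C) *: f t).
have LdC : L1 mu dCf by exact: (L1_test1M tC f1).
have LdS : L1 mu dSf by exact: (L1_test1M tS f1).
have LC : L1 mu Cg by exact: (L1_testM tC g1).
have LS : L1 mu Sg by exact: (L1_testM tS g1).
have Lef : L1 mu ef by exact: (L1_testM tphi (L1_cexpM z f1)).
have L1a : L1 mu (fun t => 'i *: dSf t + dCf t) by exact: L1_linear.
have L2a : L1 mu (fun t => 'i *: Sg t + Cg t) by exact: L1_linear.
transitivity (bochner_integral mu (fun t => (- z) *: ef t + ('i *: dSf t + dCf t))).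
  congr bochner_integral; apply/funext => t.
  rewrite /ef /dSf /dCf dC dS -/(C t) -/(S t) !scalerA -!scalerDl eE; congr (_ *: _).
  by apply/eqP; rewrite eq_complex /=; apply/andP; split; apply/eqP; ring.
transitivity (- bochner_integral mu (fun t => z *: ef t + ('i *: Sg t + Cg t))); last first.
  congr (- bochner_integral _ _); apply/funext => t.
  rewrite /ef /Sg /Cg !scalerDr !scalerA -scalerDl [LHS]addrC eE; congr (_ *: _ + _ *: _).
    by apply/eqP; rewrite eq_complex /=; apply/andP; split; apply/eqP; ring.
  by apply/eqP; rewrite eq_complex /=; apply/andP; split; apply/eqP; ring.
rewrite (bochner_integral_linear mu10_fin _ Lef L1a) (bochner_integral_linear mu10_fin _ Lef L2a).
rewrite (bochner_integral_linear mu10_fin _ LdS LdC) (bochner_integral_linear mu10_fin _ LS LC).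
have FC : bochner_integral mu dCf = - bochner_integral mu Cg := fg _ tC.
have FS : bochner_integral mu dSf = - bochner_integral mu Sg := fg _ tS.
move: FC FS; move: (bochner_integral mu dCf) (bochner_integral mu dSf)
  (bochner_integral mu Cg) (bochner_integral mu Sg) (bochner_integral mu ef).
by move=> b1 b2 b3 b4 b5 -> ->; rewrite scalerN scaleNr !opprD.
Qed.

End weak_derivative_uniqueness.

(** * Classes in L^p over [-1, 0] and their representatives *)

Section Lp_unit_interval.
Context {R : realType}.
Variable X : completeNormedModType R[i].
Variables (p : R) (p1 : 1 < p).
Local Notation T := (measurableTypeR R).
Local Notation mu := (@mu10 R).
Local Notation Lpm := (Lp X mu (ltW p1)).

Let p0 : 0 < p. Proof. exact: lt_trans ltr01 p1. Qed.

Lemma nrm_Lp (F : Lpm) : (nrm F)%:E = Lpnorm mu p (Lp_fun F).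
Proof. exact: Lp_norm_fin. Qed.

Lemma Lp_ext (F G : Lpm) : {ae mu, forall t, Lp_fun F t = Lp_fun G t} -> F = G.
Proof.
move=> FG; apply/eqP; rewrite -subr_eq0; apply/eqP/nrm0_eq0/EFin_inj.
have h0 : Lpnorm mu p (0 : T -> X) = 0%E by apply: Lpnorm0; exact: ltW.
rewrite nrm_Lp; apply: etrans h0.
have [mFG _] := Lp_funP (F - G).
apply: (eq_Lpnorm p mFG (@strongly_measurable0 _ T _ X)).
have -> : F - G = F + (-1 : R[i]) *: G by rewrite scaleN1r.
apply: filterS3 FG (Lp_funD F ((-1 : R[i]) *: G)) (Lp_funZ (-1) G) => t h1 h2 h3.
by rewrite h2 h3 h1 scaleN1r subrr.
Qed.

Lemma Lpnorm_ae_le (f : T -> X) (C : R) : 0 <= C -> strongly_measurable f ->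
  {ae mu, forall t, nrm (f t) <= C} -> (Lpnorm mu p f <= C%:E)%E.
Proof.
move=> C0 mf fC.
have mpow : measurable_fun setT (fun t => (`|nrm (f t)| `^ p)%:E).
  apply/measurable_EFinP.
  apply: (@measurableT_comp _ _ _ _ _ _ (@powR R ^~ p)) => //.
  by apply: measurableT_comp => //; exact: measurable_nrm.
rewrite /Lpnorm unlock /=.
apply: (@le_trans _ _ ((C `^ p)%:E `^ p^-1)%E); last first.
  by rewrite poweR_EFin -powRrM mulfV ?gt_eqF// powRr1.
apply: gt0_ler_poweR.
- by rewrite invr_ge0 ltW.
- by rewrite in_itv /= leey andbT integral_ge0// => t _; rewrite lee_fin powR_ge0.
- by rewrite in_itv /= leey andbT lee_fin powR_ge0.
have cE (c : R) : (\int[mu]_t c%:E = c%:E)%E.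
  by rewrite integral_cst//= [X in (_ * X)%E]mu10_setT mule1.
rewrite -[leRHS]cE; apply: ae_ge0_le_integral => //.
  by move=> t _; rewrite lee_fin powR_ge0.
apply: filterS fC => t h _; rewrite lee_fin.
by rewrite ge0_ler_powR ?nnegrE// ?ger0_norm ?nrm_ge0// ltW.
Qed.

Lemma Lp_of_bounded (f : T -> X) (C : R) : 0 <= C -> strongly_measurable f ->
  {ae mu, forall t, nrm (f t) <= C} ->
  exists2 F : Lpm, {ae mu, forall t, Lp_fun F t = f t} & nrm F <= C.
Proof.
move=> C0 mf fC; have fL : f \in Lpfun mu (ltW p1).
  by rewrite inE /=; split => //; rewrite (le_lt_trans (Lpnorm_ae_le C0 mf fC))// ltry.
have Ff := Lp_fun_pi (LpfunType fL).
set F : Lpm := (\pi_(Lpm) (LpfunType fL))%qT in Ff.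
exists F => //; rewrite -lee_fin nrm_Lp.
apply: Lpnorm_ae_le => //; first by have [] := Lp_funP F.
by apply: filterS2 Ff fC => t ->.
Qed.

(** The Hoelder inequality against the constant 1; the measure has total mass 1, so no constant
    appears. *)
Lemma Lp_L1norm_le (F : Lpm) : (L1norm mu (Lp_fun F) <= (nrm F)%:E)%E.
Proof.
have [mF _] := Lp_funP F.
have mN := measurable_nrm mF.
have q0 : 0 < (1 - p^-1)^-1.
  by rewrite invr_gt0 subr_gt0 invf_lt1.
have := @hoelder _ _ _ mu (@nrm R X \o Lp_fun F) (cst 1) p (1 - p^-1)^-1 mN
  (measurable_cst _) p0 q0.
rewrite invrK addrC subrK => /(_ erefl).
rewrite Lnorm_cst1 mu10_setT poweR1r mule1 nrm_Lp; apply: le_trans.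
rewrite Lnorm1 le_eqVlt; apply/orP; left; apply/eqP; apply: eq_integral => t _.
by rewrite /= mulr1 ger0_norm// nrm_ge0.
Qed.

Lemma Lp_L1 (F : Lpm) : L1 mu (Lp_fun F).
Proof.
split; first by have [] := Lp_funP F.
by rewrite (le_lt_trans (Lp_L1norm_le F))// ltry.
Qed.

(** The representative chosen by [get] agrees on [-1, 0] with any other one, since continuous
    functions that are equal almost everywhere coincide there. *)
Lemma continuous_rep_eq (F : Lpm) (f : R -> X) : is_continuous_rep F f ->
  is_continuous_rep F (continuous_rep F) /\
  forall t, -1 <= t <= 0 -> continuous_rep F t = f t.
Proof.
move=> Ff; have Fr : is_continuous_rep F (continuous_rep F).
  by apply: (@getPex _ (is_continuous_rep F)); exists f.
split => //; apply: continuous_ae_eq; [exact: Fr.1|exact: Ff.1|].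
by apply: filterS2 Fr.2 Ff.2 => t <-.
Qed.

Lemma weak_derivative_eq (F G : Lpm) : is_weak_derivative F G -> weak_derivative F = G.
Proof.
move=> FG; have Fr : is_weak_derivative F (weak_derivative F).
  by apply: (@getPex _ (is_weak_derivative F)); exists G.
apply: Lp_ext; exact: (weak_deriv_uniq (Lp_L1 F) (Lp_L1 _) (Lp_L1 G) Fr FG).
Qed.

End Lp_unit_interval.

(** * The resolvent of the delay operator *)

Section contraction.
Context {R : realType}.
Variable X : completeNormedModType R[i].

(** Picard iteration from 0, the partial sums of the Neumann series. Additivity lets [n]
    applications of [S] act on a difference bounded by [B], which gives the Cauchy estimate
    [q ^+ n * B]. *)
Lemma linear_contraction_fixpoint (S : X -> X) (q : R) (y : X) :
  (forall u v, S (u - v) = S u - S v) -> (forall z, nrm (S z) <= q * nrm z) ->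
  0 <= q < 1 -> exists z, z = y + S z.
Proof.
move=> SB Sq /andP[q0 q1]; pose z := fun n => iter n (fun z => y + S z) 0.
(* [B] is the solution of [nrm y + q * B = B], so the ball of radius [B] is stable under the
   iteration. *)
pose B := nrm y / (1 - q); have q1' : 0 < 1 - q by rewrite subr_gt0.
have BE : nrm y + q * B = B by rewrite /B; field; rewrite gt_eqF.
have B0 : 0 <= B by rewrite divr_ge0 ?nrm_ge0// ltW.
have zB k : nrm (z k) <= B.
  elim: k => [|k IH]; first by rewrite nrm0.
  by rewrite -BE (le_trans (nrmD _ _))// lerD2l (le_trans (Sq _))// ler_wpM2l.
have zd n k : nrm (z (n + k)%N - z n) <= q ^+ n * B.
  elim: n => [|n IH]; first by rewrite subr0 expr0 mul1r zB.
  rewrite addSn /= opprD addrACA subrr add0r -SB (le_trans (Sq _))// exprS -mulrA.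
  exact: ler_wpM2l.
have cq : GRing.exp q n @[n --> \oo] --> 0 by apply: cvg_expr; rewrite ger0_norm.
have [l zl] : exists l : X, z n @[n --> \oo] --> l.
  apply: cauchy_nrm_cvg => e e0.
  have e1 : 0 < e / 2 / (B + 1) by rewrite !divr_gt0// ltr_wpDl.
  have /cvgrPdist_lt/(_ _ e1)[N _ hN] := cq; exists N.
  have hz n : (N <= n)%N -> nrm (z n - z N) < e / 2.
    move=> Nn; rewrite -(subnKC Nn); apply: (le_lt_trans (zd N _)).
    have := hN N (leqnn N); rewrite /= sub0r normrN ger0_norm ?exprn_ge0//.
    rewrite ltr_pdivlMr ?ltr_wpDl//; apply: le_lt_trans.
    by rewrite ler_wpM2l ?exprn_ge0// lerDl.
  move=> m n Nm Nn; rewrite (le_lt_trans (nrmB_le _ (z N) _))// (splitr e) ltrD ?hz//.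
  by rewrite nrm_distC hz.
exists l; apply: nrm_lt_eq => e e0.
have e2 : 0 < e / 2 by rewrite divr_gt0.
have [N _ hN] := (cvg_nrmP _ _ _).1 zl _ e2.
have h1 := hN N.+1 (leqnSn N); have h2 := hN N (leqnn N).
rewrite (le_lt_trans (nrmB_le _ (z N.+1) _))// (splitr e) ltrD//.
rewrite /= opprD addrACA subrr add0r -SB (le_lt_trans (Sq _))//.
apply: le_lt_trans h2; rewrite nrm_distC -[leRHS]mul1r ler_wpM2r ?nrm_ge0// ltW//.
Qed.

End contraction.

(** * Variation of constants *)

Section exponential_solution.
Context {R : realType}.
Variable X : completeNormedModType R[i].
Variables (p : R) (p1 : 1 < p).
Local Notation T := (measurableTypeR R).
Local Notation mu := (@mu10 R).
Local Notation Lpm := (Lp X mu (ltW p1)).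

Definition twist (l : R[i]) (G : Lpm) : T -> X :=
  fun t => cexp (- l * (t : R)%:C) *: Lp_fun G t.

(* Variation of constants for [f' = l f - G] with [f 0 = x]. *)
Definition exp_solution (l : R[i]) (x : X) (G : Lpm) (t : R) : X :=
  cexp (l * t%:C) *: (x + tail_integral (twist l G) t).

Lemma L1_twist l G : L1 mu (twist l G).
Proof. exact: (L1_cexpM (- l) (Lp_L1 G)). Qed.

Lemma cexpNK (l : R[i]) (t : R) (x : X) : cexp (l * t%:C) *: (cexp (- l * t%:C) *: x) = x.
Proof. by rewrite scalerA -cexpD mulNr subrr cexp0 scale1r. Qed.

Lemma exp_solution_continuous l x G : continuous (exp_solution l x G).
Proof.
move=> t; apply: cvgZ; first exact: continuous_cexp.
by apply: cvgD; [exact: cvg_cst|exact: (tail_integral_continuous (L1_twist l G))].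
Qed.

Lemma exp_solution0 l x G : exp_solution l x G 0 = x.
Proof.
rewrite /exp_solution mulr0 cexp0 scale1r tail_integral0 ?addr0//.
exact: L1_twist.
Qed.

Lemma exp_solutionE l x G t :
  exp_solution l x G t = cexp (l * t%:C) *: x + exp_solution l 0 G t.
Proof. by rewrite /exp_solution add0r scalerDr. Qed.

(** The exponential in front is moved under the integral, where it combines into [exp (l (t - s))]
    with [t <= s]; as [t - s] lies in [-1, 0], a single factor [expR c] bounds it. *)
Lemma exp_solution_le l x G c t : 0 <= c -> - c <= complex.Re l -> -1 <= t <= 0 ->
  nrm (exp_solution l x G t) <= expR c * (nrm x + nrm G).
Proof.
move=> c0 cl tI; rewrite exp_solutionE (le_trans (nrmD _ _))// mulrDr lerD//.
  by rewrite nrmZ ler_wpM2r ?nrm_ge0// nrm_cexp_line_le.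
rewrite /exp_solution add0r.
have mtail : measurable (`[t, +oo[%classic : set T) by exact: measurable_itv.
have L := L1_indic mtail (L1_twist l G).
rewrite /tail_integral -(bochner_integralZ mu10_fin _ L).
have Lz := L1Z (cexp (l * t%:C)) L.
apply: (bochner_integral_ae_le mu10_fin Lz).
have G1 := Lp_L1 G.
apply: (@le_trans _ _ ((expR c)%:E * L1norm mu (Lp_fun G))%E); last first.
  by rewrite EFinM lee_wpmul2l ?lee_fin ?expR_ge0// Lp_L1norm_le.
apply: L1norm_aeM_le; [exact: expR_ge0|by case: Lz|by case: G1|].
apply: filterS mu10_ae => s /andP[s1 s0].
rewrite /twist indicE mem_tail; case: (boolP (t <= s)%R) => ts; last first.
  by rewrite scale0r scaler0 nrm0 mulr_ge0 ?expR_ge0 ?nrm_ge0.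
rewrite scale1r scalerA -cexpD mulNr -mulrBr -rmorphB nrmZ ler_wpM2r ?nrm_ge0//.
apply: nrm_cexp_line_le => //; move: tI => /andP[t1 t0].
by apply/andP; split; lra.
Qed.

Lemma exp_solution_weak_deriv l x G :
  weak_deriv (exp_solution l x G : T -> X)
    (fun t : T => l *: exp_solution l x G t - Lp_fun G t).
Proof.
have w1 := L1_twist l G; have t1 := tail_integral_L1 w1.
have nw1 : L1 mu (fun t => - twist l G t).
  by have := L1Z (-1) w1; congr L1; apply/funext => t; rewrite scaleN1r.
have c1 : L1 mu (fun=> x) := L1_cst x.
have L0 := L10 mu10_fin X.
have d := weak_deriv_linear 1 c1 t1 L0 nw1 (weak_deriv_cst x) (weak_deriv_tail w1).
have := weak_deriv_cexp l (L1_linear 1 c1 t1) (L1_linear 1 L0 nw1) d.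
congr weak_deriv; apply/funext => t.
  by rewrite scale1r.
rewrite !scale1r add0r scalerDr scalerN /twist cexpNK addrC /exp_solution.
by congr (_ - _); rewrite !scalerA mulrC.
Qed.

Lemma Lp_of_continuous (f : R -> X) (C : R) : 0 <= C -> continuous f ->
  (forall t, -1 <= t <= 0 -> nrm (f t) <= C) ->
  exists F : Lpm, [/\ {ae mu, forall t : T, Lp_fun F t = f t}, nrm F <= C &
    is_continuous_rep F f].
Proof.
move=> C0 fc fC.
have h : {ae mu, forall t : T, nrm (f t) <= C}.
  by apply: filterS mu10_ae => t; exact: fC.
have [F Ff FC] := Lp_of_bounded p1 C0 (continuous_strongly_measurable fc) h.
by exists F; split => //; split => //; exact: continuous_subspaceT.
Qed.

Lemma exp_solution_exists l x (G : Lpm) c : 0 <= c -> - c <= complex.Re l ->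
  exists F : Lpm, [/\ is_weak_derivative F (l *: F - G),
    nrm F <= expR c * (nrm x + nrm G) & is_continuous_rep F (exp_solution l x G)].
Proof.
move=> c0 cl.
have C0 : 0 <= expR c * (nrm x + nrm G) by rewrite mulr_ge0 ?expR_ge0// addr_ge0 ?nrm_ge0.
have [F [Ff FC Fr]] := Lp_of_continuous C0 (@exp_solution_continuous l x G)
  (fun t h => exp_solution_le x G c0 cl h).
exists F; split => //.
have ES1 : L1 mu (exp_solution l x G : T -> X).
  exact: continuous_L1 (@exp_solution_continuous l x G).
have D1 : L1 mu (fun t : T => l *: exp_solution l x G t - Lp_fun G t).
  by apply: L1B; [exact: L1Z|exact: Lp_L1].
apply: (weak_deriv_ae ES1 (Lp_L1 F) D1 (Lp_L1 _) _ _ (exp_solution_weak_deriv l x G)).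
  by apply: filterS Ff => t ->.
have -> : l *: F - G = l *: F + (-1 : R[i]) *: G by rewrite scaleN1r.
have h : {ae mu, forall t : T, Lp_fun (l *: F + (-1 : R[i]) *: G) t =
    l *: Lp_fun F t - Lp_fun G t}.
  apply: filterS3 (Lp_funZ l F) (Lp_funD (l *: F) ((-1 : R[i]) *: G)) (Lp_funZ (-1) G).
  by move=> t h1 h2 h3; rewrite h2 h1 h3 scaleN1r.
by apply: filterS2 Ff h => t h1 ->; rewrite h1.
Qed.

(** Multiplied by [exp (- l t)], [F] has the same weak derivative as [tail_integral (twist l G)];
    the difference is constant by the du Bois-Reymond lemma, and that constant is [x]. *)
Lemma exp_solution_uniq l (F G : Lpm) : is_weak_derivative F (l *: F - G) ->
  exists x, is_continuous_rep F (exp_solution l x G).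
Proof.
move=> FG; have w1 := L1_twist l G; have t1 := tail_integral_L1 w1.
have D1 := Lp_L1 (l *: F - G); have F1 := Lp_L1 F.
have d1 := weak_deriv_cexp (- l) F1 D1 FG.
have nw1 : L1 mu (fun t => - twist l G t).
  by have := L1Z (-1) w1; congr L1; apply/funext => t; rewrite scaleN1r.
have e1 := L1_cexpM (- l) F1.
have de1 : L1 mu (fun t : T => cexp (- l * (t : R)%:C) *: (Lp_fun (l *: F - G) t + - l *: Lp_fun F t)).
  by apply: L1_cexpM; apply: L1D => //; exact: L1Z.
have d2 := weak_deriv_linear (-1) t1 e1 nw1 de1 (weak_deriv_tail w1) d1.
have u1 := L1_linear (-1) t1 e1; have v1 := L1_linear (-1) nw1 de1.
have d3 : weak_deriv (fun t : T => -1 *: tail_integral (twist l G) t +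
    cexp (- l * (t : R)%:C) *: Lp_fun F t) (fun=> 0).
  apply: (weak_deriv_ae u1 u1 v1 (L10 mu10_fin X) _ _ d2); first exact: nearW.
  have -> : l *: F - G = l *: F + (-1 : R[i]) *: G by rewrite scaleN1r.
  apply: filterS3 (Lp_funZ l F) (Lp_funD (l *: F) ((-1 : R[i]) *: G)) (Lp_funZ (-1) G).
  move=> t h2 h3 h4; rewrite /twist h3 h2 h4 !scaleN1r opprK scaleNr addrAC subrr sub0r.
  by rewrite scalerN subrr.
have [x hx] := weak_deriv0_cst u1 d3.
exists x; split; first exact/continuous_subspaceT/exp_solution_continuous.
apply: filterS hx => t; rewrite scaleN1r addrC => /eqP; rewrite subr_eq => /eqP h.
by rewrite /exp_solution -h cexpNK.
Qed.

End exponential_solution.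

(** * The resolvent equation of the delay operator at a fixed [l] *)

Section delay_resolvent.
Context {R : realType}.
Variables (X : completeNormedModType R[i]) (p : R) (p1 : 1 < p).
Local Notation T := (measurableTypeR R).
Local Notation mu := (@mu10 R).
Local Notation Lpm := (Lp X mu (ltW p1)).
Variables (eta : R -> X -> X) (V : R).
Hypothesis eta_lin : forall t : R, -1 <= t <= 0 -> linear (eta t).
Hypothesis eta_var : forall s : seq R, itv_partition (-1) 0 s ->
    (\sum_(i < size s)
       opnorm (fun x => eta (nth 0 s i) x - eta (nth 0 (-1 :: s) i) x)%R
     <= V%:E)%E.
Variables (A : unbounded_operator X) (lA : linear_operator A).
Variables (l : R[i]) (c q K : R).
Hypotheses (c0 : 0 <= c) (cl : - c <= complex.Re l) (rl : resolvent_set A l).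
Hypotheses (K0 : 0 <= K) (q01 : 0 <= q < 1).
Hypothesis RK : forall y, nrm (resolvent A l y) <= K * nrm y.
Hypothesis Rq : forall y, nrm (Phi_exp eta l (resolvent A l y)) <= q * nrm y.

Let V0 : 0 <= V.
Proof. by apply: eta_variation_ge0 eta_var; rewrite ltrN10. Qed.

Let PhiRB u v : Phi_exp eta l (resolvent A l (u - v)) =
  Phi_exp eta l (resolvent A l u) - Phi_exp eta l (resolvent A l v).
Proof.
have RB : resolvent A l (u - v) = -1 *: resolvent A l v + resolvent A l u.
  by rewrite -(resolvent_linear lA rl) scaleN1r addrC.
by rewrite RB (Phi_expD eta_lin eta_var) (Phi_expZ eta_lin eta_var) scaleN1r addrC.
Qed.

(* In terms of [z = (l - A) x] the equation is the fixed point problem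
   [z = y + Phi_exp l (R(l, A) z)]. *)
Lemma characteristic_equation_exists y : exists x, [/\ op_dom A x,
  l *: x - (op_fun A x + Phi_exp eta l x) = y & nrm x <= K / (1 - q) * nrm y].
Proof.
have /andP[q0 q1] := q01.
have [z zE] := linear_contraction_fixpoint y PhiRB Rq q01.
have [Ax xE] := resolventP z rl.
exists (resolvent A l z); split => //.
  by rewrite opprD addrA xE {1}zE addrK.
rewrite -mulrA (le_trans (RK z))// ler_wpM2l// mulrC ler_pdivlMr ?subr_gt0//.
rewrite mulrBr mulr1 lerBlDr {1}zE (le_trans (nrmD _ _))// lerD2l mulrC.
exact: Rq.
Qed.

(** The difference of the two values of [(l - A) x] is fixed by a linear map of norm at most
    [q < 1], hence zero. *)
Lemma characteristic_equation_uniq x1 x2 : op_dom A x1 -> op_dom A x2 ->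
  l *: x1 - (op_fun A x1 + Phi_exp eta l x1) =
  l *: x2 - (op_fun A x2 + Phi_exp eta l x2) -> x1 = x2.
Proof.
have /andP[q0 q1] := q01.
move=> A1 A2; set z1 := l *: x1 - op_fun A x1; set z2 := l *: x2 - op_fun A x2.
have h1 : resolvent A l z1 = x1 by exact: resolvent_uniq.
have h2 : resolvent A l z2 = x2 by exact: resolvent_uniq.
rewrite !opprD !addrA -/z1 -/z2 => E.
have E2 : z1 - z2 = Phi_exp eta l (resolvent A l (z1 - z2)).
  rewrite PhiRB h1 h2; move/eqP: E; rewrite subr_eq => /eqP ->.
  by rewrite addrAC (addrAC z2) subrr sub0r addrC.
suff z12 : z1 - z2 = 0 by rewrite -h1 -h2 (subr0_eq z12).
apply: nrm_le0; have := Rq (z1 - z2); rewrite -E2 => h.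
rewrite leNgt; apply/negP => n0; move: h; rewrite leNgt => /negP; apply.
by rewrite -[ltRHS]mul1r ltr_pM2r.
Qed.

(** The inner product bounds [x] in terms of the data, [V * expR c] coming from [Phi] on the
    inhomogeneous part of the solution; the added 1 is for [G], and the outer [expR c] passes from
    [x] and [G] to the second component. The point [l] itself does not occur. *)
Definition delay_resolvent_bound : R :=
  expR c * (K / (1 - q) * (1 + V * expR c) + 1).

Local Notation D := (delay_operator (ltW p1) eta A).

Lemma Phi_exp_solution x (G : Lpm) :
  Phi eta (exp_solution l x G) = Phi_exp eta l x + Phi eta (exp_solution l 0 G).
Proof.
rewrite /Phi_exp -(PhiD eta_lin eta_var); last first.
- exact/continuous_subspaceT/exp_solution_continuous.
- exact: within_continuous_exp.
by congr Phi; apply/funext => t; rewrite exp_solutionE.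
Qed.

Lemma delay_equation_exists (y : X) (G : Lpm) : exists u : X * Lpm,
  [/\ op_dom D u, l *: u - op_fun D u = (y, G) &
      nrm u <= delay_resolvent_bound * nrm ((y, G) : X * Lpm)].
Proof.
have /andP[q0 q1] := q01.
have e1 : 1 <= expR c by rewrite -expR0 ler_expR.
(* The part of [Phi F] that depends on [G] alone is moved to the right side; what is left is the
   characteristic equation for [x]. *)
pose y' := y + Phi eta (exp_solution l 0 G).
have [x [Ax xE xy]] := characteristic_equation_exists y'.
have [F [FW FG Fr]] := exp_solution_exists x G c0 cl.
have [Frr Fe] := continuous_rep_eq Fr.
have FD := weak_derivative_eq FW.
have PhiF : Phi eta (continuous_rep F) =
    Phi_exp eta l x + Phi eta (exp_solution l 0 G).
  rewrite -Phi_exp_solution; exact: (Phi_ext eta_lin eta_var Frr.1 Fr.1 Fe).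
exists (x, F); split => /=.
- split => //; first by exists (l *: F - G).
  by rewrite Fe ?exp_solution0// lerN10 lexx.
- congr pair; last by rewrite FD subKr.
  change (l *: x - (op_fun A x + Phi eta (continuous_rep F)) = y).
  by rewrite PhiF addrA opprD addrA xE /y' addrK.
rewrite !nrm_prod /=; set N := Num.max (nrm y) (nrm G).
have N0 : 0 <= N by rewrite le_max nrm_ge0.
pose B := K / (1 - q) * (1 + V * expR c).
have Kq0 : 0 <= K / (1 - q) by rewrite divr_ge0// subr_ge0 ltW.
have B0 : 0 <= B by apply: mulr_ge0 => //; rewrite addr_ge0// mulr_ge0 ?expR_ge0.
have xB : nrm x <= B * N.
  rewrite (le_trans xy)// /B -[leRHS]mulrA ler_wpM2l//.
  rewrite (le_trans (nrmD _ _))// mulrDl mul1r lerD ?le_max ?lexx//.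
  rewrite -mulrA; apply: (Phi_le eta_lin eta_var).
    exact/continuous_subspaceT/exp_solution_continuous.
  move=> t tI; rewrite (le_trans (exp_solution_le 0 G c0 cl tI))// nrm0 add0r.
  by rewrite ler_wpM2l ?expR_ge0// le_max lexx orbT.
rewrite /delay_resolvent_bound -/B -mulrA mulrDl mul1r ge_max; apply/andP; split.
  rewrite (le_trans xB)// -[leLHS]mul1r; apply: ler_pM => //; last by rewrite lerDl.
  exact: mulr_ge0.
rewrite (le_trans FG)// ler_wpM2l ?expR_ge0// lerD// le_max lexx orbT//.
Qed.

(** Both second components solve the same first-order equation, so each is the exponential solution
    determined by its value at 0. The contributions of [G] under [Phi] then cancel, and the first
    components satisfy the same characteristic equation. *)
Lemma delay_equation_uniq (u v : X * Lpm) : op_dom D u -> op_dom D v ->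
  l *: u - op_fun D u = l *: v - op_fun D v -> u = v.
Proof.
case: u => x1 F1; case: v => x2 F2 /= [A1 W1 r1] [A2 W2 r2] E.
have E1 := congr1 fst E; have E2 := congr1 snd E; rewrite /= in E1 E2.
pose G := l *: F1 - weak_derivative F1.
have wd (F : Lpm) : W1p F -> l *: F - weak_derivative F = G ->
    is_weak_derivative F (l *: F - G).
  move=> W <-; rewrite opprB addrC subrK.
  exact: (@getPex _ (is_weak_derivative F) W).
have rep (F : Lpm) x : W1p F -> l *: F - weak_derivative F = G ->
    continuous_rep F 0 = x -> is_continuous_rep F (exp_solution l x G) /\
    Phi eta (continuous_rep F) = Phi_exp eta l x + Phi eta (exp_solution l 0 G).
  move=> W FG Fx; have [x' h] := exp_solution_uniq (wd F W FG).
  have [Frr Fe] := continuous_rep_eq h.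
  have t0 : -1 <= (0 : R) <= 0 by rewrite lerN10 lexx.
  have xx' : x' = x.
    exact: (etrans (esym (exp_solution0 l x' G)) (etrans (esym (Fe 0 t0)) Fx)).
  rewrite -xx'; split; first exact: h.
  rewrite -Phi_exp_solution; exact: (Phi_ext eta_lin eta_var Frr.1 h.1 Fe).
have [h1 P1] := rep F1 x1 W1 erefl r1.
have [h2 P2] := rep F2 x2 W2 (esym E2) r2.
have E3 : l *: x1 - (op_fun A x1 + Phi eta (continuous_rep F1)) =
    l *: x2 - (op_fun A x2 + Phi eta (continuous_rep F2)) by exact: E1.
have E4 : l *: x1 - (op_fun A x1 + Phi_exp eta l x1) =
    l *: x2 - (op_fun A x2 + Phi_exp eta l x2).
  by move: E3; rewrite P1 P2 !opprD !addrA => /addIr.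
have x12 := characteristic_equation_uniq A1 A2 E4.
rewrite -x12 in h2 *; congr pair; apply: Lp_ext.
by apply: filterS2 h1.2 h2.2 => t -> ->.
Qed.

Lemma delay_resolvent : resolvent_set D l /\
  (opnorm (resolvent D l) <= delay_resolvent_bound%:E)%E.
Proof.
have RD w : op_dom D (resolvent D l w) /\ l *: resolvent D l w - op_fun D (resolvent D l w) = w.
  case: w => y G; have [u [Du uE _]] := delay_equation_exists y G.
  by apply: (@getPex _ [set u | op_dom D u /\ l *: u - op_fun D u = (y, G)]); exists u.
have C0 : 0 <= delay_resolvent_bound.
  have /andP[q0 q1] := q01.
  rewrite mulr_ge0 ?expR_ge0// addr_ge0// mulr_ge0//.
    by rewrite divr_ge0// subr_ge0 ltW.
  by rewrite addr_ge0// mulr_ge0 ?expR_ge0.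
have RC : (opnorm (resolvent D l) <= delay_resolvent_bound%:E)%E.
  apply: ge_ereal_sup => _ [[y G] /= w1 <-]; rewrite lee_fin.
  have [u [Du uE uC]] := delay_equation_exists y G.
  have [DR RE] := RD (y, G).
  rewrite (delay_equation_uniq DR Du (etrans RE (esym uE))) (le_trans uC)//.
  by rewrite ler_piMr.
split; last exact: RC.
split; last exact: (le_lt_trans RC (ltry _)).
split; first by [].
- by move=> u v /set_mem Du /set_mem Dv; exact: delay_equation_uniq.
- by move=> w _; have [DR RE] := RD w; exists (resolvent D l w).
Qed.

End delay_resolvent.

(** * From uniform resolvent bounds to s_0 and back *)

Section s0_bounds.
Context {R : realType}.

Lemma ereal_sup_nneg_fin (I : Type) (D : set I) (f : I -> \bar R) (i : I) :
  D i -> (forall j, (0 <= f j)%E) -> (ereal_sup [set f j | j in D] < +oo)%E ->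
  exists2 K : R, 0 <= K & ereal_sup [set f j | j in D] = K%:E.
Proof.
move=> Di f0 foo; set S := ereal_sup _ in foo *.
have S0 : (0 <= S)%E by apply: (le_trans (f0 i)); apply: ereal_sup_ubound; exists i.
have SE : (fine S)%:E = S by rewrite fineK// ge0_fin_numE.
by exists (fine S); rewrite ?fine_ge0.
Qed.

Lemma s0_lt (V : normedModType R[i]) (G : unbounded_operator V) (a : R) :
  linear_operator G -> (s0 G < a%:E)%E -> exists w K : R, [/\ w < a, 0 <= K,
    forall l, w < complex.Re l -> resolvent_set G l &
    forall l y, w < complex.Re l -> nrm (resolvent G l y) <= K * nrm y].
Proof.
move=> lG /ereal_inf_lt[_ [w [rho Goo] <-]]; rewrite lte_fin => wa.
(* A point of the half plane is named because the supremum over an empty set would be minus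
   infinity. *)
have [||K K0 KE] := ereal_sup_nneg_fin (i := (w + 1)%:C) _ _ Goo.
- by rewrite /= ltrDl.
- by move=> l; exact: opnorm_ge0.
exists w, K; split => // l y wl.
move: y; apply/opnorm_ubP => //.
  exact: scalable_linear (resolvent_linear lG (rho l wl)).
by rewrite -KE; apply: ereal_sup_ubound; exists l.
Qed.

Lemma s0_le (V : normedModType R[i]) (G : unbounded_operator V) (w C : R) :
  (forall l, w < complex.Re l ->
    resolvent_set G l /\ (opnorm (resolvent G l) <= C%:E)%E) -> (s0 G <= w%:E)%E.
Proof.
move=> h; apply: ereal_inf_lbound; exists w => //; split; first by move=> l /h[].
apply: (@le_lt_trans _ _ C%:E); last exact: ltry.
by apply: ge_ereal_sup => _ [l /= /h[_ lC] <-].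
Qed.

End s0_bounds.

(** * Perturbation of the bounds to the left of alpha *)

Theorem theorem4p2 (R : realType) (X : completeNormedModType R[i])
    (p : R) (p1 : 1 < p)
    (A : unbounded_operator X) (A_generator : is_generator A)
    (eta : R -> X -> X)
    (eta_bounded : forall t, -1 <= t <= 0 -> bounded_operator (eta t))
    (eta_BV : bounded_variation_op (-1) 0 eta)
    (s0A : (s0 A < 0)%E)
    (alpha : R) (alpha_gt : (s0 A < alpha%:E)%E) (alpha_le : alpha <= 0) :
  (ereal_sup [set opnorm (Phi_exp eta (alpha +i* omega)%C) | omega in setT] <
   1 / ereal_sup [set opnorm (resolvent A (alpha +i* omega)%C) |
         omega in setT])%E ->
  (s0 (delay_operator (ltW p1) eta A) < alpha%:E)%E /\ alpha <= 0.
Proof.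
move=> small; split => //.
have lA := generator_linear A_generator.
have [w0 [K [wa K0 rho RK]]] := s0_lt lA alpha_gt.
have eta_lin t : -1 <= t <= 0 -> linear (eta t) by move=> /eta_bounded[].
have [V eta_var] := eta_BV.
have V0 : 0 <= V by apply: eta_variation_ge0 eta_var; rewrite ltrN10.
(* The added 1 keeps the real part above [- c] after a move of length at most 1 to the left of
   [alpha]. *)
pose c := `|alpha| + 1; have c0 : 0 <= c by rewrite addr_ge0.
have ac : - `|alpha| <= alpha by rewrite lerNl -normrN ler_norm.
pose V' := V * expR c; have V'0 : 0 <= V' by rewrite mulr_ge0 ?expR_ge0.
have PZ l b x : Phi_exp eta l (b *: x) = b *: Phi_exp eta l x.
  exact: (Phi_expZ eta_lin eta_var).
have RZ l b x : w0 < complex.Re l -> resolvent A l (b *: x) = b *: resolvent A l x.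
  by move=> /rho rl; exact: (scalable_linear (resolvent_linear lA rl)).
have Pfin : (ereal_sup [set opnorm (Phi_exp eta (alpha +i* w)) | w in setT] < +oo)%E.
  apply: (@le_lt_trans _ _ V'%:E); last exact: ltry.
  apply: ge_ereal_sup => _ [w _ <-]; apply/opnorm_ubP => // x.
  by rewrite -mulrA (Phi_exp_le eta_lin eta_var)//= /c; lra.
have Rfin : (ereal_sup [set opnorm (resolvent A (alpha +i* w)) | w in setT] < +oo)%E.
  apply: (@le_lt_trans _ _ K%:E); last exact: ltry.
  by apply: ge_ereal_sup => _ [w _ <-]; apply/opnorm_ubP => // *; [exact: RZ|exact: RK].
have [m m0 mE] := ereal_sup_nneg_fin (i := 0) I (fun w => opnorm_ge0 _) Pfin.
have [M M0 ME] := ereal_sup_nneg_fin (i := 0) I (fun w => opnorm_ge0 _) Rfin.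
have mM1 : m * M < 1.
  (* For [M = 0] the quotient [1 / M] is not consulted: the product [m * M] is then zero. *)
  move: small; rewrite mE ME; have [->|Mn0] := eqVneq M 0; first by rewrite mulr0.
  by rewrite inver (negbTE Mn0) mul1e lte_fin -ltr_pdivlMr ?div1r// lt_neqAle eq_sym Mn0.
have Pline w x : nrm (Phi_exp eta (alpha +i* w) x) <= m * nrm x.
  move: x; apply/opnorm_ubP => //.
  by rewrite -mE; apply: ereal_sup_ubound; exists w.
have Rline w x : nrm (resolvent A (alpha +i* w) x) <= M * nrm x.
  move: x; apply/opnorm_ubP => //; first by move=> *; exact: RZ.
  by rewrite -ME; apply: ereal_sup_ubound; exists w.
have Phalf a w x : alpha <= a -> nrm (Phi_exp eta (a +i* w) x) <= m * nrm x.
  by move=> aa; apply: (Phi_exp_half_plane eta_lin eta_var (a := alpha)).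
have Rhalf a w x : alpha <= a -> nrm (resolvent A (a +i* w) x) <= M * nrm x.
  by move=> aa; apply: (resolvent_half_plane lA K0 rho RK wa).
(* For [d <= 1] the product [(m + d * V') * (M + d * K ^+ 2)] is at most [m * M + d * E]; the next
   constant [e] is chosen so that [d <= e] uses up at most half of the gap [1 - m * M]. *)
pose E := m * K ^+ 2 + V' * M + V' * K ^+ 2.
have K20 : 0 <= K ^+ 2 by exact: exprn_ge0.
have E0 : 0 <= E by rewrite !addr_ge0// mulr_ge0.
pose e := (1 - m * M) / (2 * (E + 1)).
have e0 : 0 < e by rewrite divr_gt0 ?subr_gt0// mulr_gt0// ltr_wpDl.
(* The three bounds serve, in order, to control [d ^+ 2] by [d] and stay above [- c], to stay in the
   half plane where the resolvent of [A] is bounded by [K], and to keep the contraction factor below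
   1. *)
pose d := Num.min 1 (Num.min ((alpha - w0) / 2) e).
have d0 : 0 < d by rewrite !lt_min ltr01 e0 divr_gt0// subr_gt0.
have d1 : d <= 1 by rewrite ge_min lexx.
have dw : w0 < alpha - d.
  have : d <= (alpha - w0) / 2 by rewrite !ge_min lexx orbT.
  lra.
have de : d * E <= (1 - m * M) / 2.
  have : d <= e by rewrite !ge_min lexx !orbT.
  rewrite /e ler_pdivlMr ?mulr_gt0 ?ltr_wpDl//; nra.
pose q := (m + d * V') * (M + d * K ^+ 2).
have q1 : q < 1.
  have : d * d * (V' * K ^+ 2) <= d * (V' * K ^+ 2).
    by rewrite ler_wpM2r ?mulr_ge0// ler_piMl// ltW.
  move: de mM1; rewrite /q /E; lra.
have q0 : 0 <= q by rewrite mulr_ge0// addr_ge0// mulr_ge0// ltW.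
(* The comparison point has the same imaginary part as [l], with its real part pushed to the right
   up to [alpha] if necessary; there the bounds [m] and [M] hold, and the Lipschitz estimates bring
   them back to [l]. *)
have nearby (l : R[i]) : alpha - d < complex.Re l -> exists2 a, alpha <= a &
    - c <= a /\ `|complex.Re l - a| <= d.
  move=> al; exists (Num.max alpha (complex.Re l)); first by rewrite le_max lexx.
  rewrite le_max /c; split; first by apply/orP; left; lra.
  case: (leP alpha (complex.Re l)) => h.
    by rewrite subrr normr0 ltW.
  by rewrite ltr0_norm ?subr_lt0// opprB lerBlDr -lerBlDl ltW.
have Rq l y : alpha - d < complex.Re l ->
    nrm (Phi_exp eta l (resolvent A l y)) <= q * nrm y.
  move=> al; have [a aa [ca ad]] := nearby l al; have cl : - c <= complex.Re l by rewrite /c; lra.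
  case: l al ad cl => b w /= al ad cb.
  have Pl x : nrm (Phi_exp eta (b +i* w) x) <= (m + d * V') * nrm x.
    rewrite -(subrK (Phi_exp eta (a +i* w) x) (Phi_exp eta (b +i* w) x)).
    rewrite (le_trans (nrmD _ _))// mulrDl addrC lerD ?Phalf//.
    rewrite (le_trans (Phi_exp_lipschitz eta_lin eta_var _ _ c0 cb ca))//.
    rewrite /V' !mulrA ler_wpM2r ?nrm_ge0// -[leRHS]mulrA [leRHS]mulrC.
    by rewrite ler_wpM2l// mulr_ge0 ?expR_ge0.
  have Rl : nrm (resolvent A (b +i* w) y) <= (M + d * K ^+ 2) * nrm y.
    rewrite -(subrK (resolvent A (a +i* w) y) (resolvent A (b +i* w) y)).
    rewrite (le_trans (nrmD _ _))// mulrDl addrC lerD ?Rhalf//.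
    rewrite (le_trans (resolvent_lipschitz lA K0 rho RK _ _ _))//=; first exact: lt_trans al.
      exact: lt_le_trans aa.
    rewrite ler_wpM2r ?nrm_ge0// ler_wpM2r//.
    have -> : (b +i* w) - (a +i* w) = (b - a)%:C.
      by apply/eqP; rewrite eq_complex /= subrr !eqxx.
    by rewrite nrm_real.
  by rewrite (le_trans (Pl _))// /q -mulrA ler_wpM2l// addr_ge0// mulr_ge0// ltW.
have ds : ((alpha - d)%:E < alpha%:E)%E by rewrite lte_fin gtrBl.
apply: (le_lt_trans _ ds).
apply: (@s0_le _ _ _ _ (delay_resolvent_bound V c q K)) => l al.
have wl := lt_trans dw al.
have cl : - c <= complex.Re l by rewrite /c; lra.
have q01 : 0 <= q < 1 by rewrite q0.
apply: (delay_resolvent p1 eta_lin eta_var lA c0 cl (rho l wl) K0 q01).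
  by move=> y; exact: RK.
by move=> y; exact: Rq.
Qed.
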